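(* For a numerical contraction $F\in M_d(\mathbb C)$, the set $$\mathcal W_F=\{(s,p)\in\mathbb C^2:\det(F^*+pF-sI)=0\}=\{(s,p)\in\mathbb C^2:(s,p)\in\sigma(F^*+pF,pI)\}$$ is an algebraic variety that always intersects $\Gamma$. Moreover, the following are equivalent: (1) $\mathcal W_F$ is a distinguished variety; (2) $F$ is completely non-unitary, or equivalently, $\sigma(F)\cap\mathbb T=\emptyset$; (3) $\mathcal W_F\subset\pi(\mathbb D^2\cup\mathbb T^2\cup\mathbb E^2)$, where $\mathbb E=\mathbb C\setminus\overline{\mathbb D}$; (4) every irreducible component of $\mathcal W_F$ intersects $\mathbb G$. Conversely, if $\mathcal W$ is any distinguished variety such that each of its irreducible components meets $\mathbb G$, then there exists a completely non-unitary numerical contraction $F$ (a square complex matrix of some size) such that $\mathcal W=\mathcal W_F$.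
   Context: $M_d(\mathbb C)$ is the algebra of $d\times d$ complex matrices. $F$ is a numerical contraction if $\nu(F)=\sup\{|\langle Fh,h\rangle|:\|h\|=1\}\le1$. $\sigma(F)$ is the spectrum of $F$, and $\sigma(A,B)$ denotes the joint spectrum (set of joint eigenvalues) of a commuting pair of matrices $(A,B)$. A matrix is completely non-unitary if it has no nonzero reducing subspace on which it is unitary. $\mathbb D$ is the open unit disk, $\mathbb T$ the unit circle, and $\pi:\mathbb C^2\to\mathbb C^2$ is $\pi(z_1,z_2)=(z_1+z_2,z_1z_2)$. $\mathbb G=\pi(\mathbb D^2)$ is the symmetrized bidisk, $\Gamma=\pi(\overline{\mathbb D}^2)$ its closure, $\partial\mathbb G$ its topological boundary, and $b\mathbb G=\pi(\mathbb T^2)$ its distinguished boundary. A distinguished variety is the zero set $Z(\xi)\subset\mathbb C^2$ of a polynomial $\xi$ in two variables such that $Z(\xi)\cap\mathbb G\ne\emptyset$ and $Z(\xi)\cap\partial\mathbb G=Z(\xi)\cap b\mathbb G$. *)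

(* Defs.v *)
From HB Require Import structures.
From mathcomp Require Import all_boot all_order all_algebra.
From mathcomp Require Import spectral complex.
From mathcomp Require Import all_classical all_reals all_analysis.

Set Implicit Arguments.
Unset Strict Implicit.
Unset Printing Implicit Defensive.

Import Order.TTheory GRing.Theory Num.Theory.
Import numFieldNormedType.Exports.

Local Open Scope ring_scope.
Local Open Scope classical_set_scope.
Local Open Scope sesquilinear_scope.

(* The field of complex numbers is [R[i]], with [R] any model of the reals.
   Moduli [`|z|] live in [R[i]] itself; [Normc.normc z : R] is the same number. *)

Section Matrices.
Variables (R : realType) (d : nat).
Local Notation C := R[i].
Implicit Types (F A B : 'M[C]_d) (h : 'cV[C]_d).

Definition inner (u v : 'cV[C]_d) : C := (v ^t* *m u) 0 0.

Definition vnorm h : C := sqrtC (inner h h).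

Definition numerical_radius F : \bar R :=
  ereal_sup [set (Normc.normc (inner (F *m h) h))%:E | h in [set h | vnorm h = 1]].

Definition numerical_contraction F := (numerical_radius F <= 1%:E)%E.

Definition spectrum F : set C := [set z | F - z%:M \notin unitmx].

Definition joint_spectrum A B : set (C * C) :=
  [set z | exists h, [/\ h != 0, A *m h = z.1 *: h & B *m h = z.2 *: h]].

Definition reducing F (V : {vspace 'cV[C]_d}) :=
  forall h, h \in V -> F *m h \in V /\ F ^t* *m h \in V.

(* On a reducing subspace V, the adjoint of F|V is F^*|V. *)
Definition unitary_on F (V : {vspace 'cV[C]_d}) :=
  forall h, h \in V -> F ^t* *m (F *m h) = h /\ F *m (F ^t* *m h) = h.

Definition completely_nonunitary F :=
  forall V : {vspace 'cV[C]_d}, reducing F V -> unitary_on F V -> V = 0%VS.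

Definition W_of F : set (C * C) :=
  [set sp | \det (F ^t* + sp.2 *: F - sp.1%:M) = 0].

End Matrices.

Section SymmetrizedBidisk.
Variable R : realType.
Local Notation C := R[i].

Definition disk : set C := [set z | `|z| < 1].
Definition closed_disk : set C := [set z | `|z| <= 1].
Definition circle : set C := [set z | `|z| = 1].
Definition exterior_disk : set C := [set z | 1 < `|z|].

Definition symm (z : C * C) : C * C := (z.1 + z.2, z.1 * z.2).

Definition G : set (C * C) := symm @` (disk `*` disk).
Definition Gamma : set (C * C) := symm @` (closed_disk `*` closed_disk).
Definition bG : set (C * C) := symm @` (circle `*` circle).

End SymmetrizedBidisk.

Definition boundary (K : numFieldType) (A : set (K * K)) : set (K * K) :=
  closure A `\` interior A.

Arguments disk {R}.
Arguments closed_disk {R}.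
Arguments circle {R}.
Arguments exterior_disk {R}.
Arguments G {R}.
Arguments Gamma {R}.
Arguments bG {R}.

Section Varieties.
Variable R : realType.
Local Notation C := R[i].
Implicit Types (W V : set (C * C)) (xi : {poly {poly C}}).

(* A polynomial in two variables is a polynomial in the first variable whose
   coefficients are polynomials in the second one. *)
Definition zero_set xi : set (C * C) := [set z | xi.[z.1%:P].[z.2] = 0].

Definition algebraic_variety W := exists xi, W = zero_set xi.

Definition distinguished_variety W :=
  exists xi, [/\ W = zero_set xi, zero_set xi `&` G !=set0 &
                 zero_set xi `&` boundary G = zero_set xi `&` bG].

Definition zariski_closed W :=
  exists S : set {poly {poly C}}, W = \bigcap_(xi in S) zero_set xi.

Definition irreducible_closed V :=
  [/\ zariski_closed V, V !=set0 &
      forall A B, zariski_closed A -> zariski_closed B ->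
        V = A `|` B -> V = A \/ V = B].

Definition irreducible_component W V :=
  [/\ irreducible_closed V, V `<=` W &
      forall V', irreducible_closed V' -> V `<=` V' -> V' `<=` W -> V' = V].

End Varieties.

(* Main.v *)
(* Put s = z1 + z2 and p = z1 z2. If (F^* + p F) h = s h, then s = conj(a) + p a with
   a = <F h, h> / <h, h>, |a| <= 1, which forces z1 and z2 onto the same side of the
   unit circle unless |a| = 1. In the latter case h is an eigenvector of F and F^*,
   with unimodular eigenvalue z, and W_F contains the line s = conj(z) + p z, which
   misses G and meets its boundary outside bG.

   Conversely, let W = Z(f) be distinguished. As f has no zero with |z1| = 1 and
   |p| < 1, the power sums over the roots s of f(., p) in the fibre of G are
   holomorphic in p, and by reflection across the circle they are polynomials. Hence
   W = Z(g) with g monic in s; choose it of minimal degree d. Over |p| = 1 its roots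
   satisfy s = p conj(s) and |s| <= 2. On C[s,p], let <u, v> be the integral over
   |p| = 1 of the sum of u conj(v) over the roots of g(., p). Multiplication by p is
   an isometry P, multiplication by s is an operator S with S = S^* P, and
   C[s,p]/(g, p) has dimension d, so that S acts on the wandering subspace of P as
   F^* + P F. Point evaluations at the zeros of g over the disk are bounded because the
   discriminant of g does not vanish identically; they are eigenvectors, and therefore
   g(s, p) = det(s - F^* - p F). Finally |s| <= 2 over |p| = 1 bounds the norm of the
   real parts of c F, |c| = 1, by 1, i.e. makes F a numerical contraction. *)

From HB Require Import structures.
Require Import Defs.
From mathcomp Require Import all_boot all_order all_algebra.
From mathcomp Require Import spectral complex.
From mathcomp Require Import all_classical all_reals all_analysis.
From mathcomp Require Import ring zify.
From mathcomp Require cyclic separable cyclotomic qpoly.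

Set Implicit Arguments.
Unset Strict Implicit.
Unset Printing Implicit Defensive.

Import Order.TTheory GRing.Theory Num.Theory.
Import numFieldNormedType.Exports.

Local Open Scope ring_scope.
Local Open Scope classical_set_scope.
Local Open Scope sesquilinear_scope.

(** Finite means replace complex analysis and completions. Holomorphic on the disk means uniformly
    approximable by polynomials on each smaller disk. Integrals over the circle are averages over
    M-th roots of unity: exact on trigonometric polynomials for large M, and with a geometric error
    on the rational functions that count roots. The form on C[s,p] has null vectors, such as the
    multiples of g, and the space is incomplete, so a projection onto the wandering subspace need
    not exist. Near-minimizers of the norm over classes of C[s,p]/(g, p) stand for it, identities
    hold up to errors of order 1/n, and only bounded sequences of numbers pass to a limit. What
    survives is the matrix A of multiplication by s modulo (g, p) and a Gram matrix K; a
    factorization K = Y^* Y turns the adjoint of A for K into the ordinary one. Minimality of d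
    enters through the discriminant. Its being nonzero bounds the coordinates modulo (g, p), which
    keeps K definite, and gives d distinct eigenvalues over almost every p, enough to recognize the
    characteristic polynomial. *)

(** * Divisibility, Gauss' lemma and a Nullstellensatz for polynomials in two variables *)

Section BivariatePolynomials.
Variable C : closedFieldType.
Implicit Types (f g h a b : {poly {poly C}}) (c r : {poly C}).

Definition fibre (p : C) : {poly {poly C}} -> {poly C} :=
  map_poly (horner_eval p).

HB.instance Definition _ (p : C) := GRing.RMorphism.on (fibre p).

Lemma fibreE f (s p : C) : (fibre p f).[s] = f.[s%:P].[p].
Proof.
rewrite /fibre.
have {1}-> : s = horner_eval p s%:P by rewrite /horner_eval hornerC.
by rewrite horner_map.
Qed.

Lemma coef_fibre f p i : (fibre p f)`_i = (f`_i).[p].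
Proof. by rewrite /fibre coef_map. Qed.

Lemma fibreC c p : fibre p c%:P = (c.[p])%:P.
Proof. by rewrite /fibre map_polyC. Qed.

Lemma fibreX p : fibre p 'X = 'X.
Proof. by rewrite /fibre map_polyX. Qed.

Lemma size_fibre f p : (lead_coef f).[p] != 0 -> size (fibre p f) = size f.
Proof. by move=> h; rewrite /fibre size_map_poly_id0. Qed.

Lemma lead_coef_fibre f p :
  (lead_coef f).[p] != 0 -> lead_coef (fibre p f) = (lead_coef f).[p].
Proof. by move=> h; rewrite /fibre lead_coef_map_id0 // /horner_eval horner0. Qed.

Lemma fibre_eq0_dvd f p : fibre p f = 0 -> exists f', f = ('X - p%:P)%:P * f'.
Proof.
move=> f0; pose m (c : {poly C}) := c %/ ('X - p%:P).
exists (map_poly m f).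
apply/polyP=> i; rewrite coefCM coef_map_id0 /m ?div0p //.
rewrite mulrC divpK // dvdp_XsubCl rootE.
by have := coef_fibre f p i; rewrite f0 coef0 => <-.
Qed.

(** Passing to the fibre over p lands in a domain, so one of the two factors has a zero fibre
    there. *)
Lemma XsubC_polyC_dvd_mul (p : C) a b f :
  ('X - p%:P)%:P * f = a * b ->
  (exists a', a = ('X - p%:P)%:P * a') \/ (exists b', b = ('X - p%:P)%:P * b').
Proof.
move=> /(congr1 (fibre p)); rewrite !rmorphM /= fibreC hornerXsubC subrr mul0r.
move/esym/eqP; rewrite mulf_eq0 => /orP[/eqP/fibre_eq0_dvd|/eqP/fibre_eq0_dvd].
  by left.
by right.
Qed.

Lemma poly_nonconst_root c : (1 < size c)%N -> exists p : C, root c p.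
Proof. by move=> h; apply/closed_rootP; rewrite neq_ltn h orbT. Qed.

(* Gauss' lemma: since C is algebraically closed, the content c can be split
   off one linear factor at a time. *)
Lemma content_split c f a b : c != 0 -> c%:P * f = a * b ->
  exists c1 c2 a' b',
    [/\ c = c1 * c2, a = c1%:P * a', b = c2%:P * b' & f = a' * b'].
Proof.
have [n] := ubnP (size c); elim: n => // n IHn in c a b * => cn c0 e.
have [s1|s1] := leqP (size c) 1.
  have /size_poly1P[k k0 ck] : size c == 1%N by rewrite eqn_leq s1 size_poly_gt0.
  exists c, 1, (k^-1%:P%:P * a), b; split; rewrite ?mulr1 ?mul1r //.
    by rewrite ck mulrA -polyCM -polyCM divff // mul1r.
  by rewrite -mulrA -e ck mulrA -polyCM -polyCM mulVf // mul1r.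
have [p /factor_theorem[c' cE]] := poly_nonconst_root s1.
have X0 : ('X - p%:P : {poly C}) != 0 by rewrite polyXsubC_eq0.
have c'0 : c' != 0 by apply: contraNneq c0 => c'0; rewrite cE c'0 mul0r.
have sc' : (size c' < n)%N.
  by move: cn; rewrite cE size_Mmonic ?monicXsubC // size_XsubC addn2.
have e' : ('X - p%:P)%:P * (c'%:P * f) = a * b.
  by rewrite -e cE polyCM mulrA [c'%:P * _]mulrC.
have canc (u v : {poly {poly C}}) : ('X - p%:P)%:P * u = ('X - p%:P)%:P * v -> u = v.
  by apply: mulfI; rewrite polyC_eq0.
have [[a1 aE]|[b1 bE]] := XsubC_polyC_dvd_mul e'.
  have {}e' : c'%:P * f = a1 * b by apply: canc; rewrite e' aE mulrA.
  have [c1 [c2 [a' [b' [h1 h2 h3 h4]]]]] := IHn _ _ _ sc' c'0 e'.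
  exists (('X - p%:P) * c1), c2, a', b'; split=> //.
    by rewrite cE h1; ring.
  by rewrite aE h2 polyCM mulrA.
have {}e' : c'%:P * f = a * b1 by apply: canc; rewrite e' bE mulrCA.
have [c1 [c2 [a' [b' [h1 h2 h3 h4]]]]] := IHn _ _ _ sc' c'0 e'.
exists c1, (('X - p%:P) * c2), a', b'; split=> //.
  by rewrite cE h1; ring.
by rewrite bE h3 polyCM mulrA.
Qed.

Definition divides f g := exists q, g = q * f.

(** The total degree of the lexicographically leading monomial. It is additive on nonzero
    polynomials and vanishes only on constants, so factorizations can be handled by induction on
    it. *)
Definition bidegree f := ((size f).-1 + (size (lead_coef f)).-1)%N.

Lemma bidegreeM f g : f != 0 -> g != 0 ->
  bidegree (f * g) = (bidegree f + bidegree g)%N.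
Proof.
move=> f0 g0; rewrite /bidegree lead_coefM !size_mul ?lead_coef_eq0 //.
have : (0 < size f)%N && (0 < size g)%N by rewrite !size_poly_gt0 f0 g0.
have : (0 < size (lead_coef f))%N && (0 < size (lead_coef g))%N.
  by rewrite !size_poly_gt0 !lead_coef_eq0 f0 g0.
by case: (size f) (size g) (size (lead_coef f)) (size (lead_coef g)) => [|m] [|n] [|k] [|l] //= _ _; rewrite !addnS /= addnACA.
Qed.

Lemma bidegree0 f : f != 0 -> bidegree f = 0%N -> exists2 k : C, k != 0 & f = k%:P%:P.
Proof.
move=> f0 /eqP; rewrite addn_eq0 => /andP[sf sl].
have s1 : size f == 1%N by move: sf f0; rewrite -size_poly_gt0; lia.
have /size_poly1P[c c0 fE] := s1.
have s2 : size c == 1%N.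
  by move: sl c0; rewrite fE lead_coefC -size_poly_gt0; lia.
by have /size_poly1P[k k0 cE] := s2; exists k => //; rewrite fE cE.
Qed.

Lemma bidegree_const (k : C) : bidegree k%:P%:P = 0%N.
Proof. by rewrite /bidegree lead_coefC !size_polyC; case: eqP; case: eqP. Qed.

(** As [bidegree 0 = 0], the first condition excludes zero together with the units. *)
Definition irred f := (0 < bidegree f)%N /\
  forall a b, f = a * b -> bidegree a = 0%N \/ bidegree b = 0%N.

Lemma irred_neq0 f : irred f -> f != 0.
Proof. by case=> + _; apply: contraTneq => ->; rewrite /bidegree lead_coef0 !size_poly0. Qed.

(** Otherwise f has a factor depending on the second variable only, hence is that factor up to a
    constant. *)
Lemma irred_fibre_neq0 f p : irred f -> (1 < size f)%N -> fibre p f != 0.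
Proof.
move=> fi fs; apply/negP => /eqP/fibre_eq0_dvd[f' fE].
have f0 := irred_neq0 fi.
have f'0 : f' != 0 by apply: contraNneq f0 => h; rewrite fE h mulr0.
have [_ /(_ _ _ fE)[h|h]] := fi.
  by move: h; rewrite /bidegree lead_coefC size_XsubC; lia.
have [k k0 f'E] := bidegree0 f'0 h.
by move: fs; rewrite fE f'E -polyCM size_polyC; case: eqP.
Qed.

(** By Gauss' lemma c splits between q and f. A nonconstant share of f would have a root, over which
    the whole fibre of f vanishes. *)
Lemma irred_content f h c q : irred f -> (1 < size f)%N -> c != 0 ->
  c%:P * h = q * f -> divides f h.
Proof.
move=> fi fs c0 e.
have [c1 [c2 [a' [b' [cE _ fE ->]]]]] := content_split c0 e.
have c20 : c2 != 0 by apply: contraNneq c0 => c20; rewrite cE c20 mulr0.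
have s2 : size c2 = 1%N.
  apply/eqP; rewrite eqn_leq size_poly_gt0 c20 andbT leqNgt; apply/negP.
  move=> /poly_nonconst_root[p /eqP rp].
  have /negP[] := irred_fibre_neq0 p fi fs.
  by rewrite fE rmorphM /= fibreC rp mul0r.
have /size_poly1P[k k0 c2E] : size c2 == 1%N by rewrite s2.
exists (a' * k^-1%:P%:P); rewrite fE c2E -mulrA; congr (_ * _).
by rewrite mulrA -!polyCM mulVf // mul1r.
Qed.

(** Over the field C(p) the gcd of f and h is 1 or f. In the first case Bezout's relation, cleared
    of denominators, is the conclusion. *)
Lemma irred_bezout f h : irred f -> (1 < size f)%N -> ~ divides f h ->
  exists a b c, c != 0 /\ a * f + b * h = c%:P.
Proof.
move=> fi fs nfh; have f0 := irred_neq0 fi.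
set d := Pdiv.Idomain.gcdp f h.
have d0 : d != 0 by rewrite Pdiv.Idomain.gcdp_eq0 negb_and f0.
have [sd|sd] := leqP (size d) 1.
  have /size_poly1P[c c0 dE] : size d == 1%N by rewrite eqn_leq sd size_poly_gt0.
  have [[a b] /Pdiv.Idomain.eqpP[[k1 k2] /= /andP[k10 k20]]] := Pdiv.Idomain.Bezoutp f h.
  rewrite -/d dE => e; exists (k1 *: a), (k1 *: b), (k2 * c); split.
    by rewrite mulf_neq0.
  by rewrite -!scalerAl -scalerDr e -mul_polyC polyCM.
(* Now the gcd has positive degree in s. Its primitive part d' divides f, hence equals f up to a
   constant, and the gcd relation for h makes f divide h. *)
exfalso; apply: nfh.
have /Pdiv.Idomain.dvdpP[[k1 q1] /= k10 e1] := Pdiv.Idomain.dvdp_gcdl f h.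
have /Pdiv.Idomain.dvdpP[[k2 q2] /= k20 e2] := Pdiv.Idomain.dvdp_gcdr f h.
rewrite -/d in e1 e2.
move: e1; rewrite -mul_polyC => /(content_split k10)[c1 [c2 [q' [d' [k1E q1E dE fE]]]]].
have d'0 : d' != 0 by apply: contraNneq d0 => d'0; rewrite dE d'0 mulr0.
have q'0 : q' != 0 by apply: contraNneq f0 => q'0; rewrite fE q'0 mul0r.
have sd' : (1 < size d')%N.
  apply: (leq_trans sd); rewrite dE; apply: (leq_trans (size_polyMleq _ _)).
  by rewrite -subn1 leq_subLR leq_add2r size_polyC_leq1.
have [_ /(_ _ _ fE)[bq|bd]] := fi; last first.
  have [k k0 d'E] := bidegree0 d'0 bd.
  by move: sd'; rewrite d'E size_polyC; case: eqP.
have [k k0 q'E] := bidegree0 q'0 bq.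
apply: (irred_content (c := k2 * k%:P) (q := q2 * c2%:P)) => //.
  by rewrite mulf_neq0 // polyC_eq0.
transitivity (k%:P%:P * (k2 *: h)); first by rewrite -mul_polyC polyCM; ring.
by rewrite e2 dE fE q'E; ring.
Qed.

Lemma size1_irred f : irred f -> (size f <= 1)%N ->
  exists p k, k != 0 /\ f = k%:P%:P * ('X - p%:P)%:P.
Proof.
move=> fi fs; have f0 := irred_neq0 fi.
have /size_poly1P[c c0 fE] : size f == 1%N by rewrite eqn_leq fs size_poly_gt0.
have : (1 < size c)%N by case: fi; rewrite fE /bidegree lead_coefC size_polyC c0 /=; lia.
move=> /poly_nonconst_root[p /factor_theorem[c' cE]].
have c'0 : c' != 0 by apply: contraNneq c0 => h; rewrite cE h mul0r.
have [_ /(_ c'%:P ('X - p%:P)%:P)] := fi.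
rewrite fE cE polyCM => /(_ erefl)[|].
  move=> /bidegree0; rewrite polyC_eq0 => /(_ c'0)[k k0 /polyC_inj ->].
  by exists p, k.
by rewrite /bidegree lead_coefC size_XsubC; lia.
Qed.

Lemma irred_prime f g h : irred f -> divides f (g * h) ->
  divides f g \/ divides f h.
Proof.
move=> fi [q e]; have [fs|fs] := ltnP 1 (size f).
  have [|nfg] := pselect (divides f g); [by left | right].
  have [a [b [c [c0 e']]]] := irred_bezout fi fs nfg.
  apply: (irred_content (c := c) (q := a * h + b * q)) => //.
  by rewrite -e' mulrDl -[b * g * h]mulrA e; ring.
have [p [k [k0 fE]]] := size1_irred fi fs.
have e' : ('X - p%:P)%:P * (k%:P%:P * q) = g * h by rewrite e fE; ring.
have [[g' ->]|[h' ->]] := XsubC_polyC_dvd_mul e'; [left; exists (k^-1%:P%:P * g')|right; exists (k^-1%:P%:P * h')].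
  by rewrite fE mulrACA -polyCM -polyCM mulVf // mul1r mulrC.
by rewrite fE mulrACA -polyCM -polyCM mulVf // mul1r mulrC.
Qed.

(** Otherwise the ideal (f, h) contains a nonzero c in C[p]. Over a point p that is no root of c or
    of the leading coefficient, f has a zero, and c would vanish there. *)
Lemma irred_nullstellensatz f h : irred f ->
  (forall s p : C, f.[s%:P].[p] = 0 -> h.[s%:P].[p] = 0) -> divides f h.
Proof.
move=> fi fh; have f0 := irred_neq0 fi; have [fs|fs] := ltnP 1 (size f).
  have [//|nfh] := pselect (divides f h).
  have [a [b [c [c0 e]]]] := irred_bezout fi fs nfh.
  have : lead_coef f * c != 0 by rewrite mulf_neq0 ?lead_coef_eq0.
  move=> /closed_nonrootP[p]; rewrite rootM negb_or => /andP[p1 p2].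
  have [s /rootP] : exists s, root (fibre p f) s.
    by apply: poly_nonconst_root; rewrite size_fibre.
  rewrite fibreE => fs0; have := congr1 (fun u => u.[s%:P].[p]) e.
  rewrite !hornerE /= fs0 fh // !mulr0 addr0 => /esym/eqP.
  by move: p2; rewrite rootE => /negPf->.
have [p [k [k0 fE]]] := size1_irred fi fs.
have /fibre_eq0_dvd[h' ->] : fibre p h = 0.
  apply/eqP; apply: contraT => /closed_nonrootP[s]; rewrite rootE fibreE fh ?eqxx //.
  by rewrite fE hornerM !hornerC hornerM hornerXsubC subrr mulr0.
exists (k^-1%:P%:P * h').
by rewrite fE mulrACA -polyCM -polyCM mulVf // mul1r mulrC.
Qed.

(** Stands for factorization into irreducibles, by strong induction on [bidegree]. *)
Lemma irred_ind (P : {poly {poly C}} -> Prop) f :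
  (forall k : C, k != 0 -> P k%:P%:P) -> (forall f, irred f -> P f) ->
  (forall a b, a != 0 -> b != 0 -> P a -> P b -> P (a * b)) -> f != 0 -> P f.
Proof.
move=> Pk Pi PM; have [n] := ubnP (bidegree f).
elim: n => // n IHn in f * => fn f0.
have [b0|b0] := posnP (bidegree f).
  by have [k k0 ->] := bidegree0 f0 b0; apply: Pk.
have [fi|/not_andP[//|nf]] := pselect (irred f); first exact: Pi.
move/existsNP: nf => [a /existsNP[b /not_implyP[e /not_orP[/eqP ba /eqP bb]]]].
have /andP[a0 b00] : (a != 0) && (b != 0) by rewrite -negb_or -mulf_eq0 -e.
have := bidegreeM a0 b00; rewrite -e => be.
by rewrite e; apply: PM => //; apply: IHn => //; move: ba bb fn; rewrite -!lt0n; lia.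
Qed.

Lemma monic_divisor_lead_coef f g : g \is monic ->
  divides f g -> exists2 k : C, k != 0 & lead_coef f = k%:P.
Proof.
move=> /monicP gm [q e]; have := gm; rewrite e lead_coefM => qf.
have : lead_coef f \is a GRing.unit by apply/unitrP; exists (lead_coef q); split=> //; rewrite mulrC.
rewrite poly_unitE => /andP[/size_poly1P[k k0 ->] _].
by exists k.
Qed.

(** Division with remainder by a monic g commutes with passing to fibres, and the fibre of the
    remainder has too small a degree to be a nonzero multiple of that of g. *)
Lemma monic_divides (A : C -> Prop) g f : g \is monic ->
  (forall h, (forall p, A p -> fibre p h = 0) -> h = 0) ->
  (forall p, A p -> fibre p g %| fibre p f) -> divides g f.
Proof.
move=> gm hA gf; have := Pdiv.RingMonic.rdivp_eq gm f.
have := Pdiv.Ring.ltn_rmodpN0 f (monic_neq0 gm).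
move: (Pdiv.Ring.rdivp f g) (Pdiv.Ring.rmodp f g) => q r sr e.
exists q; rewrite e (hA r) ?addr0 // => p Ap.
have lg : (lead_coef g).[p] != 0 by rewrite (monicP gm) hornerC oner_eq0.
have srp : (size (fibre p r) < size (fibre p g))%N.
  by rewrite (size_fibre lg); apply: (leq_ltn_trans (size_poly _ _)).
have : fibre p g %| fibre p r.
  by have := gf p Ap; rewrite e rmorphD rmorphM /= dvdp_addr // dvdp_mull.
by apply: contraTeq => r0; apply/negP => /(dvdp_leq r0); rewrite leqNgt srp.
Qed.

(** The factor is the primitive part of the gcd over C(p). It divides the monic g, so its leading
    coefficient is a constant and can be normalized to 1. *)
Lemma monic_common_factor g h : g \is monic -> h != 0 -> (size h < size g)%N ->
  exists d q a b l, [/\ d \is monic, g = q * d, (size d < size g)%N, l != 0 &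
    a * g + b * h = l%:P * d].
Proof.
move=> gm h0 hs; have g0 : g != 0 by rewrite monic_neq0.
set d := Pdiv.Idomain.gcdp g h.
have d0 : d != 0 by rewrite Pdiv.Idomain.gcdp_eq0 negb_and g0.
have sd : (size d < size g)%N.
  by apply: leq_ltn_trans hs; apply: Pdiv.Idomain.leq_gcdpr.
have [[a b] /Pdiv.Idomain.eqpP[[l1 l2] /= /andP[l10 l20]]] := Pdiv.Idomain.Bezoutp g h.
rewrite -/d => bez.
have /Pdiv.Idomain.dvdpP[[k1 q1] /= k10 e1] := Pdiv.Idomain.dvdp_gcdl g h.
rewrite -/d in e1; clearbody d.
move: e1; rewrite -mul_polyC => /(content_split k10)[c1 [c2 [q' [d' [k1E _ dE gE]]]]].
have c20 : c2 != 0 by apply: contraNneq k10 => e; rewrite k1E e mulr0.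
have dg : divides d' g by exists q'.
have [k k0 ld] := monic_divisor_lead_coef gm dg.
have kk : k%:P%:P * k^-1%:P%:P = 1 :> {poly {poly C}}.
  by rewrite -!polyCM mulfV.
exists (k^-1%:P%:P * d'), (q' * k%:P%:P), (l1 *: a), (l1 *: b), (l2 * c2 * k%:P); split.
- by rewrite monicE lead_coefM lead_coefC ld -polyCM mulVf.
- have -> : q' * k%:P%:P * (k^-1%:P%:P * d') = q' * d' * (k%:P%:P * k^-1%:P%:P) by ring.
  by rewrite kk mulr1.
- by apply: leq_ltn_trans sd; rewrite dE size_Cmul ?polyC_eq0 ?invr_eq0 // size_Cmul.
- by rewrite !mulf_neq0 // polyC_eq0.
- rewrite -!scalerAl -scalerDr bez dE -mul_polyC !polyCM.
  have -> : l2%:P * c2%:P * k%:P%:P * (k^-1%:P%:P * d') =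
    l2%:P * (c2%:P * d') * (k%:P%:P * k^-1%:P%:P) by ring.
  by rewrite kk mulr1.
Qed.

End BivariatePolynomials.

(** * Closure, interior and boundary of the symmetrized bidisk *)

Section BoundaryNorm.
Variable K : numFieldType.

Lemma boundaryP (A : set (K * K)) x : boundary A x <->
  (forall e, 0 < e -> exists y, [/\ A y, `|x.1 - y.1| < e & `|x.2 - y.2| < e]) /\
  ~ (exists2 e, 0 < e & forall y, `|x.1 - y.1| < e -> `|x.2 - y.2| < e -> A y).
Proof.
split=> [[cA nA]|[cA nA]]; split.
- move=> e e0; have [y [Ay [/= b1 b2]]] := cA _ (nbhsx_ballx x e e0).
  by exists y; split.
- move=> [e e0 h]; apply: nA; apply/nbhs_ballP; exists e => //= y [/= b1 b2].
  exact: h.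
- move=> B /nbhs_ballP[e /= e0 eB]; have [y [Ay b1 b2]] := cA e e0.
  by exists y; split=> //; apply: eB; split.
- move=> /nbhs_ballP[e /= e0 eB]; apply: nA; exists e => // y b1 b2.
  by apply: eB; split.
Qed.

End BoundaryNorm.

Section SymmetrizedBidiskGeometry.
Variable R : realType.
Local Notation C := R[i].
Implicit Types (s p z w : C).

Lemma symm_roots s p : exists z1 z2 : C, s = z1 + z2 /\ p = z1 * z2.
Proof.
pose q := sqrtC (s ^+ 2 - 4 * p).
have qE : q ^+ 2 = s ^+ 2 - 4 * p by rewrite sqrtCK.
exists ((s + q) / 2), ((s - q) / 2); split; first by field.
have -> : (s + q) / 2 * ((s - q) / 2) = (s ^+ 2 - q ^+ 2) / 4 by field.
by rewrite qE; field.
Qed.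

Lemma symm_inj z1 z2 w1 w2 : z1 + z2 = w1 + w2 -> z1 * z2 = w1 * w2 ->
  (w1 = z1 /\ w2 = z2) \/ (w1 = z2 /\ w2 = z1).
Proof.
move=> hs hp.
have : (w1 - z1) * (w1 - z2) == 0.
  have -> : (w1 - z1) * (w1 - z2) = w1 ^+ 2 - (z1 + z2) * w1 + z1 * z2 by ring.
  by rewrite hs hp; apply/eqP; ring.
rewrite mulf_eq0 !subr_eq0 => /orP[/eqP e|/eqP e]; [left|right]; split=> //.
  by apply: (addrI w1); rewrite -hs e.
by apply: (addrI w1); rewrite -hs e addrC.
Qed.

Lemma symmP (A B : set C) s p z1 z2 : s = z1 + z2 -> p = z1 * z2 ->
  (@symm R @` (A `*` B)) (s, p) -> (A z1 /\ B z2) \/ (A z2 /\ B z1).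
Proof.
move=> -> -> [[w1 w2] [/= Aw Bw] [h1 h2]].
by have [[? ?]|[? ?]] := symm_inj (esym h1) (esym h2); subst; [left|right].
Qed.

Lemma GP s p z1 z2 : s = z1 + z2 -> p = z1 * z2 ->
  G (s, p) <-> `|z1| < 1 /\ `|z2| < 1.
Proof.
move=> hs hp; split=> [/(symmP hs hp)[[]|[]]//|[h1 h2]].
by exists (z1, z2) => //; rewrite /symm /= hs hp.
Qed.

Lemma GammaP s p z1 z2 : s = z1 + z2 -> p = z1 * z2 ->
  Gamma (s, p) <-> `|z1| <= 1 /\ `|z2| <= 1.
Proof.
move=> hs hp; split=> [/(symmP hs hp)[[]|[]]//|[h1 h2]].
by exists (z1, z2) => //; rewrite /symm /= hs hp.
Qed.

Lemma bGP s p z1 z2 : s = z1 + z2 -> p = z1 * z2 ->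
  bG (s, p) <-> `|z1| = 1 /\ `|z2| = 1.
Proof.
move=> hs hp; split=> [/(symmP hs hp)[[]|[]]//|[h1 h2]].
by exists (z1, z2) => //; rewrite /symm /= hs hp.
Qed.

Lemma closure_G_Gamma (x : C * C) :
  (forall e : C, 0 < e -> exists y, [/\ G y, `|x.1 - y.1| < e & `|x.2 - y.2| < e]) ->
  Gamma x.
Proof.
case: x => s p cx; have [z1 [z2 [hs hp]]] := symm_roots s p.
have key z w : s = z + w -> p = z * w -> `|z| <= 1.
  move=> hzs hzp; rewrite real_leNgt ?normr_real //; apply/negP => z1gt.
  have z0 : 0 < `|z| by apply: lt_trans z1gt.
  (* A root z outside the closed disk is at distance at least |z| - 1 from w1 and w2, so X^2 - s' X
     + p' has modulus at least (|z| - 1)^2 at z. But this value is (s - s') z - (p - p'), of modulus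
     below e (|z| + 1). *)
  pose e := (`|z| - 1) ^+ 2 / (`|z| + 1).
  have e0 : 0 < e by rewrite divr_gt0 ?exprn_gt0 ?subr_gt0 // addr_gt0.
  have [[s' p'] [[[w1 w2] /= [w1d w2d] [es ep]] /= b1 b2]] := cx e e0.
  rewrite -es in b1; rewrite -ep in b2.
  have eq0 : (z - w1) * (z - w2) = (s - (w1 + w2)) * z - (p - w1 * w2).
    by rewrite hzs hzp; ring.
  have low : (`|z| - 1) ^+ 2 <= `|(z - w1) * (z - w2)|.
    rewrite normrM expr2; apply: ler_pM; rewrite ?subr_ge0 ?(ltW z1gt) //.
      apply: le_trans (lerB_dist _ _); rewrite lerB // ltW //.
    by apply: le_trans (lerB_dist _ _); rewrite lerB // ltW.
  have up : `|(z - w1) * (z - w2)| < e * (`|z| + 1).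
    rewrite eq0; apply: le_lt_trans (ler_normB _ _) _.
    rewrite mulrDr mulr1 normrM; apply: ler_ltD => //.
    by rewrite ler_wpM2r // ltW.
  by move: (le_lt_trans low up); rewrite /e divfK ?ltxx // gt_eqF // addr_gt0.
apply/(GammaP hs hp); split; first exact: key hs hp.
by apply: (key z2 z1); rewrite 1?addrC 1?mulrC.
Qed.

Lemma symm_closure_G z1 z2 : `|z1| <= 1 -> `|z2| <= 1 ->
  forall e : C, 0 < e -> exists y,
    [/\ G y, `|z1 + z2 - y.1| < e & `|z1 * z2 - y.2| < e].
Proof.
move=> h1 h2 e e0.
(* The point is approached by (r z1, r z2) in the open bidisk. The minimum with 1 keeps r positive,
   and 1 - r <= e / 8 moves both coordinates by less than e. *)
pose r : C := 1 - Num.min 1 (e / 4) / 2.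
have m0 : 0 < Num.min 1 (e / 4 : C).
  by rewrite /Num.min; case: ifP; rewrite ?ltr01 // divr_gt0.
have er : e / 4 \is Num.real by rewrite gtr0_real // divr_gt0.
have m1 : Num.min 1 (e / 4 : C) <= 1.
  by rewrite /Num.min; case: ifP => // /negbT; rewrite -real_leNgt ?real1.
have m2 : Num.min 1 (e / 4 : C) <= e / 4.
  by rewrite /Num.min; case: ifP => // /ltW.
move: m0 m1 m2 @r; set m := Num.min _ _ => m0 m1 m2 r.
have r1 : r < 1 by rewrite /r gtrBl divr_gt0.
have r0 : 0 < r.
  rewrite /r subr_gt0 ltr_pdivrMr // mul1r; apply: le_lt_trans m1 _.
  by rewrite ltr1n.
have e1 : 1 - r <= e / 8.
  rewrite /r opprB addrC subrK ler_pdivrMr //; apply: le_trans m2 _.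
  by rewrite le_eqVlt; apply/orP; left; apply/eqP; field.
have e4 : e / 8 * 4 < e.
  have -> : e / 8 * 4 = e / 2 by field.
  by rewrite ltr_pdivrMr // ltr_pMr // ltr1n.
exists (symm (r * z1, r * z2)); split=> /=.
  apply/(GP erefl erefl); rewrite /= !normrM (gtr0_norm r0).
  by split; rewrite (le_lt_trans _ r1) // ler_piMr // ltW.
- have -> : z1 + z2 - (r * z1 + r * z2) = (1 - r) * (z1 + z2) by ring.
  rewrite normrM (ger0_norm (x := 1 - r)) ?subr_ge0 ?(ltW r1) //.
  apply: le_lt_trans e4; apply: ler_pM; rewrite ?subr_ge0 ?(ltW r1) //.
  by apply: le_trans (ler_normD _ _) _; apply: (le_trans (lerD h1 h2)); rewrite -[X in X <= _]/(2%:R) ler_nat.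
have -> : z1 * z2 - r * z1 * (r * z2) = (1 - r) * ((1 + r) * (z1 * z2)) by ring.
rewrite normrM (ger0_norm (x := 1 - r)) ?subr_ge0 ?(ltW r1) //.
apply: le_lt_trans e4; apply: ler_pM; rewrite ?subr_ge0 ?(ltW r1) //.
have r2 : 0 <= 1 + r by exact: addr_ge0 ler01 (ltW r0).
rewrite !normrM (ger0_norm r2).
apply: le_trans (_ : 2 * 1 <= 4); last by rewrite mulr1 ler_nat.
apply: ler_pM; rewrite ?mulr_ge0 ?r2 //.
  by rewrite -[2]/(1 + 1) lerD2l ltW.
by rewrite -[1]mulr1; apply: ler_pM.
Qed.

Lemma G_open (x : C * C) : G x ->
  exists2 e : C, 0 < e & forall y, `|x.1 - y.1| < e -> `|x.2 - y.2| < e -> G y.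
Proof.
case=> -[z1 z2] /= [h1 h2] <-; rewrite /disk /= in h1 h2.
(* For |w| >= 1 the product (w - z1) (w - z2) has modulus at least |w|^2 d, so changing the two
   coefficients by less than d / 2 cannot make w a root. *)
pose d := (1 - `|z1|) * (1 - `|z2|).
have d0 : 0 < d by rewrite mulr_gt0 ?subr_gt0.
exists (d / 2) => /=; first by rewrite divr_gt0.
move=> [s p] /= b1 b2.
have [w1 [w2 [hs hp]]] := symm_roots s p.
have key w v : s = w + v -> p = w * v -> `|w| < 1.
  move=> hws hwp; rewrite real_ltNge ?normr_real //; apply/negP => w1gt.
  have w0 : 0 < `|w| by apply: lt_le_trans w1gt.
  have eq0 : (w - z1) * (w - z2) = (z1 * z2 - p) - (z1 + z2 - s) * w.
    by rewrite hws hwp; ring.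
  have lw z : `|z| < 1 -> `|w| * (1 - `|z|) <= `|w - z|.
    move=> zl; apply: le_trans (lerB_dist _ _).
    by rewrite mulrBr mulr1 lerD2l lerN2 ler_peMl.
  have low : `|w| ^+ 2 * d <= `|(w - z1) * (w - z2)|.
    rewrite normrM /d expr2 mulrACA.
    by apply: ler_pM; rewrite ?mulr_ge0 ?subr_ge0 ?(ltW h1) ?(ltW h2) ?lw.
  have up : `|(w - z1) * (w - z2)| < d / 2 * `|w| ^+ 2 + d / 2 * `|w| ^+ 2.
    rewrite eq0; apply: le_lt_trans (ler_normB _ _) _.
    have d2 : 0 <= d / 2 by rewrite divr_ge0 // ltW.
    apply: ltr_leD.
      by apply: lt_le_trans b2 _; rewrite ler_peMr // exprn_ege1.
    rewrite normrM; apply: ler_pM => //; first exact: ltW.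
    by rewrite expr2 ler_peMl.
  move: (le_lt_trans low up).
  have -> : d / 2 * `|w| ^+ 2 + d / 2 * `|w| ^+ 2 = `|w| ^+ 2 * d by field.
  by rewrite ltxx.
apply/(GP hs hp); split; first exact: key hs hp.
by apply: (key w2 w1); rewrite 1?addrC 1?mulrC.
Qed.

Lemma boundary_G_symm z1 z2 : `|z1| = 1 -> `|z2| <= 1 ->
  boundary G (symm (z1, z2)).
Proof.
move=> h1 h2; apply/boundaryP; split; first by apply: symm_closure_G; rewrite ?h1.
move=> [e e0 /(_ (symm (z1, z2)))]; rewrite !subrr normr0 => /(_ e0 e0).
by move/(GP erefl erefl) => [/=]; rewrite h1 ltxx.
Qed.

Lemma boundary_GP (x : C * C) : boundary G x <->
  exists z1 z2, [/\ `|z1| = 1, `|z2| <= 1 & x = symm (z1, z2)].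
Proof.
split=> [/boundaryP[/closure_G_Gamma cx nx]|[z1 [z2 [h1 h2 ->]]]]; last exact: boundary_G_symm.
case: cx nx => -[z1 z2] /= [h1 h2] <- nx; rewrite /closed_disk /= in h1 h2.
have [e1|e1] := eqVneq `|z1| 1; first by exists z1, z2.
have [e2|e2] := eqVneq `|z2| 1.
  by exists z2, z1; split=> //; rewrite /symm /= addrC mulrC.
case: nx; apply: G_open; apply/(GP erefl erefl).
by split; rewrite lt_neqAle ?e1 ?e2.
Qed.

End SymmetrizedBidiskGeometry.

(** * Irreducible components of a plane curve as zero sets of irreducible factors *)

Section IrreducibleComponents.
Variable R : realType.
Local Notation C := R[i].
Implicit Types (f g a b : {poly {poly C}}) (V W : set (C * C)).

Lemma zero_setM a b : zero_set (a * b) = zero_set a `|` zero_set b.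
Proof.
rewrite /zero_set; apply/seteqP; split=> -[s p] /=; rewrite !hornerM.
  by move/eqP; rewrite mulf_eq0 => /orP[]/eqP ?; [left|right].
by case=> ->; rewrite ?mul0r ?mulr0.
Qed.

Lemma zero_set_divides f g : divides f g -> zero_set f `<=` zero_set g.
Proof. by case=> q -> x fx; rewrite zero_setM; right. Qed.

Lemma zero_set_const (k : C) : k != 0 -> zero_set k%:P%:P = set0.
Proof.
move=> k0; apply/seteqP; split=> // -[s p]; rewrite /zero_set /= !hornerC.
by move/eqP; rewrite (negPf k0).
Qed.

Lemma zariski_closed_zero_set f : zariski_closed (zero_set f).
Proof. by exists [set f]; rewrite bigcap_set1. Qed.

Lemma zariski_closedI V W :
  zariski_closed V -> zariski_closed W -> zariski_closed (V `&` W).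
Proof.
move=> [S ->] [T ->]; exists (S `|` T).
apply/seteqP; split=> [x [h1 h2] f [|]|x h]; [exact: h1|exact: h2|].
by split=> f hf; apply: h; [left|right].
Qed.

Lemma irreducible_closed_mul V a b : irreducible_closed V ->
  V `<=` zero_set (a * b) -> V `<=` zero_set a \/ V `<=` zero_set b.
Proof.
move=> [cV _ hV] Vab.
have [] := hV (V `&` zero_set a) (V `&` zero_set b).
- exact: zariski_closedI cV (zariski_closed_zero_set a).
- exact: zariski_closedI cV (zariski_closed_zero_set b).
- by rewrite -setIUr -zero_setM; apply/esym/setIidPl.
- by move=> ->; left; apply: subIsetr.
- by move=> ->; right; apply: subIsetr.
Qed.

Lemma irreducible_closed_factor V f : irreducible_closed V -> f != 0 ->
  V `<=` zero_set f ->
  exists f1, [/\ irred f1, divides f1 f & V `<=` zero_set f1].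
Proof.
move=> iV f0; elim/irred_ind: f0 => [k k0|g ig|a b a0 b0 IHa IHb] Vf.
- case: iV => _ [x /Vf]; by rewrite zero_set_const.
- by exists g; split=> //; exists 1; rewrite mul1r.
- have [/IHa|/IHb] := irreducible_closed_mul iV Vf => -[f1 [i1 [q ->] h1]];
    exists f1; split=> //.
    by exists (q * b); ring.
  by exists (a * q); ring.
Qed.

Lemma zero_set_factor f (x : C * C) : f != 0 -> zero_set f x ->
  exists f1, [/\ irred f1, divides f1 f & zero_set f1 x].
Proof.
move=> f0; elim/irred_ind: f0 => [k k0|g ig|a b a0 b0 IHa IHb].
- by rewrite zero_set_const.
- by move=> gx; exists g; split=> //; exists 1; rewrite mul1r.
- rewrite zero_setM => -[/IHa|/IHb] -[f1 [i1 [q ->] h1]]; exists f1; split=> //.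
    by exists (q * b); ring.
  by exists (a * q); ring.
Qed.

Lemma irred_zero_set_sub f g :
  irred f -> zero_set f `<=` zero_set g -> divides f g.
Proof.
by move=> fi fg; apply: irred_nullstellensatz => // s p h; apply: (fg (s, p)).
Qed.

(** An empty zero set would make f divide 1, by the Nullstellensatz. If neither A nor B is all of
    Z(f), each has a defining polynomial not divisible by f; the product vanishes on Z(f), against
    primality. *)
Lemma irred_irreducible_closed f : irred f -> irreducible_closed (zero_set f).
Proof.
move=> fi; split; first exact: zariski_closed_zero_set.
  apply/set0P/negP => /eqP f0.
  have [q e] : divides f 1 by apply: irred_zero_set_sub => //; rewrite f0.
  have q0 : q != 0.
    by apply/eqP => q0; move/eqP: e; rewrite q0 mul0r; apply/negP/oner_neq0.
  have := bidegree_const (1 : C).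
  by rewrite !polyC1 e (bidegreeM q0 (irred_neq0 fi)); case: fi; lia.
move=> A B [S ->] [T ->] e.
have [h|/existsNP[g /not_implyP[gS ng]]] := pselect (forall g, S g -> divides f g).
  left; apply/seteqP; split=> [x fx g gS|]; last by rewrite [X in _ `<=` X]e; left.
  exact: zero_set_divides (h g gS) x fx.
have [h|/existsNP[g' /not_implyP[gT ng']]] := pselect (forall g, T g -> divides f g).
  right; apply/seteqP; split=> [x fx g' gT|]; last by rewrite [X in _ `<=` X]e; right.
  exact: zero_set_divides (h g' gT) x fx.
have : divides f (g * g').
  apply: irred_zero_set_sub => //; rewrite zero_setM e.
  by move=> x [h|h]; [left|right]; exact: h.
by case/(irred_prime fi).
Qed.

Lemma irred_divides_zero_set f g : irred f -> irred g -> divides f g ->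
  zero_set g = zero_set f.
Proof.
move=> [fb _] [gb gi] [q e]; have [bq|] := gi _ _ e; last by lia.
have q0 : q != 0.
  by apply: contraTneq gb => q0; rewrite e q0 mul0r /bidegree lead_coef0 !size_poly0.
have [k k0 qE] := bidegree0 q0 bq.
by rewrite e zero_setM qE zero_set_const // set0U.
Qed.

(** For maximality, a larger irreducible set lies in Z(f1) for one irreducible factor f1 of g; then
    f divides f1 and both have the same zeros. *)
Lemma irred_component f g : g != 0 -> irred f -> divides f g ->
  irreducible_component (zero_set g) (zero_set f).
Proof.
move=> g0 fi fg; split; first exact: irred_irreducible_closed.
  exact: zero_set_divides.
move=> V' iV' fV' V'g.
have [f1 [i1 d1 V1]] := irreducible_closed_factor iV' g0 V'g.
have d2 : divides f f1 by apply: irred_zero_set_sub => //; apply: subset_trans V1.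
by apply/seteqP; split=> //; rewrite -(irred_divides_zero_set fi i1 d2).
Qed.

End IrreducibleComponents.

(** * The inner product on C^d and vectors extremal for the numerical radius *)

Section InnerProduct.
Variables (R : realType) (d : nat).
Local Notation C := R[i].
Implicit Types (F M : 'M[C]_d) (h u v : 'cV[C]_d).

Lemma innerE u v : inner u v = \sum_i u i 0 * (v i 0)^*.
Proof. by rewrite /inner mxE; apply: eq_bigr => i _; rewrite !mxE mulrC. Qed.

Lemma innerDl u v w : inner (u + v) w = inner u w + inner v w.
Proof. by rewrite /inner mulmxDr mxE. Qed.

Lemma innerZl (k : C) u v : inner (k *: u) v = k * inner u v.
Proof. by rewrite /inner -scalemxAr mxE. Qed.

Lemma inner_conj u v : inner v u = (inner u v)^*.
Proof.
rewrite !innerE rmorph_sum; apply: eq_bigr => i _.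
by rewrite rmorphM /= conjCK mulrC.
Qed.

Lemma innerDr u v w : inner u (v + w) = inner u v + inner u w.
Proof. by rewrite inner_conj innerDl rmorphD /= -!inner_conj. Qed.

Lemma innerZr (k : C) u v : inner u (k *: v) = k^* * inner u v.
Proof. by rewrite inner_conj innerZl rmorphM /= -inner_conj. Qed.

Lemma inner0l v : inner 0 v = 0.
Proof. by rewrite -(scale0r 0) innerZl mul0r. Qed.

Lemma inner_ge0 u : 0 <= inner u u.
Proof. by rewrite innerE sumr_ge0 // => i _; rewrite -normCK exprn_ge0. Qed.

Lemma inner_eq0 u : (inner u u == 0) = (u == 0).
Proof.
apply/eqP/eqP => [|->]; last exact: inner0l.
rewrite innerE => e; apply/matrixP => i j; rewrite ord1 mxE.
have ge0 k : true -> 0 <= u k 0 * (u k 0)^* by rewrite -normCK exprn_ge0.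
have u0 : u i 0 * (u i 0)^* = 0 by exact: (psumr_eq0P ge0 e).
move/eqP: u0; by rewrite -normCK expf_eq0 /= normr_eq0 => /eqP.
Qed.

Lemma inner_gt0 u : (0 < inner u u) = (u != 0).
Proof. by rewrite lt_neqAle inner_ge0 andbT eq_sym inner_eq0. Qed.

Lemma inner_adj M u v : inner (M *m u) v = inner u (M ^t* *m v).
Proof. by rewrite /inner trmx_mul map_mxM /= trmxCK mulmxA. Qed.

Lemma normc_normE (z : C) : ((Normc.normc z)%:C)%C = `|z|.
Proof. by []. Qed.

Lemma numerical_contractionP F :
  numerical_contraction F <-> forall h, `|inner (F *m h) h| <= inner h h.
Proof.
split=> [nF h|nF].
  have [->|h0] := eqVneq h 0; first by rewrite mulmx0 !inner0l normr0.
  pose c := sqrtC (inner h h).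
  have c0 : 0 < c by rewrite sqrtC_gt0 inner_gt0.
  have cE : c ^+ 2 = inner h h by rewrite sqrtCK.
  have cc : (c^-1)^* = c^-1 by apply: conj_Creal; rewrite realV gtr0_real.
  have : ((Normc.normc (inner (F *m (c^-1 *: h)) (c^-1 *: h)))%:E <= 1%:E)%E.
    apply: le_trans nF; apply: ereal_sup_ubound.
    exists (c^-1 *: h) => //=.
    have c1 : c^-1 * (c^-1 * inner h h) = 1 by rewrite -cE; field; rewrite gt_eqF.
    by rewrite /vnorm innerZl innerZr cc c1 sqrtC1.
  rewrite lee_fin -lecR normc_normE -scalemxAr innerZl innerZr cc !normrM.
  rewrite (gtr0_norm (x := c^-1)) ?invr_gt0 // mulrA -expr2 exprVn -cE.
  by rewrite mulrC ler_pdivrMr ?mul1r ?exprn_gt0.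
apply: ge_ereal_sup => _ [h /= h1 <-]; rewrite lee_fin -lecR normc_normE.
apply: le_trans (nF h) _.
by have := sqrtCK (inner h h); rewrite -/(vnorm h) h1 expr1n => <-.
Qed.

Lemma hermitian_psd_ker M h : M ^t* = M ->
  (forall v, 0 <= inner (M *m v) v) ->
  (forall v, inner (M *m v) v <= 4 * inner v v) ->
  inner (M *m h) h = 0 -> M *m h = 0.
Proof.
move=> Mh M0 M4 hh; apply/eqP; rewrite -inner_eq0.
(* A small step from h against v = M h must not make the form negative. With M <= 4 and the step
   -1/4 its value is at most - <v, v> / 4, which forces v = 0. *)
set v := M *m h; pose e : C := - 4^-1.
have ec : e^* = e by rewrite rmorphN fmorphV rmorph_nat.
have := M0 (h + e *: v).
rewrite mulmxDr -scalemxAr !innerDl !innerDr !innerZl !innerZr hh add0r ec.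
rewrite [inner (M *m v) h]inner_adj Mh -/v.
have := M4 v; set a := inner (M *m v) v; set b := inner v v => ab.
have -> : e * b + (e * b + e * (e * a)) = a / 16 - b / 2 by rewrite /e; field.
rewrite subr_ge0 => hba.
have b0 : 0 <= b := inner_ge0 v.
have : b / 2 <= b / 4.
  apply: le_trans hba _; rewrite ler_pdivrMr //.
  by have -> : b / 4 * 16 = 4 * b by field.
rewrite ler_pdivrMr // -mulrA => hb.
rewrite eq_le b0 andbT -(ler_pM2r (x := 1 / 2)) ?divr_gt0 //.
rewrite mul0r -(lerD2l (b / 2)) addr0.
have -> : b / 2 + b * (1 / 2) = b by field.
by apply: le_trans hb _; have -> : 4^-1 * 2 = 2^-1 :> C by field.
Qed.

Lemma mx_kernel_vec M : \det M = 0 -> exists2 h : 'cV[C]_d, h != 0 & M *m h = 0.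
Proof.
move=> M0; have /det0P[v v0 vM] : \det M^T == 0 by rewrite det_tr M0.
exists v^T; first by rewrite trmx_eq0.
by apply: trmx_inj; rewrite trmx_mul trmxK vM trmx0.
Qed.

Lemma mx_kernel_det M h : h != 0 -> M *m h = 0 -> \det M = 0.
Proof.
move=> h0 Mh; rewrite -det_tr; apply/eqP/det0P; exists h^T; rewrite ?trmx_eq0 //.
by rewrite -trmx_mul Mh trmx0.
Qed.

Lemma spectrumP F z : spectrum F z <-> exists2 h : 'cV[C]_d, h != 0 & F *m h = z *: h.
Proof.
rewrite /spectrum /= unitmxE unitfE negbK; split=> [/eqP/mx_kernel_vec[h h0]|[h h0 Fh]].
  rewrite mulmxBl mul_scalar_mx => /eqP; rewrite subr_eq0 => /eqP Fh.
  by exists h.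
by apply/eqP/(mx_kernel_det h0); rewrite mulmxBl mul_scalar_mx Fh subrr.
Qed.

Lemma W_ofP F (s p : C) : W_of F (s, p) <->
  exists2 h : 'cV[C]_d, h != 0 & F ^t* *m h + p *: (F *m h) = s *: h.
Proof.
rewrite /W_of /=; split=> [/mx_kernel_vec[h h0]|[h h0 e]].
  rewrite mulmxBl mulmxDl mul_scalar_mx -scalemxAl => /eqP; rewrite subr_eq0 => /eqP e.
  by exists h.
by apply: (mx_kernel_det h0); rewrite mulmxBl mulmxDl mul_scalar_mx -scalemxAl e subrr.
Qed.

(* Equality in |<Fh,h>| <= <h,h> makes h a null vector of the positive
   semidefinite matrix 2 - conj(a) F - a F^*. *)
Lemma numerical_contraction_extremal F h (a : C) : numerical_contraction F ->
  `|a| = 1 -> inner (F *m h) h = a * inner h h ->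
  a^* *: (F *m h) + a *: (F ^t* *m h) = 2 *: h.
Proof.
move=> /numerical_contractionP nF a1 ha.
have aa : a * a^* = 1 by rewrite -normCK a1 expr1n.
pose M := 2%:M - (a^* *: F + a *: F ^t*).
have Mv v : M *m v = 2 *: v - (a^* *: (F *m v) + a *: (F ^t* *m v)).
  by rewrite mulmxBl mul_scalar_mx mulmxDl -!scalemxAl.
have iM v : inner (M *m v) v =
    2 * inner v v - (a^* * inner (F *m v) v + (a^* * inner (F *m v) v)^*).
  rewrite Mv innerDl innerZl -scaleN1r innerZl innerDl !innerZl mulN1r.
  by rewrite rmorphM /= conjCK -inner_conj [inner (F ^t* *m v) v]inner_adj trmxCK.
have bnd v : `|a^* * inner (F *m v) v| <= inner v v.
  by rewrite normrM norm_conjC a1 mul1r.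
have sb (x : C) : - (`|x| *+ 2) <= x + x^* <= `|x| *+ 2.
  have r : x + x^* \is Num.real by rewrite CrealE rmorphD /= conjCK addrC.
  have : `|x + x^*| <= `|x| *+ 2.
    by apply: le_trans (ler_normD _ _) _; rewrite norm_conjC mulr2n.
  by rewrite real_ler_norml.
suff : M *m h = 0 by rewrite Mv => /eqP; rewrite subr_eq0 => /eqP.
apply: hermitian_psd_ker.
- rewrite /M linearB linearD !linearZ /= !map_mxB !map_mxD !map_mxZ /= tr_scalar_mx map_scalar_mx.
  by rewrite rmorph_nat conjCK /= -[F^T ^ _]/(F ^t*) trmxCK [X in _ - X]addrC.
- move=> v; rewrite iM subr_ge0; have /andP[_ h2] := sb (a^* * inner (F *m v) v).
  by apply: le_trans h2 _; rewrite mulr_natl lerMn2r bnd.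
- move=> v; rewrite iM; have /andP[h1 _] := sb (a^* * inner (F *m v) v).
  rewrite lerBlDr -lerBlDl.
  have -> : 2 * inner v v - 4 * inner v v = - (inner v v *+ 2) by ring.
  by apply: le_trans h1; rewrite lerN2 lerMn2r bnd.
- rewrite iM ha mulrA [a^* * a]mulrC aa mul1r.
  by rewrite -inner_conj; ring.
Qed.

End InnerProduct.

(** * The equivalent conditions on F and its variety *)

Section ForwardDirection.
Variables (R : realType) (d : nat).
Local Notation C := R[i].
Local Notation same_side :=
  (@symm R @` (disk `*` disk `|` circle `*` circle `|` exterior_disk `*` exterior_disk)).
Implicit Types (F M : 'M[C]_d) (h u v : 'cV[C]_d).

(** Here ['X] is the variable p of the coefficient ring, while s is the variable of the
    characteristic polynomial; this makes it monic in s. *)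
Definition pencil_poly F : {poly {poly C}} :=
  char_poly (map_mx polyC (F ^t*) + 'X *: map_mx polyC F).

Lemma fibre_pencil_poly F (p : C) :
  fibre p (pencil_poly F) = char_poly (F ^t* + p *: F).
Proof.
rewrite /fibre map_char_poly; congr char_poly.
by apply/matrixP => i j; rewrite !mxE /= /horner_eval !hornerE.
Qed.

Lemma pencil_poly_monic F : pencil_poly F \is monic.
Proof. exact: char_poly_monic. Qed.

Lemma pencil_poly_neq0 F : pencil_poly F != 0.
Proof. by rewrite monic_neq0 // pencil_poly_monic. Qed.

Lemma char_poly_horner_eq0 M (s : C) :
  (char_poly M).[s] = 0 <-> \det (M - s%:M) = 0.
Proof.
have -> : (char_poly M).[s] = \det (s%:M - M).
  rewrite -[LHS]/(horner_eval s (char_poly M)) /char_poly -det_map_mx; congr (\det _).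
  by apply/matrixP => i j; rewrite !mxE /= /horner_eval !hornerE hornerMn hornerX.
have -> : M - s%:M = -1 *: (s%:M - M) by rewrite scaleN1r opprB.
rewrite detZ; split=> [->|/eqP]; first by rewrite mulr0.
by rewrite mulf_eq0 signr_eq0 => /eqP.
Qed.

Lemma W_of_zero_set F : W_of F = zero_set (pencil_poly F).
Proof.
by apply/seteqP; split=> -[s p]; rewrite /W_of /zero_set /= -fibreE
  fibre_pencil_poly => /char_poly_horner_eq0.
Qed.

Lemma W_of_joint_spectrum F :
  W_of F = [set sp : C * C | joint_spectrum (F ^t* + sp.2 *: F) sp.2%:M sp].
Proof.
apply/seteqP; split=> -[s p] /=.
  move=> /W_ofP[h h0 e]; exists h; split=> //=; last by rewrite mul_scalar_mx.
  by rewrite mulmxDl -scalemxAl.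
move=> [h [h0 /= e _]]; apply/W_ofP; exists h => //.
by rewrite scalemxAl -mulmxDl.
Qed.

Lemma W_of_rayleigh F (s p : C) : numerical_contraction F -> W_of F (s, p) ->
  exists h (a : C), [/\ h != 0, F ^t* *m h + p *: (F *m h) = s *: h,
    inner (F *m h) h = a * inner h h, `|a| <= 1 & s = a^* + p * a].
Proof.
move=> /numerical_contractionP nF /W_ofP[h h0 e].
have n0 : 0 < inner h h by rewrite inner_gt0.
have nr : (inner h h)^* = inner h h by rewrite -inner_conj.
pose a := inner (F *m h) h / inner h h.
have aE : inner (F *m h) h = a * inner h h by rewrite divfK // gt_eqF.
exists h, a; split=> //.
  by rewrite normrM normfV (gtr0_norm n0) ler_pdivrMr // mul1r.
have := congr1 (fun v => inner v h) e; rewrite innerDl !innerZl.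
rewrite [inner (F ^t* *m h) h]inner_adj trmxCK [inner h (F *m h)]inner_conj.
rewrite aE rmorphM /= nr mulrA -mulrDl.
by move/(mulIf (lt0r_neq0 n0)) => <-.
Qed.

Lemma W_of_fibre0 F : (0 < d)%N -> exists s : C, W_of F (s, 0).
Proof.
move=> d0; have : size (char_poly (F ^t*)) != 1%N.
  by rewrite size_char_poly eqSS -lt0n.
move=> /closed_rootP[s /rootP/char_poly_horner_eq0 e]; exists s.
by rewrite /W_of /= scale0r addr0.
Qed.

(** The fibre over p = 0 is the spectrum of F^*, which a numerical contraction has inside the closed
    disk. *)
Lemma W_of_meets_Gamma F : (0 < d)%N -> numerical_contraction F ->
  W_of F `&` Gamma !=set0.
Proof.
move=> d0 nF; have [s Ws] := W_of_fibre0 F d0; exists (s, 0); split=> //.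
have [h [a [_ _ _ a1 sE]]] := W_of_rayleigh nF Ws.
apply/(@GammaP _ _ _ s 0); rewrite ?addr0 ?mulr0 // normr0; split=> //.
by rewrite sE mul0r addr0 norm_conjC.
Qed.

(** In the extremal identity at h the first term equals h, which leaves z F^* h = h. *)
Lemma numerical_contraction_unimodular F h (z : C) : numerical_contraction F ->
  `|z| = 1 -> F *m h = z *: h -> F ^t* *m h = z^* *: h.
Proof.
move=> nF z1 Fh; have zz : z * z^* = 1 by rewrite -normCK z1 expr1n.
have := numerical_contraction_extremal nF z1 (h := h).
rewrite Fh innerZl => /(_ erefl); rewrite scalerA mulrC zz => e.
have : z *: (F ^t* *m h) = h.
  by apply: (addrI (1 *: h)); rewrite e -[2]/(1 + 1) scalerDl scale1r.
by move/(congr1 (fun v => z^* *: v)); rewrite scalerA mulrC zz scale1r.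
Qed.

Lemma unimodular_eigenvector_W_of F h (z p : C) : h != 0 ->
  F *m h = z *: h -> F ^t* *m h = z^* *: h -> W_of F (z^* + p * z, p).
Proof.
by move=> h0 e1 e2; apply/W_ofP; exists h; rewrite // e1 e2 scalerA -scalerDl.
Qed.

Lemma line_not_G (z p : C) : `|z| = 1 -> ~ G (z^* + p * z, p).
Proof.
move=> z1; have zz : z * z^* = 1 by rewrite -normCK z1 expr1n.
move/(@GP _ _ _ (z^*) (p * z) erefl); rewrite mulrCA [z^* * z]mulrC zz mulr1.
by move=> /(_ erefl)[]; rewrite norm_conjC z1 ltxx.
Qed.

(** By Cayley-Hamilton the product of the factors F - z annihilates a nonzero v in V. Applying the
    factors one at a time, the last nonzero vector is an eigenvector. *)
Lemma eigenvector_in F (V : {vspace 'cV[C]_d}) : (0 < d)%N ->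
  (forall h, h \in V -> F *m h \in V) -> V != 0%VS ->
  exists h (z : C), [/\ h \in V, h != 0 & F *m h = z *: h].
Proof.
case: d F V => // d' F V _ FV V0.
have [v vV v0] : exists2 v, v \in V & v != 0.
  by exists (vpick V); rewrite ?memv_pick ?vpick0.
have [rs cE] := closed_field_poly_normal (char_poly F).
have : horner_mx F (\prod_(z <- rs) ('X - z%:P)) *m v = 0.
  have := Cayley_Hamilton F; rewrite cE (monicP (char_poly_monic F)) scale1r => ->.
  by rewrite mul0mx.
elim: rs v vV v0 {cE} => [|z rs IH] v vV v0.
  by rewrite big_nil rmorph1 mul1mx => e; rewrite e eqxx in v0.
rewrite big_cons mulrC rmorphM /= -mulmxA rmorphB /= horner_mx_X horner_mx_C.
have [e _|n0] := eqVneq ((F - z%:M) *m v) 0.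
  exists v, z; split=> //; move/eqP: e.
  by rewrite mulmxBl mul_scalar_mx subr_eq0 => /eqP.
apply: IH => //; rewrite mulmxBl mul_scalar_mx; apply: memvB; first exact: FV.
exact: memvZ.
Qed.

Lemma distinguished_cnu F : (0 < d)%N ->
  distinguished_variety (W_of F) -> completely_nonunitary F.
Proof.
move=> d0 [xi [WE _ bE]] V rV uV; apply/eqP; apply: contraT => V0.
have [h [z [hV h0 Fh]]] := eigenvector_in d0 (fun h hV => (rV h hV).1) V0.
have [uh _] := uV h hV.
have z1 : `|z| = 1.
  apply/eqP; rewrite -(eqrXn2 (n := 2)) // expr1n normCK; apply/eqP.
  have : inner (F *m h) (F *m h) = inner h h by rewrite inner_adj uh.
  rewrite {1 2}Fh innerZl innerZr mulrA -{2}[inner h h]mul1r.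
  by apply: mulIf; rewrite inner_eq0.
have zz : z * z^* = 1 by rewrite -normCK z1 expr1n.
have Fah : F ^t* *m h = z^* *: h.
  move: uh; rewrite Fh -scalemxAr => /(congr1 (fun v => z^* *: v)).
  by rewrite scalerA [z^* * z]mulrC zz scale1r.
(* Over p = 0 the line passes through the image of (conj(z), 0), a boundary point of G outside
   bG. *)
have W0 := unimodular_eigenvector_W_of 0 h0 Fh Fah.
rewrite mul0r addr0 in W0.
have : (zero_set xi `&` boundary G) (z^*, 0).
  split; first by rewrite -WE.
  apply/boundary_GP; exists (z^*), 0; rewrite norm_conjC z1 normr0 ler01.
  by rewrite /symm /= addr0 mulr0.
rewrite bE => -[_ /(@bGP _ _ _ (z^*) 0)]; rewrite addr0 mulr0 normr0.
by move=> /(_ erefl erefl)[_ /esym/eqP]; rewrite oner_eq0.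
Qed.

Lemma cnu_spectrum F : numerical_contraction F -> completely_nonunitary F ->
  spectrum F `&` circle = set0.
Proof.
move=> nF cF; apply/seteqP; split=> // z [/spectrumP[h h0 Fh] z1].
have zz : z * z^* = 1 by rewrite -normCK z1 expr1n.
have Fah := numerical_contraction_unimodular nF z1 Fh.
have h0' : h \in 0%VS.
  rewrite -(cF <[h]>%VS) ?memv_line // => v /vlineP[k ->].
    rewrite -!scalemxAr Fh Fah !scalerA.
    by split; apply: memvZ; apply: memv_line.
  by rewrite -!scalemxAr Fh Fah -!scalemxAr Fh Fah !scalerA -!mulrA zz [z^* * z]mulrC zz mulr1.
by move: h0 h0'; rewrite memv0 => /negPf->.
Qed.

(** The relation says w2 = (w1 - conj(a)) / (a w1 - 1), a Moebius map that preserves the disk, the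
    circle and the exterior. *)
Lemma disk_automorphism_modulus (a w1 w2 : C) : `|a| < 1 ->
  w1 + w2 = a^* + a * (w1 * w2) ->
  (1 <= `|w1| -> 1 <= `|w2|) /\ (1 < `|w1| -> 1 < `|w2|).
Proof.
move=> a1 e.
have e1 : w1 - a^* = w2 * (a * w1 - 1).
  apply/eqP; rewrite -subr_eq0.
  have -> : w1 - a^* - w2 * (a * w1 - 1) = w1 + w2 - (a^* + a * (w1 * w2)) by ring.
  by rewrite e subrr.
have key : `|w1 - a^*| ^+ 2 - `|a * w1 - 1| ^+ 2 = (1 - `|a| ^+ 2) * (`|w1| ^+ 2 - 1).
  by rewrite !normCK !rmorphB /= rmorphM rmorph1 conjCK; ring.
have a2 : 0 < 1 - `|a| ^+ 2 by rewrite subr_gt0 exprn_ilt1.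
have n1 := congr1 Num.norm e1; rewrite normrM in n1.
split=> h.
  have w0 : w1 - a^* != 0.
    rewrite subr_eq0; apply: contraTneq a1 => w1E.
    by move: h; rewrite w1E norm_conjC => h; rewrite -real_leNgt ?normr_real ?real1.
  have le : `|a * w1 - 1| <= `|w1 - a^*|.
    rewrite -(ler_pXn2r (n := 2)) ?nnegrE // -subr_ge0 key mulr_ge0 ?(ltW a2) //.
    by rewrite subr_ge0 exprn_ege1.
  rewrite real_leNgt ?real1 ?normr_real //; apply/negP => w2l.
  have m0 : 0 < `|a * w1 - 1|.
    rewrite normr_gt0; apply: contraNneq w0 => m0.
    by rewrite e1 m0 mulr0.
  move: le; rewrite n1 -[X in X <= _]mul1r ler_pM2r // => /(lt_le_trans w2l).
  by rewrite ltxx.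
have lt : `|a * w1 - 1| < `|w1 - a^*|.
  rewrite -(ltr_pXn2r (n := 2)) ?nnegrE // -subr_gt0 key mulr_gt0 //.
  by rewrite subr_gt0 exprn_egt1.
rewrite real_ltNge ?real1 ?normr_real //; apply/negP => w2l.
have le : `|w2| * `|a * w1 - 1| <= `|a * w1 - 1| by rewrite ler_piMl.
by move: lt; rewrite n1 => /lt_le_trans/(_ le); rewrite ltxx.
Qed.

Lemma spectrum_W_of F : numerical_contraction F -> spectrum F `&` circle = set0 ->
  W_of F `<=` same_side.
Proof.
move=> nF sF [s p] Wsp.
have [h [a [h0 e ha a1 sE]]] := W_of_rayleigh nF Wsp.
have [z1 [z2 [hs hp]]] := symm_roots s p.
exists (z1, z2); last by rewrite /symm /= -hs -hp.
have [na|na] := eqVneq `|a| 1.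
  have aa : a * a^* = 1 by rewrite -normCK na expr1n.
  have ext := numerical_contraction_extremal nF na ha.
  (* For |a| = 1 the extremal identity and the eigenvector equation are two linear relations between
     F h, F^* h and h; eliminating F^* h leaves this one. If its left coefficient is 0 then z1 = z2
     = conj(a); otherwise h is an eigenvector of F, with eigenvalue a on the circle. *)
  have key : (a * p - a^*) *: (F *m h) = (a * s - 2) *: h.
    rewrite !scalerBl -!scalerA -e -ext scalerDr.
    rewrite opprD [- _ - _]addrC addrA.
    by rewrite [a *: (F ^t* *m h) + _]addrC addrK.
  have [ap|ap] := eqVneq (a * p) (a^*).
    have pE : p = a^* ^+ 2.
      by rewrite expr2 -{1}ap mulrAC aa mul1r.
    have sE2 : s = a^* + a^* by rewrite sE pE expr2 -mulrA [a^* * a]mulrC aa mulr1.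
    have [[-> ->]|[-> ->]] := symm_inj (etrans (esym sE2) hs) (etrans (esym pE) hp);
      by left; right; split; rewrite /circle /= norm_conjC.
  have d0 : a * p - a^* != 0 by rewrite subr_eq0.
  have /spectrumP sp : exists2 h : 'cV[C]_d, h != 0 & F *m h = a *: h.
    exists h => //; have Fh : F *m h = ((a * p - a^*)^-1 * (a * s - 2)) *: h.
      by rewrite -scalerA -key scalerA mulVf // scale1r.
    move: ha; rewrite Fh innerZl => /mulIf -> //.
    by rewrite inner_eq0.
  by have : (spectrum F `&` circle) a by []; rewrite sF.
have {}a1 : `|a| < 1 by rewrite lt_neqAle na.
have e1 : z1 + z2 = a^* + a * (z1 * z2) by rewrite -hs -hp sE mulrC.
have e2 : z2 + z1 = a^* + a * (z2 * z1) by rewrite addrC [z2 * _]mulrC.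
have [l1 g1] := disk_automorphism_modulus a1 e1.
have [l2 g2] := disk_automorphism_modulus a1 e2.
rewrite /disk /circle /exterior_disk /=.
case: (real_ltgtP (real1 _) (normr_real z1)) => h1.
- by right; split=> //; apply: g1.
- left; left; split=> //=; rewrite real_ltNge ?real1 ?normr_real //.
  by apply/negP => /l2; rewrite real_leNgt ?real1 ?normr_real // h1.
- left; right; split=> //=; apply/eqP; rewrite eq_le l1 -?h1 // andbT.
  by rewrite real_leNgt ?real1 ?normr_real //; apply/negP => /g2; rewrite -h1 ltxx.
Qed.

Lemma W_of_fibre0_G F (s : C) :
  W_of F `<=` same_side ->
  W_of F (s, 0) -> G (s, 0).
Proof.
move=> WF /WF[[z1 z2] /= h [<- pE]]; exists (z1, z2); last by rewrite /symm /= pE.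
have z : (z1 == 0) || (z2 == 0) by rewrite -mulf_eq0 pE.
case: h => [[//|]|]; rewrite /circle /exterior_disk => -[/= h1 h2];
  case/orP: z => /eqP z; move: h1 h2; rewrite z normr0.
- by move=> /esym/eqP; rewrite oner_eq0.
- by move=> _ /esym/eqP; rewrite oner_eq0.
- by rewrite ltr10.
- by rewrite ltr10.
Qed.

Lemma monic_irred_divisor_size (f g : {poly {poly C}}) : g \is monic ->
  irred f -> divides f g -> (1 < size f)%N.
Proof.
move=> gm fi fg; have [k k0 lf] := monic_divisor_lead_coef gm fg.
by case: fi => + _; rewrite /bidegree lf size_polyC k0 addn0 ltn_predRL.
Qed.

(** An irreducible factor of the monic [pencil_poly F] has positive degree in s, hence a zero over p
    = 0. There z1 z2 = 0, so that both lie in the disk. *)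
Lemma W_of_components F :
  W_of F `<=` same_side ->
  forall V, irreducible_component (W_of F) V -> V `&` G !=set0.
Proof.
move=> WF V [iV VW mV]; have := VW; rewrite W_of_zero_set => VZ.
have [f [fi fd Vf]] := irreducible_closed_factor iV (pencil_poly_neq0 F) VZ.
have fV : zero_set f = V.
  apply: mV => //; first exact: irred_irreducible_closed.
  by rewrite W_of_zero_set; exact: zero_set_divides.
have [k k0 lf] := monic_divisor_lead_coef (pencil_poly_monic F) fd.
have [s /rootP] : exists s, root (fibre 0 f) s.
  apply: poly_nonconst_root; rewrite size_fibre ?lf ?hornerC //.
  exact: monic_irred_divisor_size (pencil_poly_monic F) fi fd.
rewrite fibreE => fs; have Vs : V (s, 0) by rewrite -fV.
by exists (s, 0); split=> //; apply: (W_of_fibre0_G WF); apply: VW.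
Qed.

Lemma irred_line (a b : C) :
  irred ('X - (a%:P + b *: 'X)%:P : {poly {poly C}}).
Proof.
set f := 'X - _; have f0 : f != 0 by rewrite polyXsubC_eq0.
have fm : f \is monic by rewrite monicXsubC.
split; first by rewrite /bidegree size_XsubC.
move=> u v e.
have [k k0 lv] : exists2 k : C, k != 0 & lead_coef v = k%:P.
  by apply: (monic_divisor_lead_coef fm); exists u.
have [l l0 lu] : exists2 k : C, k != 0 & lead_coef u = k%:P.
  by apply: (monic_divisor_lead_coef fm); exists v; rewrite mulrC.
have u0 : u != 0 by rewrite -lead_coef_eq0 lu polyC_eq0.
have v0 : v != 0 by rewrite -lead_coef_eq0 lv polyC_eq0.
have : size f = 2%N by rewrite size_XsubC.
rewrite e size_mul // /bidegree lu lv !size_polyC k0 l0 !addn0.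
have := u0; have := v0; rewrite -!size_poly_gt0.
by move: (size u) (size v) => m n; lia.
Qed.

Lemma components_spectrum F : numerical_contraction F ->
  (forall V, irreducible_component (W_of F) V -> V `&` G !=set0) ->
  spectrum F `&` circle = set0.
Proof.
move=> nF cW; apply/seteqP; split=> // z [/spectrumP[h h0 Fh] z1].
have Fah := numerical_contraction_unimodular nF z1 Fh.
pose f : {poly {poly C}} := 'X - ((z^*)%:P + z *: 'X)%:P.
have fi : irred f by exact: irred_line.
have fE s p : zero_set f (s, p) <-> s = z^* + p * z.
  rewrite /zero_set /f /= !hornerE /= [p * z]mulrC.
  by split=> [/eqP|->]; [rewrite subr_eq0 => /eqP|rewrite subrr].
have fd : divides f (pencil_poly F).
  apply: irred_zero_set_sub => // -[s p] /fE ->; rewrite -W_of_zero_set.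
  exact: unimodular_eigenvector_W_of Fh Fah.
have := irred_component (pencil_poly_neq0 F) fi fd.
by rewrite -W_of_zero_set => /cW[[s p] [/fE ->]]; apply: line_not_G.
Qed.

Lemma W_of_distinguished F : (0 < d)%N ->
  W_of F `<=` same_side ->
  distinguished_variety (W_of F).
Proof.
move=> d0 WF; exists (pencil_poly F); rewrite -W_of_zero_set; split=> //.
  by have [s Ws] := W_of_fibre0 F d0; exists (s, 0); split=> //; apply: (W_of_fibre0_G WF).
apply/seteqP; split=> -[s p] [Wx]; split=> //; last first.
  case: b => -[z1 z2] /= [h1 h2] <-; apply/boundary_GP.
  by exists z1, z2; rewrite h1 h2.
move: b => /boundary_GP[z1 [z2 [h1 h2 [e1 e2]]]].
have [[w1 w2] /= hw [f1 f2]] := WF _ Wx.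
apply/(bGP (esym f1) (esym f2)).
have h : `|w1| = 1 \/ `|w2| = 1.
  by have [[<- _]|[<- _]] := symm_inj (etrans f1 e1) (etrans f2 e2); [left|right].
case: hw => [[|]|] -[/= k1 k2]; rewrite /disk /circle /exterior_disk /= in k1 k2.
- by case: h => h; move: k1 k2; rewrite h ltxx.
- by [].
- by case: h => h; move: k1 k2; rewrite h ltxx.
Qed.

End ForwardDirection.

(** * Compactness in C^n and averages over roots of unity *)

Section CompactnessAndAverages.
Variable R : realType.
Local Notation C := R[i].

Lemma real_complexP (x : C) : 0 <= x -> exists2 y : R, 0 <= y & x = (y%:C)%C.
Proof.
move=> x0; have /complex_realP[y xE] := ger0_real x0.
by exists y; rewrite // -lecR -xE.
Qed.

Lemma expr_small (r e : C) : 0 <= r -> r < 1 -> 0 < e ->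
  exists n0, forall n, (n0 <= n)%N -> r ^+ n <= e.
Proof.
move=> r0 r1 e0.
have [x x0 xE] := real_complexP r0; have [y y0 yE] := real_complexP (ltW e0).
rewrite {}xE {}yE in r0 r1 e0 *.
rewrite ltcR in r1; rewrite ltcR in e0.
have nx : `|x| < 1 by rewrite ger0_norm.
have /cvgr0_norm_le /(_ _ e0)[n0 _ h] := cvg_expr nx.
exists n0 => n /h /=; rewrite ger0_norm ?exprn_ge0 // => hn.
by rewrite -rmorphXn /= lecR.
Qed.

(** The order of R[i] is partial: realness of x and y turns the negation of x <= y into y < x, and
    then e = (x - y) / (2 (K + 1)) violates the bound. *)
Lemma complex_le_eps (x y : C) (K : C) : 0 <= K -> x \is Num.real -> y \is Num.real ->
  (forall e : C, 0 < e -> x <= y + K * e) -> x <= y.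
Proof.
move=> K0 xr yr h; rewrite real_leNgt //; apply/negP => yx.
have K1 : 0 < K + 1 by rewrite ltr_wpDl.
have := h ((x - y) / (K + 1) / 2); rewrite !divr_gt0 ?subr_gt0 // => /(_ isT).
rewrite -lerBlDl mulrA ler_pdivlMr // mulrA ler_pdivlMr //.
have d0 : 0 < x - y by rewrite subr_gt0.
have -> : (x - y) * 2 * (K + 1) = K * (x - y) + (K * (x - y) + 2 * (x - y)) by ring.
rewrite gerDl; have pos : 0 < K * (x - y) + 2 * (x - y).
  by rewrite ltr_wpDl ?mulr_ge0 ?mulr_gt0 // ltW.
by move/(lt_le_trans pos); rewrite ltxx.
Qed.

Lemma sqrt_le_normD (x y : R) : Num.sqrt (x ^+ 2 + y ^+ 2) <= `|x| + `|y|.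
Proof.
rewrite -[leRHS]ger0_norm ?addr_ge0 // -sqrtr_sqr; apply: ler_wsqrtr.
rewrite sqrrD -(real_normK (num_real x)) -(real_normK (num_real y)) addrAC lerDl.
by rewrite mulrn_wge0 // mulr_ge0.
Qed.

Lemma bolzano_weierstrass n (u : nat -> 'I_n -> C) (B : C) :
  (forall m i, `|u m i| <= B) ->
  exists x : 'I_n -> C, forall e N, 0 < e ->
    exists2 m, (N <= m)%N & forall i, `|u m i - x i| < e.
Proof.
move=> uB.
(* For n = 0 the hypothesis does not make B nonnegative, so the real bound is chosen by cases. *)
have [b b0 BE] : exists2 b : R, 0 <= b & forall m i, `|u m i| <= (b%:C)%C.
  case: n u uB => [|n] u uB; first by exists 0 => // m [].
  have /real_complexP[b b0 BE] : 0 <= B by apply: le_trans (uB 0%N ord0).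
  by exists b => // m i; rewrite -BE.
pose v m : 'rV[R]_(n + n) :=
  row_mx (\row_i complex.Re (u m i)) (\row_i complex.Im (u m i)).
pose I : set R := `[- b, b]%classic.
have cI : compact [set w : 'rV[R]_(n + n) | forall i, I (w ord0 i)].
  by apply: (@rV_compact R _ (fun=> I)) => i; rewrite /I; exact: segment_compact.
have vI : (v @ \oo) [set w : 'rV[R]_(n + n) | forall i, I (w ord0 i)].
  exists 0%N => // m _ i.
  have hr (x y : R) : Num.sqrt (x ^+ 2 + y ^+ 2) <= b -> `|x| <= b.
    apply: le_trans; rewrite -sqrtr_sqr; apply: ler_wsqrtr.
    by rewrite lerDl sqr_ge0.
  rewrite /I /= in_itv /= -ler_norml -(splitK i).
  case: (fintype.split i) => j /=; rewrite ?row_mxEl ?row_mxEr mxE;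
    have := BE m j; rewrite normc_def lecR; first exact: hr.
  by rewrite addrC; exact: hr.
have [w [_ cw]] := cI (v @ \oo) _ vI.
exists (fun i => (w ord0 (lshift n i)) +i* (w ord0 (rshift n i)))%C => e N e0.
have [y y0 yE] := real_complexP (ltW e0); rewrite yE ltcR in e0.
have y2 : 0 < y / 2 by rewrite divr_gt0.
have vN : (v @ \oo) (v @` [set m | (N <= m)%N]).
  by exists N => // m /= Nm; exists m.
have [_ [[m Nm <-] bm]] := cw _ _ vN (nbhsx_ballx w _ y2).
exists m => // i.
have [_ {}bm] : 0 < y / 2 /\ forall i j, ball (w i j) (y / 2) (v m i j) := bm.
have := bm ord0 (lshift n i); have := bm ord0 (rshift n i).
rewrite row_mxEl row_mxEr !mxE /ball /= => b2 b1.
rewrite yE normc_def ltcR; case: (u m i) b1 b2 => a1 a2 /= b1 b2.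
rewrite distrC in b1; rewrite distrC in b2.
set w1 := w _ _ in b1 *; set w2 := w _ _ in b2 *.
apply: (@le_lt_trans _ _ (`|a1 - w1| + `|a2 - w2|)).
  exact: sqrt_le_normD.
by rewrite [y]splitr ltrD.
Qed.

Lemma prim_root_ex M : (0 < M)%N -> exists w : C, M.-primitive_root w.
Proof.
move=> M0; pose p : {poly C} := 'X^M - 1.
have [rs pE] := closed_field_poly_normal p.
have lp : lead_coef p = 1 by apply/monicP; rewrite monicXnsubC.
rewrite lp scale1r in pE.
have urs : uniq rs.
  rewrite -separable.separable_prod_XsubC -pE.
  by apply: cyclotomic.separable_Xn_sub_1; rewrite pnatr_eq0 -lt0n.
have srs : size rs = M.
  apply: succn_inj; rewrite -(size_prod_XsubC rs id) -pE.
  by rewrite size_XnsubC.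
have : has M.-primitive_root rs.
  apply: cyclic.has_prim_root => //; rewrite ?srs //.
  apply/allP => z zr; apply/unity_rootP; apply/eqP; rewrite -subr_eq0.
  have : root p z by rewrite pE root_prod_XsubC.
  by rewrite rootE !hornerE.
by case/hasP => w _ ww; exists w.
Qed.

(* For w a primitive M-th root of unity with M large, [avg M w] plays the role of
   the normalized integral over the unit circle. *)
Definition avg (M : nat) (w : C) (phi : C -> C) : C :=
  M%:R^-1 * \sum_(i < M) phi (w ^+ i).

Lemma prim_root_norm M (w : C) i : (0 < M)%N -> M.-primitive_root w ->
  `|w ^+ i| = 1.
Proof.
move=> M0 /prim_expr_order wM; rewrite normrX.
have /eqP : `|w| ^+ M = 1 by rewrite -normrX wM normr1.
by rewrite pexpr_eq1 // => /eqP ->; rewrite expr1n.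
Qed.

Section Avg.
Variables (M : nat) (w : C).
Hypotheses (M0 : (0 < M)%N) (wM : M.-primitive_root w).

Lemma avgD phi psi :
  avg M w (fun a => phi a + psi a) = avg M w phi + avg M w psi.
Proof. by rewrite /avg big_split /= mulrDr. Qed.

Lemma avgZ k phi : avg M w (fun a => k * phi a) = k * avg M w phi.
Proof. by rewrite /avg -mulr_sumr mulrCA. Qed.

Lemma avg_sum (I : Type) (rs : seq I) (phi : I -> C -> C) :
  avg M w (fun a => \sum_(i <- rs) phi i a) = \sum_(i <- rs) avg M w (phi i).
Proof. by rewrite /avg exchange_big /= mulr_sumr. Qed.

Lemma eq_avg phi psi : (forall a, `|a| = 1 -> a ^+ M = 1 -> phi a = psi a) ->
  avg M w phi = avg M w psi.
Proof.
move=> h; rewrite /avg; congr (_ * _); apply: eq_bigr => i _; apply: h.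
  exact: (prim_root_norm _ M0 wM).
by rewrite exprAC (prim_expr_order wM) expr1n.
Qed.

Lemma avg_const k : avg M w (fun=> k) = k.
Proof.
rewrite /avg sumr_const card_ord -[k *+ M]mulr_natl mulrA mulVf ?mul1r //.
by rewrite pnatr_eq0 -lt0n.
Qed.

Lemma avg_pow n : avg M w (fun a => a ^+ n) = ((M %| n)%N)%:R.
Proof.
have [/dvdnP[k ->]|nM] := boolP (M %| n)%N.
  transitivity (avg M w (fun=> 1)); last by rewrite avg_const.
  by apply: eq_avg => a _ aM; rewrite mulnC exprM aM expr1n.
have w1 : w ^+ n != 1 by rewrite -(prim_order_dvd wM).
apply/eqP; rewrite mulf_eq0; apply/orP; right.
have : (w ^+ n - 1) * \sum_(i < M) (w ^+ i) ^+ n == 0.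
  under eq_bigr do rewrite exprAC.
  by rewrite -subrX1 exprAC (prim_expr_order wM) expr1n subrr.
by rewrite mulf_eq0 subr_eq0 (negPf w1).
Qed.

Lemma avg_norm phi (B : C) : (forall a, `|a| = 1 -> `|phi a| <= B) ->
  `|avg M w phi| <= B.
Proof.
move=> h; rewrite normrM normfV normr_nat ler_pdivrMl ?ltr0n //.
apply: le_trans (ler_norm_sum _ _ _) _.
have -> : M%:R * B = \sum_(i < M) B by rewrite sumr_const card_ord mulr_natl.
by apply: ler_sum => i _; apply: h; exact: (prim_root_norm _ M0 wM).
Qed.

Lemma avg_ge0 phi : (forall a, `|a| = 1 -> 0 <= phi a) -> 0 <= avg M w phi.
Proof.
move=> h; rewrite mulr_ge0 ?invr_ge0 // sumr_ge0 // => i _.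
exact: h (prim_root_norm _ M0 wM).
Qed.

Lemma ler_avg phi psi : (forall a, `|a| = 1 -> phi a <= psi a) ->
  avg M w phi <= avg M w psi.
Proof.
move=> h; rewrite ler_wpM2l ?invr_ge0 // ler_sum // => i _.
exact: h (prim_root_norm _ M0 wM).
Qed.

Lemma avg_conj phi : avg M w (fun a => (phi a)^*) = (avg M w phi)^*.
Proof. by rewrite /avg rmorphM /= fmorphV rmorph_nat rmorph_sum. Qed.

(** A Fourier coefficient, free of aliasing because the exponents below M are distinct modulo M. *)
Lemma avg_coef (p : {poly C}) j : (size p <= M)%N -> (j < M)%N ->
  avg M w (fun a => a^-1 ^+ j * p.[a]) = p`_j.
Proof.
move=> sp jM.
transitivity (avg M w (fun a => \sum_(i <- iota 0 M) p`_i * a ^+ (M - j + i))).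
  apply: eq_avg => a a1 aM.
  have a0 : a != 0 by rewrite -normr_eq0 a1 oner_eq0.
  have -> : a^-1 ^+ j = a ^+ (M - j).
    apply: (mulfI (expf_neq0 j a0)); rewrite -exprD subnKC ?(ltnW jM) // aM.
    by rewrite exprVn mulfV ?expf_neq0.
  rewrite (horner_coef_wide _ sp) -(big_mkord xpredT (fun i => p`_i * a ^+ i)).
  rewrite mulr_sumr /index_iota subn0; apply: eq_bigr => i _.
  by rewrite exprD mulrCA.
rewrite avg_sum; under eq_bigr do rewrite avgZ avg_pow.
rewrite -{1}[M]subn0 -/(index_iota 0 M) big_mkord (bigD1 (Ordinal jM)) //= subnK ?dvdnn ?mulr1; last exact: ltnW.
rewrite big1 ?addr0 // => i ij.
suff /negPf -> : ~~ (M %| M - j + i)%N by rewrite mulr0.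
have iM := ltn_ord i; apply/negP => /dvdnP[[|[|k]]]; rewrite ?mul0n ?mul1n.
- by lia.
- move=> h; move/negP: ij; apply; apply/eqP/val_inj => /=; lia.
- by rewrite mulSn mulSn; lia.
Qed.

End Avg.
End CompactnessAndAverages.

(** * Uniform approximation by polynomials and reflection across the circle *)

Section PolynomialApproximation.
Variable R : realType.
Local Notation C := R[i].
Implicit Types (phi psi : C -> C) (r e p : C).

(** Required for every r < 1 this is holomorphy on the unit disk, in a form stable under sums,
    products and uniform limits. *)
Definition approx_on r phi := forall e, 0 < e ->
  exists P : {poly C}, forall p, `|p| <= r -> `|phi p - P.[p]| <= e.

Lemma approx_ext r phi psi : (forall p, `|p| <= r -> phi p = psi p) ->
  approx_on r phi -> approx_on r psi.
Proof.
move=> h ap e e0; have [P hP] := ap e e0; exists P => p pr.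
by rewrite -h // hP.
Qed.

Lemma approx_poly r (P : {poly C}) : approx_on r (fun p => P.[p]).
Proof. by move=> e e0; exists P => p _; rewrite subrr normr0 ltW. Qed.

Lemma approxD r phi psi : approx_on r phi -> approx_on r psi ->
  approx_on r (fun p => phi p + psi p).
Proof.
move=> a1 a2 e e0; have e2 : 0 < e / 2 by rewrite divr_gt0.
have [P hP] := a1 _ e2; have [Q hQ] := a2 _ e2; exists (P + Q) => p pr.
rewrite hornerD opprD addrACA; apply: le_trans (ler_normD _ _) _.
by rewrite [e]splitr lerD ?hP ?hQ.
Qed.

Lemma poly_bounded r (P : {poly C}) : 0 <= r ->
  exists2 B : C, 0 < B & forall p, `|p| <= r -> `|P.[p]| <= B.
Proof.
move=> r0; exists (1 + \sum_(i < size P) `|P`_i| * r ^+ i).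
  by rewrite ltr_pwDl // sumr_ge0 // => i _; rewrite mulr_ge0 // exprn_ge0.
move=> p pr; rewrite horner_coef; apply: le_trans (ler_norm_sum _ _ _) _.
rewrite ler_wpDl // ler_sum // => i _.
by rewrite normrM normrX ler_wpM2l // lerXn2r // nnegrE.
Qed.

Lemma approx_bounded r phi : 0 <= r -> approx_on r phi ->
  exists2 B : C, 0 < B & forall p, `|p| <= r -> `|phi p| <= B.
Proof.
move=> r0 /(_ 1 ltr01)[P hP]; have [B B0 hB] := poly_bounded P r0.
exists (1 + B) => [|p pr]; first by rewrite addr_gt0.
by rewrite -[phi p](subrK P.[p]) (le_trans (ler_normD _ _)) // lerD ?hP ?hB.
Qed.

Lemma approxM r phi psi : 0 <= r -> approx_on r phi -> approx_on r psi ->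
  approx_on r (fun p => phi p * psi p).
Proof.
move=> r0 a1 a2 e e0.
have [B B0 hB] := approx_bounded r0 a1.
have e2 : 0 < e / 2 / B by rewrite !divr_gt0.
have [Q hQ] := a2 _ e2.
have [D D0 hD] := poly_bounded Q r0.
have e1 : 0 < e / 2 / D by rewrite !divr_gt0.
have [P hP] := a1 _ e1.
exists (P * Q) => p pr; rewrite hornerM.
have -> : phi p * psi p - P.[p] * Q.[p] =
  phi p * (psi p - Q.[p]) + (phi p - P.[p]) * Q.[p] by ring.
apply: le_trans (ler_normD _ _) _; rewrite !normrM [e]splitr; apply: lerD.
  rewrite -[leRHS](divfK (lt0r_neq0 B0)) mulrC.
  by apply: ler_pM => //; [exact: hQ|exact: hB].
rewrite -[leRHS](divfK (lt0r_neq0 D0)).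
by apply: ler_pM => //; [exact: hP|exact: hD].
Qed.

Lemma approx_sum (I : Type) (s : seq I) r (phi : I -> C -> C) :
  (forall i, approx_on r (phi i)) ->
  approx_on r (fun p => \sum_(i <- s) phi i p).
Proof.
move=> h; elim: s => [|i s IH].
  apply: approx_ext (approx_poly r 0) => p _; by rewrite big_nil horner0.
by apply: approx_ext (approxD (h i) IH) => p _; rewrite big_cons.
Qed.

Lemma approx_lim r phi : (forall e, 0 < e -> exists2 psi, approx_on r psi &
    forall p, `|p| <= r -> `|phi p - psi p| <= e) -> approx_on r phi.
Proof.
move=> h e e0; have e2 : 0 < e / 2 by rewrite divr_gt0.
have [psi aps hp] := h _ e2; have [P hP] := aps _ e2; exists P => p pr.
rewrite -[phi p](subrK (psi p)) -addrA; apply: le_trans (ler_normD _ _) _.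
by rewrite [e]splitr lerD ?hp ?hP.
Qed.

Lemma approx_inv_linear r (b : C) : 0 <= r -> r < 1 -> 1 <= `|b| ->
  approx_on r (fun p => (p - b)^-1).
Proof.
move=> r0 r1 b1 e e0; have rr : 0 < 1 - r by rewrite subr_gt0.
have b0 : b != 0 by rewrite -normr_gt0 (lt_le_trans ltr01).
have [n0 hn] := expr_small r0 r1 (mulr_gt0 e0 rr).
(* A partial sum of the geometric series of (p - b)^-1. Its relative error (p / b)^n0 is at most
   r^n0, and |p - b| >= 1 - r. *)
exists (- (b^-1 *: \sum_(i < n0) (b^-1 *: 'X) ^+ i)) => p pr.
have pb : p - b != 0.
  rewrite subr_eq0; apply: contraTneq (le_lt_trans pr r1) => ->.
  by rewrite -real_leNgt ?normr_real ?real1.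
rewrite hornerN hornerZ horner_sum.
under eq_bigr do rewrite horner_exp hornerZ hornerX.
rewrite opprK; set S := \sum_(_ < _) _.
have SE : (p - b) * (b^-1 * S) = (b^-1 * p) ^+ n0 - 1.
  by rewrite mulrA mulrBl mulfV // [p * _]mulrC subrX1.
have -> : (p - b)^-1 + b^-1 * S = (b^-1 * p) ^+ n0 / (p - b).
  apply: (mulfI pb); rewrite mulrDr SE mulfV // addrC subrK.
  by rewrite mulrCA mulfV // mulr1.
rewrite normrM normfV normrX normrM normfV.
have lb : 1 - r <= `|p - b|.
  by rewrite distrC (le_trans _ (lerB_dist _ _)) // lerB.
rewrite ler_pdivrMr; last by rewrite normr_gt0.
apply: (@le_trans _ _ (r ^+ n0)).
  rewrite lerXn2r ?nnegrE ?mulr_ge0 ?invr_ge0 //.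
  by rewrite (le_trans _ pr) // ler_piMl // invf_le1 // (lt_le_trans ltr01).
by rewrite (le_trans (hn _ (leqnn _))) // ler_wpM2l // ltW.
Qed.

Lemma approx_inv_poly r (Q : {poly C}) : 0 <= r -> r < 1 ->
  (forall p, `|p| < 1 -> Q.[p] != 0) -> approx_on r (fun p => (Q.[p])^-1).
Proof.
move=> r0 r1 Q0; have [rs QE] := closed_field_poly_normal Q.
have Qn0 : Q != 0.
  by apply: contraNneq (Q0 0 _) => [->|]; rewrite ?horner0 ?normr0.
have rsb b : b \in rs -> 1 <= `|b|.
  move=> brs; rewrite real_leNgt ?normr_real ?real1 //; apply/negP => /Q0/negP; apply.
  by rewrite QE hornerZ mulf_eq0 (_ : _.[b] == 0) ?orbT // -[_ == _]/(root _ b) root_prod_XsubC.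
suff : approx_on r (fun p => (\prod_(z <- rs) ('X - z%:P)).[p]^-1).
  move=> /(approxM r0 (approx_poly r (lead_coef Q)^-1%:P)).
  by apply: approx_ext => p _; rewrite hornerC [in RHS]QE hornerZ invfM.
elim: rs rsb {QE} => [|b rs IH] rsb.
  by apply: approx_ext (approx_poly r 1) => p _; rewrite big_nil hornerC invr1.
have h1 : approx_on r (fun p => (p - b)^-1).
  by apply: approx_inv_linear => //; apply: rsb; rewrite mem_head.
have h2 := IH (fun c hc => rsb c (mem_behead (hc : c \in behead (b :: rs)))).
apply: approx_ext (approxM r0 h1 h2) => p _.
by rewrite big_cons hornerM hornerXsubC invfM.
Qed.

(** On the circle of radius r, p^k conj(P(p)) has no frequency above k, so the coefficients of P
    beyond k are Fourier coefficients of the difference. *)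
Lemma reflection_high_coef (P : {poly C}) r k (eta : C) : 0 < r ->
  (forall p, `|p| = r -> `|P.[p] - p ^+ k * (P.[p])^*| <= eta) ->
  forall j, (k < j)%N -> `|P`_j| * r ^+ j <= eta.
Proof.
move=> r0 h j kj.
pose M := (size P + j).+1.
have [w wM] := prim_root_ex R (ltn0Sn (size P + j)); rewrite -/M in wM.
have M0 : (0 < M)%N by [].
pose P' := \poly_(i < size P) (P`_i * r ^+ i).
have P'E a : P'.[a] = P.[r * a].
  rewrite horner_poly horner_coef; apply: eq_bigr => i _.
  by rewrite exprMn mulrA.
have sP' : (size P' <= size P)%N by apply: size_poly.
have P'j : P'`_j = P`_j * r ^+ j.
  by rewrite coef_poly; case: ltnP => // sj; rewrite nth_default ?mul0r.
have conja (a : C) : `|a| = 1 -> a^* = a^-1.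
  move=> a1; have a0 : a != 0 by rewrite -normr_eq0 a1 oner_eq0.
  by apply: (mulfI a0); rewrite mulfV // -normCK a1 expr1n.
have e1 : avg M w (fun a => a^-1 ^+ j * P'.[a]) = P'`_j.
  by apply: avg_coef => //; rewrite /M; [apply: leq_trans sP' _|]; lia.
have e2 : avg M w (fun a => a^-1 ^+ 0 * ('X^(j - k) * P').[a]) = 0.
  rewrite avg_coef ?coefXnM ?subn_gt0 ?kj //.
  by apply: leq_trans (size_polyMleq _ _) _; rewrite size_polyXn /M; lia.
have e3 : avg M w (fun a => a^-1 ^+ j * (P.[r * a] - (r * a) ^+ k * (P.[r * a])^*)) =
    P`_j * r ^+ j.
  set e4 := avg M w _ in e2.
  have e5 : r ^+ k * e4^* = 0 by rewrite e2 rmorph0 mulr0.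
  rewrite -P'j -e1 -[RHS]subr0 -e5 /e4 -avg_conj -avgZ.
  rewrite -mulN1r -avgZ -avgD; apply: eq_avg => // a a1 _ /=.
  have a0 : a != 0 by rewrite -normr_eq0 a1 oner_eq0.
  rewrite expr0 mul1r hornerM hornerXn rmorphM rmorphXn /= (conja a a1) P'E.
  have <- : a^-1 ^+ j * a ^+ k = a^-1 ^+ (j - k).
    by rewrite -{1}(subnK (ltnW kj)) exprD -mulrA -exprMn mulVf // expr1n mulr1.
  by rewrite exprMn; ring.
rewrite -(ger0_norm (exprn_ge0 j (ltW r0))) -normrM -e3.
apply: avg_norm => // a a1.
rewrite normrM normrX normfV a1 invr1 expr1n mul1r; apply: h.
by rewrite normrM a1 mulr1 gtr0_norm.
Qed.

Lemma geometric_bound (q : C) n : 0 <= q -> q < 1 ->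
  \sum_(i < n) q ^+ i <= (1 - q)^-1.
Proof.
move=> q0 q1; have qq : 0 < 1 - q by rewrite subr_gt0.
rewrite -[leRHS]mul1r ler_pdivlMr // mulrC.
have -> : (1 - q) * \sum_(i < n) q ^+ i = 1 - q ^+ n.
  by rewrite -opprB mulNr -subrX1 opprB.
by rewrite gerBl exprn_ge0.
Qed.

(** On a circle of radius r near 1 the defect of phi is small, hence so are the coefficients beyond
    k of an approximant. Dropping them costs little on |p| <= rho. *)
Lemma reflection_approx phi k (L : C) : 0 <= L ->
  (forall r, 0 <= r -> r < 1 -> approx_on r phi) ->
  (forall p, `|p| < 1 -> `|phi p - p ^+ k * (phi p)^*| <= L * (1 - `|p| ^+ 2)) ->
  forall rho e, 0 <= rho -> rho < 1 -> 0 < e ->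
  exists2 P : {poly C}, (size P <= k.+1)%N &
    forall p, `|p| <= rho -> `|phi p - P.[p]| <= e.
Proof.
move=> L0 ap rf rho e rho0 rho1 e0.
have q0 : 0 < 1 - rho by rewrite subr_gt0.
(* The final error has two shares. The choice of s, with t = 1 - r, makes 4 L t / (1 - rho) = 2 L s
   at most e / 2; the choice of [del] makes del (1 + 4 / (1 - rho)) at most e / 2. *)
pose s := e / (e + 4 * L + 1).
have dn0 : 0 < e + 4 * L + 1 by rewrite addr_gt0 // ltr_wpDr // mulr_ge0.
have s0 : 0 < s by rewrite divr_gt0.
have s1 : s <= 1.
  by rewrite ler_pdivrMr // mul1r -addrA lerDl addr_ge0 // mulr_ge0.
pose t := (1 - rho) / 2 * s.
have t0 : 0 < t by rewrite mulr_gt0 // divr_gt0.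
have t1 : t <= (1 - rho) / 2 by rewrite ler_piMr // ltW // divr_gt0.
pose r := 1 - t.
have r1 : r < 1 by rewrite gtrBl.
have rrho : (1 + rho) / 2 <= r.
  rewrite -subr_ge0 (_ : r - (1 + rho) / 2 = (1 - rho) / 2 - t) ?subr_ge0 //.
  by rewrite /r; field.
have r0 : 0 < r by apply: lt_le_trans rrho; rewrite divr_gt0 // ltr_wpDr.
pose del := e * (1 - rho) / 10.
have del0 : 0 < del by rewrite divr_gt0 // mulr_gt0.
have [P hP] := ap r (ltW r0) r1 del del0.
pose eta := 2 * del + 2 * L * t.
have eta0 : 0 <= eta
  by exact: addr_ge0 (mulr_ge0 (ler0n _ 2) (ltW del0)) (mulr_ge0 (mulr_ge0 (ler0n _ 2) L0) (ltW t0)).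
have hc : forall j, (k < j)%N -> `|P`_j| * r ^+ j <= eta.
  apply: reflection_high_coef => // p pr.
  have d1 : `|P.[p] - phi p| <= del by rewrite distrC hP // pr.
  have -> : P.[p] - p ^+ k * (P.[p])^* = (P.[p] - phi p) +
     - (p ^+ k * (P.[p] - phi p)^*) + (phi p - p ^+ k * (phi p)^*).
    by rewrite rmorphB /=; ring.
  apply: le_trans (ler_normD _ _) _; apply: lerD.
    apply: le_trans (ler_normD _ _) _; rewrite normrN normrM norm_conjC normrX pr.
    rewrite mulr_natl mulr2n lerD // (le_trans _ d1) //.
    by rewrite ler_piMl // exprn_ile1 // ltW.
  apply: (le_trans (rf _ _)); first by rewrite pr.
  rewrite pr -mulrA mulrCA ler_wpM2l //.
  have -> : 1 - r ^+ 2 = 2 * t - t ^+ 2 by rewrite /r; ring.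
  by rewrite gerBl exprn_ge0 // ltW.
exists (take_poly k.+1 P); first exact: size_take_poly.
move=> p pr; set T := take_poly _ P.
have PE : T + drop_poly k.+1 P * 'X^(k.+1) = P := poly_take_drop k.+1 P.
have -> : phi p - T.[p] = (phi p - P.[p]) + (drop_poly k.+1 P * 'X^(k.+1)).[p].
  by rewrite -{1}PE hornerD; ring.
set q := rho / r.
have q00 : 0 <= q by rewrite divr_ge0 // ltW.
have qE : 1 - q = (r - rho) / r by rewrite /q; field; rewrite gt_eqF.
have rr : (1 - rho) / 2 <= r - rho.
  rewrite lerBrDr (_ : (1 - rho) / 2 + rho = (1 + rho) / 2) //.
  by field.
have qlow : (1 - rho) / 2 <= 1 - q.
  rewrite qE; apply: (le_trans rr); rewrite ler_pdivlMr // ler_piMr ?(ltW r1) //.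
  by apply: (le_trans _ rr); rewrite divr_ge0 // ltW.
have q1 : q < 1 by rewrite -subr_gt0 (lt_le_trans _ qlow) // divr_gt0.
have tail : `|(drop_poly k.+1 P * 'X^(k.+1)).[p]| <= eta * (2 / (1 - rho)).
  rewrite hornerM hornerXn horner_coef mulr_suml.
  apply: le_trans (ler_norm_sum _ _ _) _.
  apply: (@le_trans _ _ (\sum_(i < size (drop_poly k.+1 P)) eta * q ^+ i)).
    apply: ler_sum => i _; rewrite coef_drop_poly -mulrA -exprD normrM normrX.
    apply: (@le_trans _ _ (`|P`_(i + k.+1)| * r ^+ (i + k.+1) * q ^+ (i + k.+1))).
      rewrite -mulrA -exprMn ler_wpM2l // /q mulrCA mulfV ?gt_eqF // mulr1.
      by rewrite lerXn2r // nnegrE.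
    apply: ler_pM; rewrite ?mulr_ge0 ?exprn_ge0 ?(ltW r0) //.
      by apply: hc; rewrite ltn_addl.
    by rewrite exprD ler_piMr ?exprn_ge0 // exprn_ile1 // ltW.
  rewrite -mulr_sumr ler_wpM2l //; apply: le_trans (geometric_bound _ q00 q1) _.
  have -> : 2 / (1 - rho) = ((1 - rho) / 2)^-1 by rewrite invf_div.
  by rewrite lef_pV2 ?posrE ?divr_gt0 // subr_gt0.
apply: le_trans (ler_normD _ _) _.
apply: le_trans (lerD (hP p _) tail) _.
  by apply: le_trans pr _; rewrite -subr_ge0 (le_trans _ rr) // divr_ge0 // ltW.
rewrite /eta mulrDl addrA.
have -> : e = e / 2 + e / 2 by field.
apply: lerD.
  have -> : del + 2 * del * (2 / (1 - rho)) = e / 2 * ((5 - rho) / 5).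
    by rewrite /del; field; rewrite gt_eqF.
  rewrite ler_piMr ?divr_ge0 ?(ltW e0) // ler_pdivrMr // mul1r.
  by rewrite gerBl.
have -> : 2 * L * t * (2 / (1 - rho)) = 2 * L * s.
  by rewrite /t; field; rewrite gt_eqF.
rewrite /s mulrA ler_pdivrMr // -subr_ge0.
have -> : e / 2 * (e + 4 * L + 1) - 2 * L * e = e / 2 * (e + 1) by field.
by rewrite mulr_ge0 ?divr_ge0 ?addr_ge0 // ltW.
Qed.

(* A function that is a locally uniform limit of polynomials on the disk and
   satisfies phi(p) = p^k conj(phi(p)) on the circle extends, by reflection, to a
   polynomial of degree at most k. *)
Lemma reflection_poly phi k (L : C) : 0 <= L ->
  (forall r, 0 <= r -> r < 1 -> approx_on r phi) ->
  (forall p, `|p| < 1 -> `|phi p - p ^+ k * (phi p)^*| <= L * (1 - `|p| ^+ 2)) ->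
  exists2 P : {poly C}, (size P <= k.+1)%N & forall p, `|p| < 1 -> phi p = P.[p].
Proof.
move=> L0 ap rf.
(* Approximants of degree at most k are determined by their values at k + 1 nodes, taken in |p| <=
   1/2. Since they approach phi at the nodes, phi is the Lagrange interpolant of its own values. *)
pose x (i : nat) : C := (i.+2)%:R^-1.
have xinj : injective x by move=> i j /invr_inj/eqP; rewrite eqr_nat => /eqP[].
have xh i : `|x i| <= 2^-1.
  by rewrite normfV normr_nat lef_pV2 ?posrE // ler_nat.
have h2 : (2^-1 : C) < 1 by rewrite invf_lt1 // ltr1n.
have lg (P : {poly C}) : (size P <= k.+1)%N -> forall p,
    P.[p] = \sum_(i < k.+1) P.[x i] * (tnth (qpoly.lagrange k.+1 x) i).[p].
  move=> sP p; rewrite {1}(qpoly.lagrange_gen (ltn0Sn k) xinj sP) horner_sum.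
  by apply: eq_bigr => i _; rewrite hornerM hornerC.
pose lag (i : 'I_k.+1) : {poly C} := tnth (qpoly.lagrange k.+1 x) i.
pose P := \sum_(i < k.+1) phi (x i) *: lag i.
exists P.
  apply: (leq_trans (size_sum _ _ _)); apply/bigmax_leqP => i _.
  by apply: leq_trans (size_scale_leq _ _) _; rewrite qpoly.size_lagrange_.
move=> p p1; apply/eqP; rewrite -subr_eq0 -normr_le0.
pose Lam := \sum_(i < k.+1) `|(lag i).[p]|.
have Lam0 : 0 <= 1 + Lam by rewrite addr_ge0 // sumr_ge0.
apply: (complex_le_eps Lam0); rewrite ?normr_real ?real0 // => e e0.
pose rho := (1 + `|p|) / 2.
have rho0 : 0 <= rho by rewrite divr_ge0 // addr_ge0.
have rho1 : rho < 1 by rewrite ltr_pdivrMr // mul1r -[ltRHS]/(1 + 1) ltrD2l.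
have prho : `|p| <= rho.
  by rewrite ler_pdivlMr // mulr_natr mulr2n lerD2r ltW.
have hrho : 2^-1 <= rho by rewrite -[leLHS]mul1r ler_pM2r ?invr_gt0 // lerDl.
have [Q sQ hQ] := reflection_approx L0 ap rf rho0 rho1 e0.
rewrite add0r; have -> : phi p - P.[p] =
    (phi p - Q.[p]) + \sum_(i < k.+1) (Q.[x i] - phi (x i)) * (lag i).[p].
  rewrite (lg Q sQ p) /P horner_sum -addrA; congr (_ + _).
  rewrite -!sumrN -big_split /=; apply: eq_bigr => i _.
  by rewrite hornerZ /lag; ring.
apply: le_trans (ler_normD _ _) _; rewrite mulrDl mul1r lerD ?hQ //.
apply: le_trans (ler_norm_sum _ _ _) _; rewrite /Lam mulr_suml ler_sum // => i _.
by rewrite normrM mulrC ler_wpM2l // distrC hQ // (le_trans (xh i)).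
Qed.

End PolynomialApproximation.

(** * Averages that select the roots lying in a fibre of G *)

Section InnerRootSums.
Variable R : realType.
Local Notation C := R[i].
Implicit Types (p z a : C).

Lemma log_derivative (rs : seq C) (l x : C) :
  (l *: \prod_(b <- rs) ('X - b%:P)).[x] != 0 ->
  (l *: \prod_(b <- rs) ('X - b%:P))^`().[x] /
    (l *: \prod_(b <- rs) ('X - b%:P)).[x] = \sum_(b <- rs) (x - b)^-1.
Proof.
rewrite derivZ !hornerZ mulf_eq0 negb_or => /andP[l0 h].
rewrite invfM mulrACA divff // mul1r.
elim: rs h => [|b rs IH]; first by rewrite !big_nil derivC horner0 mul0r.
rewrite !big_cons derivM derivXsubC mul1r hornerD !hornerM hornerXsubC.
rewrite mulf_eq0 negb_or => /andP[xb Q0].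
by rewrite -IH //; field; rewrite Q0 xb.
Qed.

Section Averages.
Variables (M : nat) (w : C).
Hypotheses (M0 : (0 < M)%N) (wM : M.-primitive_root w).

(** As a^M = 1, multiplying by 1 - z^M turns the integrand into the sum of z^i a^i over i < M, whose
    average is the term i = 0. *)
Lemma avg_geometric z : z ^+ M != 1 ->
  avg M w (fun a => (1 - z * a)^-1) = (1 - z ^+ M)^-1.
Proof.
move=> zM; have zM0 : 1 - z ^+ M != 0 by rewrite subr_eq0 eq_sym.
transitivity ((1 - z ^+ M)^-1 * avg M w (fun a => \sum_(i <- iota 0 M) z ^+ i * a ^+ i)).
  rewrite -avgZ; apply: eq_avg => // a a1 aM /=.
  have e : (1 - z * a) * \sum_(i <- iota 0 M) z ^+ i * a ^+ i = 1 - z ^+ M.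
    rewrite -[M in iota 0 M]subn0 -/(index_iota 0 M) big_mkord.
    under eq_bigr do rewrite -exprMn.
    by rewrite -opprB mulNr -subrX1 exprMn aM mulr1 opprB.
  have za : 1 - z * a != 0.
    by apply: contraNneq zM0 => h; rewrite -e h mul0r.
  have S0 : \sum_(i <- iota 0 M) z ^+ i * a ^+ i != 0.
    by apply: contraNneq zM0 => h; rewrite -e h mulr0.
  by rewrite -e; field; rewrite S0 za.
rewrite avg_sum; under eq_bigr do rewrite avgZ avg_pow //.
rewrite -[M in iota 0 M]subn0 -/(index_iota 0 M) big_mkord (bigD1 (Ordinal M0)) //= dvdn0 expr0 mulr1.
rewrite big1 ?addr0 ?mulr1 // => i i0.
rewrite gtnNdvd ?mulr0 //.
by rewrite lt0n; apply: contraNneq i0 => i0; apply/eqP/val_inj.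
Qed.

(* The integrand is a d/da of a polynomial in a^-1 + p a, so it has no
   constant Fourier coefficient. *)
Lemma avg_exact p k : (k.*2.+2 < M)%N ->
  avg M w (fun a => (a^-1 + p * a) ^+ k * (a^-1 - p * a)) = 0.
Proof.
move=> kM; pose Y : {poly C} := p *: 'X^2.
pose E := (1 - Y) * (1 + Y) ^+ k.
have sY : (size Y <= 3)%N by rewrite (leq_trans (size_scale_leq _ _)) ?size_polyXn.
have s1Y : (size (1 + Y)%R <= 3)%N.
  by rewrite (leq_trans (size_polyD _ _)) // geq_max size_poly1 sY.
have s1NY : (size (1 - Y)%R <= 3)%N.
  by rewrite (leq_trans (size_polyD _ _)) // geq_max size_poly1 size_polyN sY.
have sE : (size E <= M)%N.
  have h2 : (size ((1 + Y) ^+ k)%R <= k.*2.+1)%N.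
    apply: leq_trans (size_poly_exp_leq _ _) _; rewrite ltnS -mul2n leq_mul2r.
    by rewrite -subn1 leq_subLR s1Y orbT.
  rewrite (leq_trans (size_polyMleq _ _)) //.
  by rewrite -subn1 leq_subLR (leq_trans (leq_add s1NY h2)) //; lia.
transitivity (avg M w (fun a => a^-1 ^+ k.+1 * E.[a])).
  apply: eq_avg => // a a1 _ /=; have a0 : a != 0 by rewrite -normr_eq0 a1 oner_eq0.
  rewrite /E /Y !(hornerM, horner_exp, hornerD, hornerN, hornerZ, hornerXn, hornerC).
  have -> : a^-1 + p * a = a^-1 * (1 + p * a ^+ 2) by field.
  have -> : a^-1 - p * a = a^-1 * (1 - p * a ^+ 2) by field.
  by rewrite exprMn [a^-1 ^+ k.+1]exprS !hornerX; ring.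
rewrite avg_coef //; last by lia.
(* The relation (k + 1) E = (k + 1) H - X H' kills the coefficient of index k + 1. *)
pose H := (1 + Y) ^+ k.+1.
have HE : k.+1%:R *: E = k.+1%:R *: H - 'X * H^`().
  rewrite /H /E deriv_exp /= derivD derivC add0r /Y derivZ derivXn /= expr1.
  rewrite !scaler_nat -!mul_polyC [(1 + _) ^+ k.+1]exprS.
  by rewrite -[in LHS]mulr_natr -[X in _ = X - _]mulr_natr -[_ *+ k.+1]mulr_natr; ring.
have : k.+1%:R * E`_k.+1 = 0.
  rewrite -coefZ HE coefB coefZ coefXM coef_deriv mulr_natl /=.
  by rewrite subrr.
by move/eqP; rewrite mulf_eq0 pnatr_eq0 /= => /eqP.
Qed.

(* For large M this is close to 1 if z1 and z2 are in the open disk and close to 0 if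
   exactly one of them is. *)
Definition root_weight z1 z2 : C := (1 - z1 ^+ M)^-1 + (1 - z2 ^+ M)^-1 - 1.

(** With x = a^-1 + z1 z2 a and s = z1 + z2, the denominator is a^-1 (1 - z1 a) (1 - z2 a), and
    partial fractions settle k = 0. The step uses x^(k+1) / (x - s) = x^k + s x^k / (x - s), whose
    first part averages to 0 by [avg_exact]. *)
Lemma avg_root z1 z2 k : z1 ^+ M != 1 -> z2 ^+ M != 1 -> (k.*2 < M)%N ->
  avg M w (fun a => (a^-1 + z1 * z2 * a) ^+ k *
     ((a^-1 - z1 * z2 * a) / (a^-1 + z1 * z2 * a - (z1 + z2)))) =
  (z1 + z2) ^+ k * root_weight z1 z2.
Proof.
move=> z1M z2M.
have ne z a : z ^+ M != 1 -> a ^+ M = 1 -> 1 - z * a != 0.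
  move=> zM aM; rewrite subr_eq0; apply: contraNneq zM => h.
  by apply/eqP; rewrite -[LHS]mulr1 -{1}aM -exprMn -h expr1n.
have den a : a != 0 -> a ^+ M = 1 -> a^-1 + z1 * z2 * a - (z1 + z2) != 0.
  move=> a0 aM.
  have : a^-1 * ((1 - z1 * a) * (1 - z2 * a)) != 0.
    by rewrite !mulf_neq0 ?invr_neq0 // ne.
  by apply: contraNneq => h; rewrite -h; apply/eqP; field.
have nz a : `|a| = 1 -> a != 0 by move=> a1; rewrite -normr_eq0 a1 oner_eq0.
elim: k => [|k IH] kM.
  rewrite expr0 mul1r /root_weight -!avg_geometric //.
  rewrite -[X in _ - X](avg_const w M0) -[- avg _ _ _]mulN1r -avgZ -!avgD; apply: eq_avg => // a a1 aM /=.
  have h1 := ne _ _ z1M aM; have h2 := ne _ _ z2M aM; have h3 := den _ (nz _ a1) aM.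
  have h4 : a^-1 + z1 * z2 * a - (z1 + z2) = a^-1 * ((1 - z1 * a) * (1 - z2 * a)).
    by field; exact: nz.
  rewrite expr0 mul1r h4; field.
  by rewrite h1 h2 (nz _ a1).
rewrite exprS -mulrA -IH; last by lia.
rewrite -[LHS]subr0 -(avg_exact (z1 * z2) (k := k)); last by lia.
rewrite -avgZ -[- avg _ _ _]mulN1r -avgZ -avgD; apply: eq_avg => // a a1 aM /=.
have h3 := den _ (nz _ a1) aM; rewrite exprS; field.
rewrite (nz _ a1) /=; have := mulf_neq0 (nz _ a1) h3; apply: contraNneq => h.
by rewrite -h; apply/eqP; field; exact: nz.
Qed.

End Averages.

(** If both points are inside, the tails z^M / (1 - z^M) are small. If z1 is outside, |z1 z2| < 1
    gives |z2| <= t with t = 1 / |z1|; the weight is then of size t^M, while (z1 + z2)^k may grow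
    like (2 / t)^k, whence the exponent M - k. *)
Lemma root_weight_bound M k (q z1 z2 : C) : (k <= M)%N -> 0 < q -> q < 1 ->
  `|z1 * z2| < 1 -> (0 < M)%N ->
  `|z1| <= q \/ 1 <= q * `|z1| -> `|z2| <= q \/ 1 <= q * `|z2| ->
  `|(if `[< G (z1 + z2, z1 * z2) >] then (z1 + z2) ^+ k else 0) -
    (z1 + z2) ^+ k * root_weight M z1 z2| <= 2 ^+ k.+1 * (q ^+ (M - k) / (1 - q)).
Proof.
move=> kM q0 q1 p1 M0 d1 d2; have qq : 0 < 1 - q by rewrite subr_gt0.
have tail z t : `|z| <= t -> t <= q -> `|z ^+ M / (1 - z ^+ M)| <= t ^+ M / (1 - q).
  move=> zt tq; have z1' : `|z| <= q by apply: le_trans tq.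
  have zM : `|z ^+ M| <= q.
    by rewrite normrX (le_trans _ z1') // ler_iXnr // (le_trans z1') // ltW.
  have lb : 1 - q <= `|1 - z ^+ M|.
    by rewrite (le_trans _ (lerB_dist _ _)) // normr1 lerB.
  have lb0 : 0 < `|1 - z ^+ M| by apply: lt_le_trans lb.
  rewrite normrM normfV; apply: ler_pM; rewrite ?invr_ge0 //.
    by rewrite normrX lerXn2r // nnegrE (le_trans _ zt).
  by rewrite lef_pV2 ?posrE.
have zM z : `|z| <= q -> 1 - z ^+ M != 0.
  move=> zq; rewrite subr_eq0; apply: contraTneq (le_lt_trans zq q1) => h.
  have : `|z| ^+ M = 1 by rewrite -normrX -h normr1.
  by move/eqP; rewrite pexpr_eq1 // => /eqP ->; rewrite ltxx.
have inq z : `|z| < 1 -> `|z| <= q \/ 1 <= q * `|z| -> `|z| <= q.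
  move=> zl [//|h]; have : q * `|z| < 1 by rewrite mulr_ilt1 // ltW.
  by move=> /(le_lt_trans h); rewrite ltxx.
have half (x1 x2 : C) : 0 <= x1 -> 0 <= x2 -> x1 <= x2 -> x1 + x1 <= 2 * x2.
  by move=> _ _ h; rewrite mulr_natl mulr2n lerD.
have [/asboolP Gz|nG] := boolP `[< G (z1 + z2, z1 * z2) >].
  have [l1 l2] := (GP erefl erefl).1 Gz.
  have {}d1 := inq _ l1 d1; have {}d2 := inq _ l2 d2.
  have -> : (z1 + z2) ^+ k - (z1 + z2) ^+ k * root_weight M z1 z2 =
     - ((z1 + z2) ^+ k * (z1 ^+ M / (1 - z1 ^+ M) + z2 ^+ M / (1 - z2 ^+ M))).
    by rewrite /root_weight; field; rewrite !zM.
  rewrite normrN normrM normrX exprSr -mulrA; apply: ler_pM; rewrite ?exprn_ge0 //.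
    rewrite lerXn2r ?nnegrE //; apply: (le_trans (ler_normD _ _)).
    by rewrite -[leRHS]/(1 + 1) lerD // ltW.
  apply: le_trans (ler_normD _ _) _.
  apply: (@le_trans _ _ (q ^+ M / (1 - q) + q ^+ M / (1 - q))).
    by rewrite lerD // tail.
  have qge0 m : 0 <= q ^+ m / (1 - q) by rewrite divr_ge0 ?exprn_ge0 // ltW.
  apply: half => //; rewrite ler_wpM2r ?invr_ge0 ?(ltW qq) //.
  by rewrite ler_wiXn2l ?leq_subr // ltW.
have out y1 y2 : `|y1 * y2| < 1 -> 1 <= `|y1| -> `|y1| <= q \/ 1 <= q * `|y1| ->
    `|(y1 + y2) ^+ k * root_weight M y1 y2| <= 2 ^+ k.+1 * (q ^+ (M - k) / (1 - q)).
  move=> yy y1ge dd; have y1p : 0 < `|y1| by apply: lt_le_trans y1ge.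
  have {}dd : 1 <= q * `|y1|.
    by case: dd => // /(le_trans y1ge)/le_lt_trans/(_ q1); rewrite ltxx.
  pose t := `|y1|^-1; have t0 : 0 < t by rewrite invr_gt0.
  have tq : t <= q by rewrite -[leLHS]mul1r ler_pdivrMr.
  have y1E : `|y1| = t^-1 by rewrite invrK.
  have yV : `|y1^-1| <= t by rewrite normfV.
  have y2t : `|y2| <= t.
    by rewrite -[leLHS]mul1r -(mulVf (lt0r_neq0 y1p)) -mulrA -normrM ler_piMr ?ltW.
  have y10 : y1 != 0 by rewrite -normr_gt0.
  have yq : `|y1^-1| <= q by apply: le_trans tq.
  have y2q : `|y2| <= q by apply: le_trans tq.
  have y1M : 1 - y1 ^+ M != 0.
    have := zM _ yq; apply: contraNneq => h.
    by rewrite exprVn (_ : y1 ^+ M = 1) ?invr1 ?subrr //; apply/eqP; rewrite eq_sym -subr_eq0 h.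
  have -> : root_weight M y1 y2 =
      - (y1^-1 ^+ M / (1 - y1^-1 ^+ M)) + y2 ^+ M / (1 - y2 ^+ M).
    have := zM _ yq; rewrite exprVn => h; rewrite /root_weight.
    have Y0 : y1 ^+ M != 0 by rewrite expf_neq0.
    have Y1 : y1 ^+ M - 1 != 0 by rewrite -opprB oppr_eq0.
    by field; rewrite Y0 ?y1M ?Y1 zM.
  rewrite normrM normrX.
  have s1 : `|y1 + y2| <= 2 / t.
    apply: le_trans (ler_normD _ _) _; rewrite -y1E mulr_natl mulr2n lerD2l.
    by apply: (le_trans y2t); rewrite (le_trans tq) // (le_trans (ltW q1)).
  have s2 : `|- (y1^-1 ^+ M / (1 - y1^-1 ^+ M)) + y2 ^+ M / (1 - y2 ^+ M)| <=
      2 * (t ^+ M / (1 - q)).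
    apply: le_trans (ler_normD _ _) _; rewrite normrN mulr_natl mulr2n.
    by rewrite lerD // tail.
  apply: le_trans (ler_pM (exprn_ge0 _ (normr_ge0 _)) (normr_ge0 _) _ s2) _.
    by apply: lerXn2r s1; rewrite nnegrE // divr_ge0 // ltW.
  have -> : (2 / t) ^+ k * (2 * (t ^+ M / (1 - q))) = 2 ^+ k.+1 * (t ^+ (M - k) / (1 - q)).
    rewrite -{1}(subnK kM) exprD exprMn exprVn exprS; field.
    by rewrite expf_neq0 ?(lt0r_neq0 t0) // lt0r_neq0.
  rewrite ler_wpM2l ?exprn_ge0 // ler_wpM2r ?invr_ge0 ?(ltW qq) //.
  by rewrite lerXn2r // nnegrE ltW.
rewrite sub0r normrN.
have [l1|l1] := boolP (`|z1| < 1).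
  rewrite addrC (_ : root_weight M z1 z2 = root_weight M z2 z1); last first.
    by rewrite /root_weight [_^-1 + _]addrC.
  apply: out => //; first by rewrite mulrC.
  rewrite real_leNgt ?real1 ?normr_real //; apply: contra nG => l2.
  by apply/asboolP/(GP erefl erefl).
by apply: out => //; rewrite real_leNgt ?real1 ?normr_real.
Qed.

End InnerRootSums.

(** * Limits of complex sequences *)

Section Tends.
Variable R : realType.
Local Notation C := R[i].
Implicit Types (x y : nat -> C) (a b l : C).

Definition tends x l := forall e : C, 0 < e ->
  exists N, forall n, (N <= n)%N -> `|x n - l| <= e.

Lemma tends_cst l : tends (fun=> l) l.
Proof. by move=> e e0; exists 0%N => n _; rewrite subrr normr0 ltW. Qed.

Lemma tendsD x y a b : tends x a -> tends y b -> tends (fun n => x n + y n) (a + b).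
Proof.
move=> xa yb e e0; have e2 : 0 < e / 2 by rewrite divr_gt0.
have [N1 h1] := xa _ e2; have [N2 h2] := yb _ e2.
exists (maxn N1 N2) => n; rewrite geq_max => /andP[n1 n2].
rewrite opprD addrACA (le_trans (ler_normD _ _)) // [e]splitr.
by apply: lerD; [apply: h1|apply: h2].
Qed.

Lemma tends_bounded x a : tends x a -> exists2 D : C, 0 < D &
  exists N, forall n, (N <= n)%N -> `|x n| <= D.
Proof.
move=> /(_ 1 ltr01)[N hN]; exists (1 + `|a|); first by rewrite ltr_pwDl.
exists N => n /hN h; rewrite -[x n](subrK a) (le_trans (ler_normD _ _)) //.
by rewrite lerD2r.
Qed.

Lemma tendsM x y a b : tends x a -> tends y b -> tends (fun n => x n * y n) (a * b).
Proof.
move=> xa yb e e0; have [D D0 [N3 hD]] := tends_bounded xa.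
have b1 : 0 < `|b| + 1 by rewrite ltr_wpDl.
have e1 : 0 < e / 2 / D by rewrite !divr_gt0.
have e2 : 0 < e / 2 / (`|b| + 1) by rewrite !divr_gt0.
have [N1 h1] := xa _ e2; have [N2 h2] := yb _ e1.
exists (maxn N3 (maxn N1 N2)) => n; rewrite !geq_max => /and3P[n3 n1 n2].
have -> : x n * y n - a * b = x n * (y n - b) + (x n - a) * b by ring.
apply: le_trans (ler_normD _ _) _; rewrite !normrM [e]splitr; apply: lerD.
  rewrite -[leRHS](divfK (lt0r_neq0 D0)) mulrC.
  by apply: ler_pM => //; [apply: h2|apply: hD].
rewrite -[leRHS](divfK (lt0r_neq0 b1)).
by apply: ler_pM => //; [apply: h1|rewrite lerDl].
Qed.

Lemma tends_sum (I : finType) (x : I -> nat -> C) (a : I -> C) :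
  (forall i, tends (x i) (a i)) -> tends (fun n => \sum_i x i n) (\sum_i a i).
Proof.
move=> h; elim: (index_enum I) => [|i s IH].
  by rewrite big_nil => e e0; exists 0%N => n _; rewrite big_nil subrr normr0 ltW.
rewrite big_cons => e e0; have [N hN] := tendsD (h i) IH e0.
by exists N => n /hN; rewrite big_cons.
Qed.

Lemma tends_conj x a : tends x a -> tends (fun n => (x n)^*) a^*.
Proof.
move=> h e /h[N hN]; exists N => n /hN.
by rewrite -rmorphB norm_conjC.
Qed.

Lemma tends_inv_nat (c : C) : 0 <= c -> tends (fun n => c / n.+1%:R) 0.
Proof.
move=> c0 e e0; have [y y0 yE] := real_complexP (divr_ge0 c0 (ltW e0)).
exists (Num.bound y) => n Nn; rewrite subr0 ger0_norm ?divr_ge0 //.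
rewrite ler_pdivrMr // mulrC -ler_pdivrMr // yE -(rmorph_nat (real_complex R)) lecR.
by apply/ltW/(lt_le_trans (archi_boundP y0)); rewrite ler_nat leqW.
Qed.

Lemma tends_squeeze x y a c : 0 <= c -> (forall n, `|x n - y n| <= c / n.+1%:R) ->
  tends y a -> tends x a.
Proof.
move=> c0 h ya e e0; have e2 : 0 < e / 2 by rewrite divr_gt0.
have [N1 h1] := ya _ e2; have [N2 h2] := tends_inv_nat c0 e2.
exists (maxn N1 N2) => n; rewrite geq_max => /andP[n1 n2].
rewrite -[x n](subrK (y n)) -addrA (le_trans (ler_normD _ _)) // [e]splitr.
apply: lerD; last exact: h1.
apply: (le_trans (h n)); have := h2 n n2.
by rewrite subr0 ger0_norm // divr_ge0.
Qed.

Lemma tends_uniq x a b : tends x a -> tends x b -> a = b.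
Proof.
move=> xa xb; apply/eqP; rewrite -subr_eq0 -normr_le0.
have K2 : (0 : C) <= 2 by [].
apply: (complex_le_eps K2); rewrite ?normr_real ?real0 // => e e0.
have [N1 h1] := xa _ e0; have [N2 h2] := xb _ e0.
have k1 := h1 _ (leq_maxl N1 N2); have k2 := h2 _ (leq_maxr N1 N2).
rewrite add0r mulr_natl mulr2n -[a](subrK (x (maxn N1 N2))) -addrA.
by rewrite (le_trans (ler_normD _ _)) // lerD // distrC.
Qed.

Lemma tends_le x y a b : a \is Num.real -> b \is Num.real ->
  (forall n, x n <= y n) -> tends x a -> tends y b -> a <= b.
Proof.
move=> ar br h xa yb; have K2 : (0 : C) <= 2 by [].
apply: (complex_le_eps K2) => // e e0.
have [N1 h1] := xa _ e0; have [N2 h2] := yb _ e0; set n := maxn N1 N2.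
have k1 := h1 _ (leq_maxl N1 N2); have k2 := h2 _ (leq_maxr N1 N2).
have key (z c : C) : c \is Num.real -> `|z - c| <= e ->
    ('Re z <= c + e) /\ (c - e <= 'Re z).
  move=> cr zc; have r : 'Re z - c = 'Re (z - c) by rewrite raddfB /= (Creal_ReP _ cr).
  have : `|'Re z - c| <= e by rewrite r (le_trans (leif_normC_Re_Creal _)).
  rewrite real_ler_norml ?realB ?Creal_Re // lerBlDr => /andP[l1 l2].
  split; first by rewrite addrC.
  by rewrite -subr_ge0 (_ : 'Re z - (c - e) = 'Re z - c - (- e)) ?subr_ge0 //; ring.
have [_ a1] := key _ _ ar k1; have [b1 _] := key _ _ br k2.
have xy : 'Re (x n) <= 'Re (y n).
  rewrite -subr_ge0 -raddfB /= (Creal_ReP _ _) ?subr_ge0 ?h //.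
  by rewrite ger0_real // subr_ge0.
have := le_trans a1 (le_trans xy b1).
by rewrite lerBlDr mulr_natl mulr2n addrA.
Qed.

Lemma tends_sub x a (f : nat -> nat) : (forall n, (n <= f n)%N) ->
  tends x a -> tends (x \o f) a.
Proof.
move=> hf h e /h[N hN]; exists N => n Nn /=; apply: hN.
exact: leq_trans (hf n).
Qed.

(** The selection f need not be increasing: n <= f n is enough to carry limits over. *)
Lemma bounded_subsequence (I : finType) (x : nat -> I -> C) (D : C) :
  (forall n i, `|x n i| <= D) ->
  exists (f : nat -> nat) (a : I -> C), (forall n, (n <= f n)%N) /\
    forall i, tends (fun n => x (f n) i) (a i).
Proof.
move=> xD; pose u n (j : 'I_#|I|) := x n (enum_val j).
have [a ha] := bolzano_weierstrass (fun n j => xD n (enum_val j) : `|u n j| <= D).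
have hex n : exists m, (n <= m)%N /\ forall j, `|u m j - a j| < n.+1%:R^-1.
  have n0 : 0 < (n.+1%:R^-1 : C) by rewrite invr_gt0.
  by have [m nm hm] := ha _ n n0; exists m; split.
have [f hf] := choice hex.
exists f, (fun i => a (enum_rank i)); split=> [n|i]; first by case: (hf n).
apply: (tends_squeeze ler01 _ (tends_cst _)) => n.
have [_ /(_ (enum_rank i))] := hf n; rewrite /u enum_rankK => /ltW.
by rewrite mul1r.
Qed.

Lemma tends_norm x a : tends x a -> tends (fun n => `|x n|) `|a|.
Proof.
move=> h e /h[N hN]; exists N => n /hN; apply: le_trans.
exact: ler_dist_dist.
Qed.

Lemma tends_horner (c : {poly C}) y b : tends y b -> tends (fun n => c.[y n]) c.[b].
Proof.
move=> yb; elim/poly_ind: c => [|c k IH].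
  by move=> e e0; exists 0%N => n _; rewrite !horner0 subrr normr0 ltW.
rewrite hornerMXaddC => e /(tendsD (tendsM IH yb) (tends_cst k))[N h].
by exists N => n /h; rewrite hornerMXaddC.
Qed.

Lemma tends_bivariate (f : {poly {poly C}}) x y a b : tends x a -> tends y b ->
  tends (fun n => f.[(x n)%:P].[y n]) f.[a%:P].[b].
Proof.
move=> xa yb; elim/poly_ind: f => [|f c IH].
  by move=> e e0; exists 0%N => n _; rewrite !horner0 subrr normr0 ltW.
rewrite hornerMXaddC hornerD hornerM hornerC => e.
move=> /(tendsD (tendsM IH xa) (tends_horner c yb))[N h].
by exists N => n /h; rewrite hornerMXaddC hornerD hornerM hornerC.
Qed.

Lemma tends_ratio : tends (fun n => n.+1%:R / n.+2%:R) 1.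
Proof.
apply: (tends_squeeze ler01 _ (tends_cst 1)) => n; rewrite -[n.+2%:R]natr1.
have n0 : 0 < (n.+1%:R : C) by rewrite ltr0n.
have -> : n.+1%:R / (n.+1%:R + 1) - 1 = - (n.+1%:R + 1)^-1 :> C.
  by field; rewrite lt0r_neq0 // addr_gt0.
rewrite normrN normfV div1r ger0_norm ?(addr_ge0 (ltW n0)) // lef_pV2 ?posrE ?addr_gt0 //.
by rewrite lerDl.
Qed.

End Tends.

(** * Power sums of the roots in a fibre of G are polynomials in p *)

Section InnerPowerSums.
Variable R : realType.
Local Notation C := R[i].
Variable f : {poly {poly C}}.
Hypothesis f_boundary : forall a p : C, `|a| = 1 -> `|p| < 1 ->
  f.[(a^-1 + p * a)%:P].[p] != 0.

(** By compactness: zeros with |z1| approaching 1 would have a limit with |z1| = 1 and |z1 z2| <= r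
    < 1, where f does not vanish. The two alternatives keep z1 off the circle on either side. *)
Lemma root_separation (r : C) : 0 <= r -> r < 1 ->
  exists q : C, [/\ 0 < q, q < 1 & forall z1 z2 : C, `|z1 * z2| <= r ->
    f.[(z1 + z2)%:P].[z1 * z2] = 0 -> `|z1| <= q \/ 1 <= q * `|z1|].
Proof.
move=> r0 r1; pose q (n : nat) : C := n.+1%:R / n.+2%:R.
have q0 n : 0 < q n by rewrite divr_gt0.
have q1 n : q n < 1 by rewrite ltr_pdivrMr // mul1r ltr_nat.
have [[n h]|/forallNP h] := pselect (exists n, forall z1 z2 : C, `|z1 * z2| <= r ->
    f.[(z1 + z2)%:P].[z1 * z2] = 0 -> `|z1| <= q n \/ 1 <= q n * `|z1|).
  by exists (q n).
have {}h n : exists z : bool -> C, [/\ `|z true * z false| <= r,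
    f.[(z true + z false)%:P].[z true * z false] = 0,
    q n < `|z true| & q n * `|z true| < 1].
  have := h n; move=> /existsNP[z1 /existsNP[z2 /not_implyP[h1 /not_implyP[h2]]]].
  move=> /not_orP[/negP h3 /negP h4]; exists (fun b => if b then z1 else z2); split=> //=.
    by rewrite real_ltNge ?normr_real ?gtr0_real.
  by rewrite real_ltNge ?realM ?normr_real ?gtr0_real.
have [z hz] := choice h.
have qh n : 2^-1 <= q n.
  by rewrite ler_pdivlMr // ler_pdivrMl // -natrM ler_nat; lia.
have zb n b : `|z n b| <= 2.
  have [h1 h2 h3 h4] := hz n; case: b.
    have : 2^-1 * `|z n true| <= 1.
      by apply: ltW; apply: le_lt_trans h4; rewrite ler_wpM2r.
    by rewrite mulrC ler_pdivrMr // mul1r.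
  have zp : 0 < `|z n true| by apply: lt_trans h3.
  rewrite -(ler_pM2l zp) -normrM; apply: (le_trans h1); apply: (le_trans (ltW r1)).
  rewrite -[leLHS](mulVf (x := 2)) // ler_wpM2r //.
  by apply: le_trans (ltW h3); exact: qh.
have [m [x [hm hx]]] := bounded_subsequence zb.
have qlim : tends (q \o m) 1 by apply: (tends_sub hm); exact: tends_ratio.
have x01 : `|x true| = 1.
  have zx := tends_norm (hx true); apply/eqP; rewrite eq_le.
  rewrite -{1}[`|x true|]mul1r (tends_le _ _ _ (tendsM qlim zx) (tends_cst 1)) ?realM ?normr_real ?real1 //.
    by rewrite (tends_le _ _ _ qlim zx) ?normr_real ?real1 // => n; case: (hz (m n)) => _ _ /ltW.
  by move=> n; case: (hz (m n)) => _ _ _ /ltW.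
have xr : `|x true * x false| <= r.
  apply: (tends_le _ _ _ (tends_norm (tendsM (hx true) (hx false))) (tends_cst r)).
  - exact: normr_real.
  - exact: ger0_real.
  - by move=> n; case: (hz (m n)).
have F0 : f.[(x true + x false)%:P].[x true * x false] = 0.
  have := tends_bivariate f (tendsD (hx true) (hx false)) (tendsM (hx true) (hx false)).
  move/tends_uniq; apply; apply: (tends_squeeze ler01 _ (tends_cst 0)) => n.
  by have [_ -> _ _] := hz (m n); rewrite subrr normr0 divr_ge0.
have nx : `|(x true)^-1| = 1 by rewrite normfV x01 invr1.
have x00 : x true != 0 by rewrite -normr_eq0 x01 oner_eq0.
have := f_boundary nx (le_lt_trans xr r1).
by rewrite invrK mulrAC divff // mul1r F0 eqxx.
Qed.

(** Roots are listed with multiplicity, in an order that may vary arbitrarily with p; only symmetric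
    functions of the list are used. *)
Definition fibre_roots (p : C) : seq C :=
  sval (closed_field_poly_normal (fibre p f)).

Lemma fibre_rootsE p :
  fibre p f = lead_coef (fibre p f) *: \prod_(b <- fibre_roots p) ('X - b%:P).
Proof. exact: (svalP (closed_field_poly_normal (fibre p f))). Qed.

Lemma fibre_roots_root p b : b \in fibre_roots p -> f.[b%:P].[p] = 0.
Proof.
move=> hb; rewrite -fibreE fibre_rootsE hornerZ; apply/eqP.
by rewrite mulf_eq0 -[_ == 0 in X in _ || X]/(root _ b) root_prod_XsubC hb orbT.
Qed.

Lemma fibre_neq0 p : `|p| < 1 -> fibre p f != 0.
Proof.
move=> p1; have := f_boundary (normr1 C) p1.
by apply: contraNneq => h; rewrite -fibreE h horner0.
Qed.

Lemma size_fibre_roots p : `|p| < 1 -> (size (fibre_roots p) <= size f)%N.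
Proof.
move=> p1; apply: (@leq_trans (size (fibre p f))); last exact: size_poly.
rewrite fibre_rootsE size_scale ?lead_coef_eq0 ?fibre_neq0 //.
by rewrite size_prod_XsubC.
Qed.

Definition inner_roots p : seq C := [seq b <- fibre_roots p | `[< G (b, p) >]].

Definition inner_power_sum k (p : C) : C := \sum_(b <- inner_roots p) b ^+ k.

(* By the argument principle on the curve a |-> a^-1 + p a, which separates the roots
   s = z1 + z2 with z1, z2 in the disk from the others. *)
Lemma inner_power_sum_approx k r : 0 <= r -> r < 1 -> approx_on r (inner_power_sum k).
Proof.
move=> r0 r1; apply: approx_lim => e e0.
have [q [q0 q1 hq]] := root_separation r0 r1.
have qq : 0 < 1 - q by rewrite subr_gt0.
pose D : C := (size f).+1%:R * 2 ^+ k.+1 / (1 - q).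
have D0 : 0 < D by rewrite divr_gt0 // mulr_gt0 // exprn_gt0.
have [n0 hn] := expr_small (ltW q0) q1 (divr_gt0 e0 D0).
pose M := (n0 + k.*2).+1.
have [w wM] := prim_root_ex R (ltn0Sn (n0 + k.*2)); rewrite -/M in wM.
have M0 : (0 < M)%N by [].
have kM : (k <= M)%N by rewrite ltnW // ltnS -addnn addnA leq_addl.
have nMk : (n0 <= M - k)%N by rewrite leq_subRL // ltnW // ltnS addnC leq_add2l -addnn leq_addl.
(* Here ['X] is the variable p. For fixed a the integrand is a polynomial in p divided by [f.[S a]],
   which has no zero in the disk, so each of the M terms is approximable. *)
pose S (a : C) : {poly C} := (a^-1)%:P + a *: 'X.
have SE a p : (S a).[p] = a^-1 + p * a.
  by rewrite hornerD hornerC hornerZ hornerX [p * a]mulrC.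
have fS (g : {poly {poly C}}) a p : g.[S a].[p] = g.[(a^-1 + p * a)%:P].[p].
  by rewrite -fibreE -SE; symmetry; exact: horner_map.
pose P a := S a ^+ k * ((a^-1)%:P - a *: 'X) * (deriv f).[S a].
pose phi (a p : C) := (P a).[p] * (f.[S a].[p])^-1.
exists (fun p => avg M w (phi ^~ p)).
  apply: approxM => //.
    by apply: approx_ext (approx_poly r (M%:R^-1)%:P) => p _; rewrite hornerC.
  have := @approx_sum R 'I_M (index_enum 'I_M) r (fun i => phi (w ^+ i)).
  apply=> i; apply: approxM => //; first exact: approx_poly.
  apply: approx_inv_poly => // p p1; rewrite fS; apply: f_boundary => //.
  exact: prim_root_norm M0 wM.
move=> p pr; have p1 : `|p| < 1 by apply: le_lt_trans r1.
have hex (b : C) : exists zz : C * C, b = zz.1 + zz.2 /\ p = zz.1 * zz.2.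
  by have [z1 [z2 [h1 h2]]] := symm_roots b p; exists (z1, z2).
have [z hz] := choice hex.
have sep b : b \in fibre_roots p ->
    (`|(z b).1| <= q \/ 1 <= q * `|(z b).1|) /\ (`|(z b).2| <= q \/ 1 <= q * `|(z b).2|).
  move=> /fibre_roots_root hb; have [h1 h2] := hz b; split.
    by apply: (hq _ (z b).2); rewrite -?h1 -?h2.
  by apply: (hq _ (z b).1); rewrite [_ * (z b).1]mulrC ?[_ + (z b).1]addrC -?h1 -?h2.
have zM x : `|x| <= q \/ 1 <= q * `|x| -> x ^+ M != 1.
  move=> hx; apply/negP => /eqP/(congr1 Num.norm); rewrite normrX normr1 => /eqP.
  rewrite pexpr_eq1 // => /eqP x1; case: hx; rewrite x1 ?mulr1 => h.
    by have := le_lt_trans h q1; rewrite ltxx.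
  by have := le_lt_trans h q1; rewrite ltxx.
have psiE : avg M w (phi ^~ p) =
    \sum_(b <- fibre_roots p) b ^+ k * root_weight M (z b).1 (z b).2.
  transitivity (avg M w (fun a => \sum_(b <- fibre_roots p)
      (a^-1 + p * a) ^+ k * ((a^-1 - p * a) / (a^-1 + p * a - b)))).
    apply: eq_avg => // a a1 _; rewrite /phi /P !hornerM horner_exp SE !fS.
    rewrite hornerD hornerN hornerC hornerZ hornerX [a * p]mulrC.
    under eq_bigr do rewrite mulrA.
    rewrite -mulr_sumr -[LHS]mulrA; congr (_ * _).
    have := f_boundary a1 p1; rewrite -!fibreE.
    have -> : fibre p (deriv f) = deriv (fibre p f) by rewrite /fibre deriv_map.
    by rewrite fibre_rootsE; exact: log_derivative.
  rewrite avg_sum; apply: eq_big_seq => b hb; have [h1 h2] := hz b.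
  have [d1 d2] := sep b hb.
  have k2M : (k.*2 < M)%N by rewrite /M ltnS leq_addl.
  by have := avg_root M0 wM (zM _ d1) (zM _ d2) k2M; rewrite -h2 -h1.
rewrite psiE /inner_power_sum /inner_roots big_filter big_mkcond -sumrB /=.
apply: le_trans (ler_norm_sum _ _ _) _.
apply: (@le_trans _ _ (\sum_(b <- fibre_roots p) 2 ^+ k.+1 * (q ^+ (M - k) / (1 - q)))).
  rewrite big_seq [leRHS]big_seq; apply: ler_sum => b hb; have [h1 h2] := hz b.
  have [d1 d2] := sep b hb.
  have zp : `|(z b).1 * (z b).2| < 1 by rewrite -h2.
  by have := root_weight_bound kM q0 q1 zp M0 d1 d2; rewrite -h2 -h1.
rewrite big_const_seq count_predT iter_addr_0 -[_ *+ size _]mulr_natl.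
apply: (@le_trans _ _ ((size f).+1%:R * (2 ^+ k.+1 * (q ^+ (M - k) / (1 - q))))).
  rewrite ler_wpM2r ?mulr_ge0 ?exprn_ge0 ?invr_ge0 ?(ltW q0) ?(ltW qq) //.
  by rewrite ler_nat; apply: leqW; exact: size_fibre_roots.
have -> : (size f).+1%:R * (2 ^+ k.+1 * (q ^+ (M - k) / (1 - q))) = q ^+ (M - k) * D.
  by rewrite /D; ring.
by rewrite -ler_pdivlMr // hn.
Qed.

(** For a root b = z1 + z2 with p = z1 z2, b - p conj(b) = z1 (1 - |z2|^2) + z2 (1 - |z1|^2), and
    |z1|, |z2| >= |p|. The factor k 2^k is a Lipschitz constant of x^k on |x| <= 2, and [size f]
    bounds the number of roots. *)
Lemma inner_power_sum_reflection k p : `|p| < 1 ->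
  `|inner_power_sum k p - p ^+ k * (inner_power_sum k p)^*| <=
    ((size f)%:R * (k%:R * 2 ^+ k * 2)) * (1 - `|p| ^+ 2).
Proof.
move=> p1; rewrite /inner_power_sum rmorph_sum mulr_sumr -sumrB.
apply: le_trans (ler_norm_sum _ _ _) _.
have pk (x y : C) : `|x| <= 2 -> `|y| <= 2 -> `|x ^+ k - y ^+ k| <= k%:R * 2 ^+ k * `|x - y|.
  move=> x2 y2; elim: k => [|n IH]; first by rewrite subrr normr0 !mul0r.
  have -> : x ^+ n.+1 - y ^+ n.+1 = x * (x ^+ n - y ^+ n) + (x - y) * y ^+ n.
    by rewrite !exprS; ring.
  have -> : n.+1%:R * 2 ^+ n.+1 * `|x - y| =
      2 * (n%:R * 2 ^+ n * `|x - y|) + 2 * 2 ^+ n * `|x - y|.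
    by rewrite -natr1 exprS; ring.
  apply: le_trans (ler_normD _ _) _; rewrite !normrM; apply: lerD.
    exact: ler_pM.
  rewrite mulrC ler_wpM2r // normrX; apply: (@le_trans _ _ (2 ^+ n)).
    by rewrite lerXn2r // nnegrE.
  by rewrite ler_peMl ?exprn_ge0 // ler1n.
apply: (@le_trans _ _ (\sum_(b <- inner_roots p) k%:R * 2 ^+ k * 2 * (1 - `|p| ^+ 2))).
  rewrite big_seq [leRHS]big_seq; apply: ler_sum => b.
  rewrite mem_filter => /andP[/asboolP Gb _].
  have [z1 [z2 [h1 h2]]] := symm_roots b p.
  have [l1 l2] := (GP h1 h2).1 Gb.
  have b2 : `|b| <= 2.
    by rewrite h1 (le_trans (ler_normD _ _)) // -[leRHS]/(1 + 1) lerD // ltW.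
  have pb2 : `|p * b^*| <= 2.
    by rewrite normrM norm_conjC (le_trans _ b2) // ler_piMl // ltW.
  rewrite rmorphXn -exprMn; apply: (le_trans (pk _ _ b2 pb2)).
  rewrite -[leRHS]mulrA ler_wpM2l ?mulr_ge0 ?exprn_ge0 //.
  have pz x y : p = x * y -> `|y| < 1 -> `|p| <= `|x|.
    by move=> -> y1; rewrite normrM ler_piMr // ltW.
  have -> : b - p * b^* = z1 * (1 - `|z2| ^+ 2) + z2 * (1 - `|z1| ^+ 2).
    by rewrite h1 h2 rmorphD /= !normCK; ring.
  apply: le_trans (ler_normD _ _) _; rewrite !normrM mulr_natl mulr2n.
  have sq x : `|p| <= `|x| -> `|x| < 1 -> `|1 - `|x| ^+ 2| <= 1 - `|p| ^+ 2.
    move=> px x1; rewrite ger0_norm ?lerB ?lerXn2r ?nnegrE //.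
    by rewrite subr_ge0 exprn_ile1 // ltW.
  have q1 := pz _ _ h2 l2; have q2 := pz _ _ (etrans h2 (mulrC _ _)) l1.
  by apply: lerD; rewrite (le_trans (ler_piMl _ (ltW _))) // sq.
rewrite big_const_seq count_predT iter_addr_0 -[_ *+ size _]mulr_natl -[leRHS]mulrA.
rewrite ler_wpM2r ?mulr_ge0 ?exprn_ge0 //.
  by rewrite subr_ge0 exprn_ile1 // ltW.
rewrite ler_nat (leq_trans _ (size_fibre_roots p1)) //.
by rewrite size_filter count_size.
Qed.

Lemma inner_power_sum_poly k : exists2 P : {poly C}, (size P <= k.+1)%N &
  forall p, `|p| < 1 -> inner_power_sum k p = P.[p].
Proof.
apply: (reflection_poly (L := (size f)%:R * (k%:R * 2 ^+ k * 2))).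
- by rewrite !mulr_ge0 ?exprn_ge0.
- by move=> r r0 r1; apply: inner_power_sum_approx.
- exact: inner_power_sum_reflection.
Qed.

End InnerPowerSums.

(** * Newton's identities *)

Section NewtonIdentities.
Variable K : comNzRingType.
Implicit Types (rs : seq K).

(** The reversed polynomial: its n-th coefficient is (-1)^n times the n-th elementary symmetric
    function, and 0 beyond the number of roots, so that Newton's identities take one form for all
    n. *)
Definition rev_roots_poly rs : {poly K} := \prod_(r <- rs) (1 - r *: 'X).

Definition power_sum rs k := \sum_(r <- rs) r ^+ k.

Lemma coef_rev_roots_cons r rs n :
  (rev_roots_poly (r :: rs))`_n.+1 =
  (rev_roots_poly rs)`_n.+1 - r * (rev_roots_poly rs)`_n.
Proof.
by rewrite /rev_roots_poly big_cons mulrBl mul1r coefB -scalerAl coefZ coefXM.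
Qed.

Lemma coef0_rev_roots rs : (rev_roots_poly rs)`_0 = 1.
Proof.
elim: rs => [|r rs IH]; first by rewrite /rev_roots_poly big_nil coef1.
rewrite /rev_roots_poly big_cons mulrBl mul1r coefB -scalerAl coefZ coefXM.
by rewrite mulr0 subr0.
Qed.

Lemma size_rev_roots rs : (size (rev_roots_poly rs) <= (size rs).+1)%N.
Proof.
elim: rs => [|r rs IH]; first by rewrite /rev_roots_poly big_nil size_poly1.
apply/leq_sizeP => -[//|j]; rewrite ltnS => hj.
by rewrite coef_rev_roots_cons !nth_default ?mulr0 ?subr0 // (leq_trans IH) // leqW.
Qed.

Lemma newton rs n : n%:R * (rev_roots_poly rs)`_n +
  \sum_(i < n) power_sum rs i.+1 * (rev_roots_poly rs)`_(n - i.+1) = 0.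
Proof.
elim: rs n => [|r rs IH] n.
  rewrite big1 => [|i _]; last by rewrite /power_sum big_nil mul0r.
  by rewrite /rev_roots_poly big_nil coef1; case: n => [|n]; rewrite /= ?mul0r ?mulr0 addr0.
case: n => [|n]; first by rewrite mul0r big_ord0 addr0.
set c := rev_roots_poly rs; set c' := rev_roots_poly (r :: rs).
have c'S j : c'`_j.+1 = c`_j.+1 - r * c`_j := coef_rev_roots_cons r rs j.
(* Since c' = (1 - r X) c, multiplying c' by the series of 1 / (1 - r X) returns c; this is the
   contribution of the new root r. *)
have tele m : \sum_(i < m.+1) r ^+ i.+1 * c'`_(m - i) = r * c`_m.
  elim: m => [|m IHm]; first by rewrite big_ord1 !coef0_rev_roots expr1.
  rewrite big_ord_recl /= expr1 subn0 c'S.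
  under eq_bigr => i _ do rewrite /bump /= add1n subSS exprS -mulrA.
  by rewrite -mulr_sumr IHm; ring.
have pE i : power_sum (r :: rs) i = r ^+ i + power_sum rs i.
  by rewrite /power_sum big_cons.
under eq_bigr => i _ do rewrite pE mulrDl subSS.
rewrite big_split /= tele.
have -> : \sum_(i < n.+1) power_sum rs i.+1 * c'`_(n - i) =
    \sum_(i < n.+1) power_sum rs i.+1 * c`_(n.+1 - i.+1) -
    r * \sum_(i < n) power_sum rs i.+1 * c`_(n - i.+1).
  rewrite !big_ord_recr /= !subnn !coef0_rev_roots addrAC; congr (_ + _).
  rewrite mulr_sumr -sumrB; apply: eq_bigr => i _.
  rewrite subSS -(subnSK (ltn_ord i)) c'S; ring.
have h1 := IH n.+1; have h2 := IH n; rewrite -/c in h1 h2.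
move: h1 h2; set S1 := \sum_(i < n.+1) _; set S2 := \sum_(i < n) _ => h1 h2.
rewrite c'S -natr1 in h1 *.
have -> : (n%:R + 1) * (c`_n.+1 - r * c`_n) + (r * c`_n + (S1 - r * S2)) =
  ((n%:R + 1) * c`_n.+1 + S1) - r * (n%:R * c`_n + S2) by ring.
by rewrite h1 h2 mulr0 subr0.
Qed.

Lemma prod_roots_rev rs : \prod_(r <- rs) ('X - r%:P) =
  \sum_(k < (size rs).+1) (rev_roots_poly rs)`_k *: 'X^(size rs - k).
Proof.
elim: rs => [|r rs IH].
  by rewrite big_nil big_ord1 coef0_rev_roots subnn scale1r expr0.
rewrite big_cons IH [RHS]big_ord_recl /= coef0_rev_roots scale1r subn0.
under [in RHS]eq_bigr => i _ do rewrite /bump /= add1n coef_rev_roots_cons subSS scalerBl.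
rewrite sumrB mulrBl.
have -> : \sum_(i < (size rs).+1) (r * (rev_roots_poly rs)`_i) *: 'X^(size rs - i) =
    r%:P * \sum_(k < (size rs).+1) (rev_roots_poly rs)`_k *: 'X^(size rs - k).
  by rewrite mulr_sumr; apply: eq_bigr => i _; rewrite -scalerA mul_polyC.
rewrite addrA; congr (_ - _).
rewrite [in RHS]big_ord_recr /= nth_default ?scale0r ?addr0; last exact: size_rev_roots.
rewrite mulr_sumr big_ord_recl /= coef0_rev_roots scale1r subn0 exprS.
congr (_ + _); apply: eq_bigr => i _; rewrite /bump /= add1n -scalerAr -exprS.
by rewrite subnSK.
Qed.

End NewtonIdentities.

(** * The monic factor that carries the zeros in G *)

Section InnerFactor.
Variable R : realType.
Local Notation C := R[i].

Lemma disk_points_neq0 (c : {poly C}) : (forall p : C, `|p| < 1 -> c.[p] = 0) -> c = 0.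
Proof.
move=> h; apply/eqP; apply: contraT => c0.
pose x (i : nat) : C := (i.+2)%:R^-1.
have xinj : injective x by move=> i j /invr_inj/eqP; rewrite eqr_nat => /eqP[].
have := max_poly_roots c0 (rs := [seq x i | i <- iota 0 (size c)]).
rewrite size_map size_iota ltnn; apply.
  apply/allP => _ /mapP[i _ ->]; rewrite rootE h // normfV normr_nat.
  by rewrite invf_lt1 // ltr1n.
by rewrite map_inj_uniq ?iota_uniq.
Qed.

Lemma disk_fibre_eq0 (g : {poly {poly C}}) :
  (forall p : C, `|p| < 1 -> fibre p g = 0) -> g = 0.
Proof.
move=> h; apply/polyP => i; rewrite coef0; apply: disk_points_neq0 => p p1.
by rewrite -coef_fibre h // coef0.
Qed.

(** In characteristic 0, Newton's identities can be solved for the elementary symmetric functions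
    one after another. *)
Lemma power_sums_elementary (rs : C -> seq C) (N : nat -> {poly C}) :
  (forall k p, `|p| < 1 -> power_sum (rs p) k = (N k).[p]) ->
  forall n, exists c : {poly C}, forall p, `|p| < 1 ->
    (rev_roots_poly (rs p))`_n = c.[p].
Proof.
move=> hN n; have [m] := ubnP n; elim: m => // m IH in n *; rewrite ltnS => nm.
case: n nm => [|n] nm; first by exists 1 => p p1; rewrite coef0_rev_roots hornerC.
have hex (i : 'I_n.+1) : exists c : {poly C}, forall p, `|p| < 1 ->
    (rev_roots_poly (rs p))`_(n.+1 - i.+1) = c.[p].
  by apply: IH; rewrite subSS (leq_ltn_trans (leq_subr _ _)).
have [c hc] := choice hex.
exists (- (n.+1%:R^-1 *: \sum_(i < n.+1) N i.+1 * c i)) => p p1.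
have := newton (rs p) n.+1.
rewrite hornerN hornerZ horner_sum => /eqP; rewrite addr_eq0 => /eqP h.
have n0 : n.+1%:R != 0 :> C by rewrite pnatr_eq0.
apply: (mulfI n0); rewrite h mulrN mulrA divff // mul1r; congr (- _).
by apply: eq_bigr => i _; rewrite hornerM hc // hN.
Qed.

Lemma fibre_inner_outer (f : {poly {poly C}}) p :
  fibre p f = (lead_coef (fibre p f) *:
    \prod_(b <- [seq b <- fibre_roots f p | ~~ `[< G (b, p) >]]) ('X - b%:P)) *
    \prod_(b <- inner_roots f p) ('X - b%:P).
Proof.
rewrite /inner_roots !big_filter {1}(fibre_rootsE f p).
by rewrite (bigID (fun b => `[< G (b, p) >])) /= mulrC scalerAl.
Qed.

Lemma inner_factor (f : {poly {poly C}}) : (forall a p : C, `|a| = 1 -> `|p| < 1 ->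
    f.[(a^-1 + p * a)%:P].[p] != 0) ->
  exists g u : {poly {poly C}}, [/\ f = u * g, g \is monic,
    forall s p : C, `|p| < 1 -> g.[s%:P].[p] = 0 -> G (s, p) &
    forall s p : C, G (s, p) -> u.[s%:P].[p] != 0].
Proof.
move=> fb; pose rs := inner_roots f.
have hex k : exists P : {poly C}, (size P <= k.+1)%N /\
    forall p, `|p| < 1 -> power_sum (rs p) k = P.[p].
  by have [P sP hP] := inner_power_sum_poly fb k; exists P; split.
have [N hN] := choice hex.
(* The power sum of exponent 0 counts the roots and is a polynomial of degree 0, so their number
   does not depend on p. *)
have [m hm] : exists m, forall p, `|p| < 1 -> size (rs p) = m.
  exists (size (rs 0)) => p p1; have [s0 h0] := hN 0%N.
  have [c Nc] : exists c, N 0%N = c%:P by exists (N 0%N)`_0; exact: size1_polyC.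
  have sz q : `|q| < 1 -> (size (rs q))%:R = c.
    move=> q1; rewrite -[c](hornerC c q) -Nc -h0 // /power_sum.
    by rewrite big_const_seq count_predT iter_addr_0.
  by apply/eqP; rewrite -(eqr_nat C) !sz // normr0.
have [c hc] := choice (power_sums_elementary (fun k p p1 => (hN k).2 p p1)).
pose g : {poly {poly C}} := 'X^m + \sum_(i < m) (c i.+1) *: 'X^(m - i.+1).
have gsum : (size (\sum_(i < m) (c i.+1) *: 'X^(m - i.+1))%R <= m)%N.
  apply: (leq_trans (size_sum _ _ _)); apply/bigmax_leqP => i _.
  apply: (leq_trans (size_scale_leq _ _)); rewrite size_polyXn.
  by have := ltn_ord i; lia.
have gm : g \is monic by rewrite monicE lead_coefDl ?lead_coefXn // size_polyXn ltnS.
have sg : size g = m.+1 by rewrite size_polyDl ?size_polyXn // ltnS.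
have gE p : `|p| < 1 -> fibre p g = \prod_(r <- rs p) ('X - r%:P).
  move=> p1; rewrite prod_roots_rev hm // big_ord_recl coef0_rev_roots scale1r subn0.
  rewrite /g rmorphD rmorphXn /= fibreX rmorph_sum; congr (_ + _).
  apply: eq_bigr => i _; rewrite /bump /= add1n hc //.
  by rewrite -[in LHS]mul_polyC rmorphM rmorphXn /= fibreX fibreC mul_polyC.
clearbody g.
have [u fE] : exists u, f = u * g.
  apply: (monic_divides (A := fun p => `|p| < 1) gm); first exact: disk_fibre_eq0.
  by move=> p p1; rewrite (fibre_inner_outer f p) (gE p p1); exact: dvdp_mull (dvdpp _).
exists g, u; split=> // s p; last first.
  move=> Gs; have p1 : `|p| < 1.
    have [z1 [z2 [h1 h2]]] := symm_roots s p; have [l1 l2] := (GP h1 h2).1 Gs.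
    by rewrite h2 normrM mulr_ilt1.
  have l0 : lead_coef (fibre p f) != 0 by rewrite lead_coef_eq0 fibre_neq0.
  have uE : fibre p u = lead_coef (fibre p f) *:
      \prod_(b <- [seq b <- fibre_roots f p | ~~ `[< G (b, p) >]]) ('X - b%:P).
    have g0 : fibre p g != 0 by rewrite (gE p p1); apply/monic_neq0/monic_prod_XsubC.
    apply: (mulIf g0); transitivity (fibre p f); first by rewrite fE rmorphM.
    by rewrite gE // -fibre_inner_outer.
  rewrite -fibreE uE hornerZ mulf_eq0 negb_or l0 /=.
  rewrite -[_ == 0]/(root _ s) root_prod_XsubC mem_filter negb_and negbK.
  by apply/orP; left; apply/asboolP.
move=> p1; rewrite -fibreE gE // => /eqP.
by rewrite -[_ == 0]/(root _ s) root_prod_XsubC mem_filter => /andP[/asboolP].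
Qed.

End InnerFactor.

(** * Polynomials vanishing on the circle, and the fibres of a monic polynomial *)

Section CirclePoints.
Variable R : realType.
Local Notation C := R[i].

Lemma circle_points_neq0 (c : {poly C}) : (forall p : C, `|p| = 1 -> c.[p] = 0) -> c = 0.
Proof.
move=> h; apply/polyP => j; rewrite coef0.
have [w wM] := prim_root_ex R (ltn0Sn (size c + j)).
rewrite -(avg_coef (ltn0Sn (size c + j)) wM) ?ltnS ?leq_addl //; last first.
  by rewrite leqW // leq_addr.
rewrite -[RHS](avg_const w (ltn0Sn (size c + j))).
by apply: (eq_avg _ wM) => // a a1 _; rewrite h // mulr0.
Qed.

(** The factor k lets finitely many points of the circle be left out. *)
Lemma circle_fibre_eq0 (g : {poly {poly C}}) (k : {poly C}) : k != 0 ->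
  (forall p : C, `|p| = 1 -> k.[p] != 0 -> fibre p g = 0) -> g = 0.
Proof.
move=> k0 h; apply/polyP => i; rewrite coef0; apply: (mulfI k0); rewrite mulr0.
apply: circle_points_neq0 => p p1; rewrite hornerM.
have [->|kp] := eqVneq k.[p] 0; first by rewrite mul0r.
by rewrite -coef_fibre h // coef0 mulr0.
Qed.

End CirclePoints.

Section MonicFibres.
Variable R : realType.
Local Notation C := R[i].
Variable g : {poly {poly C}}.
Hypothesis gm : g \is monic.

Lemma monic_size_fibre p : size (fibre p g) = size g.
Proof. by rewrite size_fibre // (monicP gm) hornerC oner_eq0. Qed.

Lemma monic_fibre_prod p : fibre p g = \prod_(b <- fibre_roots g p) ('X - b%:P).
Proof.
rewrite {1}(fibre_rootsE g p) lead_coef_fibre (monicP gm) hornerC ?oner_eq0 //.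
by rewrite scale1r.
Qed.

Lemma size_monic_fibre_roots p : size (fibre_roots g p) = (size g).-1.
Proof. by rewrite -(monic_size_fibre p) monic_fibre_prod size_prod_XsubC. Qed.

Lemma mem_fibre_roots p b : (b \in fibre_roots g p) = (g.[b%:P].[p] == 0).
Proof.
by rewrite -fibreE monic_fibre_prod -[_ == 0]/(root _ b) root_prod_XsubC.
Qed.

(** Newton's identities in the other direction: the coefficients of g determine the power sums, over
    every p. *)
Lemma power_sum_poly k : exists N : {poly C}, forall p,
  power_sum (fibre_roots g p) k = N.[p].
Proof.
have cE p n : (rev_roots_poly (fibre_roots g p))`_n =
    (if (n < size g)%N then g`_((size g).-1 - n) else 0).[p].
  have sg : (0 < size g)%N by rewrite size_poly_gt0 monic_neq0.
  have [ng|ng] := ltnP n (size g); last first.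
    rewrite horner0 nth_default //; apply: leq_trans (size_rev_roots _) _.
    by rewrite size_monic_fibre_roots prednK.
  rewrite -coef_fibre monic_fibre_prod prod_roots_rev size_monic_fibre_roots.
  rewrite coef_sum prednK // (bigD1 (Ordinal ng)) //= coefZ coefXn eqxx mulr1.
  rewrite big1 ?addr0 // => i /negP ni; rewrite coefZ coefXn.
  case: eqP => [e|]; last by rewrite mulr0.
  case: ni; apply/eqP/val_inj => /=.
  have hi : (i <= (size g).-1)%N by rewrite -ltnS prednK.
  have hn : (n <= (size g).-1)%N by rewrite -ltnS prednK.
  by rewrite -(subKn hi) -e subKn.
case: k => [|k].
  exists (size g).-1%:R%:P => p; rewrite hornerC -(size_monic_fibre_roots p).
  by rewrite /power_sum big_const_seq count_predT iter_addr_0.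
have [m] := ubnP k; elim: m => // m IH in k *; rewrite ltnS => km.
have hex (i : 'I_k) : exists N : {poly C}, forall p,
    power_sum (fibre_roots g p) i.+1 = N.[p].
  by apply: IH; apply: leq_trans km.
have [N hN] := choice hex.
pose c n : {poly C} := if (n < size g)%N then g`_((size g).-1 - n) else 0.
exists (- (k.+1%:R *: c k.+1 + \sum_(i < k) N i * c (k - i)%N)) => p.
have := newton (fibre_roots g p) k.+1; rewrite big_ord_recr /= subnn coef0_rev_roots mulr1.
rewrite addrA addrC => /eqP; rewrite addr_eq0 => /eqP ->.
rewrite hornerN hornerD hornerZ horner_sum cE; congr (- (_ + _)).
by apply: eq_bigr => i _; rewrite hornerM -hN subSS cE.
Qed.

End MonicFibres.

(** * Minimal degree and the discriminant *)

Section Discriminant.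
Variable R : realType.
Local Notation C := R[i].
Variable g : {poly {poly C}}.
Hypothesis gm : g \is monic.
Hypothesis g_circle : forall s p : C, `|p| = 1 -> g.[s%:P].[p] = 0 -> s = p * s^*.

Lemma conj_circle (p : C) : `|p| = 1 -> p^* = p^-1.
Proof.
move=> p1; have p0 : p != 0 by rewrite -normr_eq0 p1 oner_eq0.
by apply: (mulfI p0); rewrite -normCK p1 expr1n divff.
Qed.

Lemma conj_fibre_root (s p : C) : `|p| = 1 -> g.[s%:P].[p] = 0 -> s^* = p^-1 * s.
Proof.
move=> p1 h; have p0 : p != 0 by rewrite -normr_eq0 p1 oner_eq0.
by rewrite {2}(g_circle p1 h) mulKf.
Qed.

Lemma prod_roots_dvdp_exp (rs : seq C) (c : {poly C}) :
  (forall r, r \in rs -> root c r) -> \prod_(r <- rs) ('X - r%:P) %| c ^+ size rs.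
Proof.
elim: rs => [|r rs IH] h; first by rewrite big_nil dvd1p.
rewrite big_cons exprS; apply: dvdp_mul.
  by rewrite dvdp_XsubCl h // mem_head.
by apply: IH => x xr; apply: h; rewrite in_cons xr orbT.
Qed.

(* A polynomial of lower degree vanishing on Z(g) over the circle would cut out
   a monic factor of g with the same zero set. *)
Lemma minimal_circle_vanishing (e : {poly {poly C}}) :
  (forall c : {poly {poly C}}, c \is monic -> zero_set c = zero_set g ->
    (size g <= size c)%N) ->
  (size e < size g)%N ->
  (forall s p : C, `|p| = 1 -> g.[s%:P].[p] = 0 -> e.[s%:P].[p] = 0) -> e = 0.
Proof.
move=> gmin es ev; apply/eqP; apply: contraT => e0.
have g0 : g != 0 by rewrite monic_neq0.
have [c [q' [a [b [l [cm cg sc l0 bez]]]]]] := monic_common_factor gm e0 es.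
(* Where l(p) is nonzero, c vanishes at every root of g(., p) with |p| = 1, so a power of c absorbs
   the multiplicities. Then g and its smaller monic factor c have the same zeros, against
   minimality. *)
suff [q qE] : divides g (c ^+ (size g).-1).
  move: sc; rewrite ltnNge gmin //; apply/seteqP; split=> -[s p].
    by rewrite /zero_set /= cg hornerM hornerM => ->; rewrite mulr0.
  rewrite /zero_set /= => h; have := congr1 (fun u => u.[s%:P].[p]) qE.
  rewrite !hornerM !horner_exp h mulr0 => /eqP; rewrite expf_eq0 => /andP[_].
  by move/eqP.
apply: (monic_divides (A := fun p => `|p| = 1 /\ l.[p] != 0) gm).
  by move=> r hr; apply: (circle_fibre_eq0 l0) => p p1 lp; apply: hr.
move=> p [p1 lp]; rewrite rmorphXn /=.
rewrite -(size_monic_fibre_roots gm p) {1}(monic_fibre_prod gm p).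
apply: prod_roots_dvdp_exp => z; rewrite (mem_fibre_roots gm) => /eqP gz.
have := congr1 (fun u => (fibre p u).[z]) bez.
rewrite rmorphD !rmorphM /= fibreC hornerD !hornerM hornerC !fibreE gz (ev _ _ p1 gz).
rewrite !mulr0 addr0 => /esym/eqP; rewrite mulf_eq0 (negPf lp) /= rootE fibreE //.
Qed.

(* The Hankel determinant of the power sums is the discriminant of g. *)
Lemma hankel_det_neq0 (N : nat -> {poly C}) :
  (forall c : {poly {poly C}}, c \is monic -> zero_set c = zero_set g ->
    (size g <= size c)%N) ->
  (forall k p, power_sum (fibre_roots g p) k = (N k).[p]) ->
  \det (\matrix_(i < (size g).-1, j < (size g).-1) N (i + j)%N) != 0.
Proof.
move=> gmin hN; apply/negP => /det0P[v v0 vM].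
pose e : {poly {poly C}} := \sum_(i < (size g).-1) v 0 i *: 'X^i.
have e0 : e = 0.
  apply: minimal_circle_vanishing => //.
    have sg : (0 < size g)%N by rewrite size_poly_gt0 monic_neq0.
    rewrite -[X in (_ < X)%N](prednK sg) ltnS.
    apply: (leq_trans (size_sum _ _ _)); apply/bigmax_leqP => i _.
    by rewrite (leq_trans (size_scale_leq _ _)) // size_polyXn.
  move=> s p p1 gs.
  have evE r : e.[r%:P].[p] = \sum_(i < (size g).-1) (v 0 i).[p] * r ^+ i.
    rewrite /e !horner_sum; apply: eq_bigr => i _.
    by rewrite hornerZ hornerXn hornerM -polyC_exp hornerC.
  have ecE r : r \in fibre_roots g p -> (e.[r%:P].[p])^* =
      \sum_(j < (size g).-1) ((v 0 j).[p])^* * p^-1 ^+ j * r ^+ j.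
    rewrite (mem_fibre_roots gm) => /eqP gr; rewrite evE rmorph_sum; apply: eq_bigr => j _.
    by rewrite rmorphM rmorphXn /= (conj_fibre_root p1 gr) exprMn mulrA.
  (* The kernel vector says that the sums of e(r) r^j over the roots vanish for j < d. On the circle
     conj(r) = r / p, so conj(e(r)) is a combination of these r^j, and the sum of |e(r)|^2
     vanishes. *)
  have sum0 : \sum_(r <- fibre_roots g p) e.[r%:P].[p] * (e.[r%:P].[p])^* = 0.
    transitivity (\sum_(r <- fibre_roots g p) \sum_(j < (size g).-1)
        ((v 0 j).[p])^* * p^-1 ^+ j * (e.[r%:P].[p] * r ^+ j)).
      apply: eq_big_seq => r hr; rewrite ecE // mulr_sumr; apply: eq_bigr => j _; ring.
    rewrite exchange_big big1 //= => j _; rewrite -mulr_sumr.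
    suff -> : \sum_(r <- fibre_roots g p) e.[r%:P].[p] * r ^+ j = 0 by rewrite mulr0.
    have := congr1 (fun m : 'rV[{poly C}]_(size g).-1 => (m 0 j).[p]) vM.
    rewrite !mxE horner0 horner_sum => h; rewrite -[RHS]h.
    under eq_bigr do rewrite evE mulr_suml.
    rewrite exchange_big; apply: eq_bigr => i _; rewrite mxE hornerM -hN mulr_sumr.
    by apply: eq_bigr => r _; rewrite exprD mulrA.
  have : s \in fibre_roots g p by rewrite (mem_fibre_roots gm) gs.
  move/eqP: sum0; rewrite psumr_eq0; last by move=> r _; rewrite -normCK exprn_ge0.
  move=> /allP h /h /=; rewrite -normCK expf_eq0 /= normr_eq0 => /eqP //.
apply/negP: v0; rewrite negbK; apply/eqP/rowP => i; rewrite mxE.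
have := congr1 (fun q : {poly {poly C}} => q`_i) e0; rewrite coef0 /e coef_sum => <-.
rewrite (bigD1 i) //= coefZ coefXn eqxx mulr1 big1 ?addr0 // => j ji.
by rewrite coefZ coefXn eq_sym (inj_eq val_inj) (negPf ji) mulr0.
Qed.

End Discriminant.

(** * The monic equation of minimal degree of a distinguished variety *)

Section NormalForm.
Variable R : realType.
Local Notation C := R[i].
Implicit Types (W : set (C * C)).

(** The point has z1 = a^-1 on the circle and z2 = p a strictly inside, so it is a boundary point
    outside bG. *)
Lemma distinguished_boundary (f : {poly {poly C}}) :
  zero_set f `&` boundary G = zero_set f `&` bG ->
  forall a p : C, `|a| = 1 -> `|p| < 1 -> f.[(a^-1 + p * a)%:P].[p] != 0.
Proof.
move=> fE a p a1 p1; apply/eqP => f0.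
have a0 : a != 0 by rewrite -normr_eq0 a1 oner_eq0.
have pE : p = a^-1 * (p * a) by rewrite mulrCA mulVf // mulr1.
have : (zero_set f `&` boundary G) (a^-1 + p * a, p).
  split; first exact: f0.
  apply/boundary_GP; exists a^-1, (p * a); split.
  - by rewrite normfV a1 invr1.
  - by rewrite normrM a1 mulr1 ltW.
  - by rewrite /symm /= -pE.
rewrite fE => -[_ /(bGP erefl pE)[_]]; rewrite normrM a1 mulr1 => h.
by rewrite h ltxx in p1.
Qed.

Lemma small_factor (rs : seq C) (s e : C) : 0 < e -> (0 < size rs)%N ->
  `|\prod_(b <- rs) (s - b)| < e ^+ size rs -> exists2 b, b \in rs & `|s - b| < e.
Proof.
move=> e0 rs0 h; apply: contrapT => nh; move: h; apply/negP.
rewrite -real_leNgt ?normr_real ?realX ?gtr0_real //.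
have {nh} : forall b, b \in rs -> e <= `|s - b|.
  move=> b hb; rewrite real_leNgt ?normr_real ?gtr0_real //; apply/negP => h.
  by apply: nh; exists b.
elim: rs {rs0} => [|b rs IH] h; first by rewrite big_nil normr1.
rewrite big_cons normrM exprS; apply: ler_pM; rewrite ?exprn_ge0 ?(ltW e0) //.
  by apply: h; rewrite mem_head.
by apply: IH => c hc; apply: h; rewrite in_cons hc orbT.
Qed.

(** Move p radially into the disk. As g is monic, |g(s, p')| is the product of the distances from s
    to the roots over p', so some root comes close to s. Hence (s, p) is in the closure of G, and
    |p| = 1 puts z1 and z2 on the circle. *)
Lemma circle_roots_bG (g : {poly {poly C}}) : g \is monic -> (1 < size g)%N ->
  (forall s p : C, `|p| < 1 -> g.[s%:P].[p] = 0 -> G (s, p)) ->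
  forall s p : C, `|p| = 1 -> g.[s%:P].[p] = 0 -> bG (s, p).
Proof.
move=> gm sg gG s p p1 gs.
have sn q : (0 < size (fibre_roots g q))%N.
  by rewrite size_monic_fibre_roots // ltn_predRL.
suff /closure_G_Gamma : forall e : C, 0 < e -> exists y : C * C,
    [/\ G y, `|(s, p).1 - y.1| < e & `|(s, p).2 - y.2| < e].
  have [z1 [z2 [h1 h2]]] := symm_roots s p.
  move=> /(GammaP h1 h2)[l1 l2]; apply/(bGP h1 h2).
  have e1 : `|z1| * `|z2| = 1 by rewrite -normrM -h2.
  have e2 : 1 <= `|z1| by rewrite -e1 ler_piMr.
  have e3 : 1 <= `|z2| by rewrite -e1 ler_piMl.
  by split; apply/eqP; rewrite eq_le ?l1 ?l2.
move=> e e0 /=.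
pose q n := n.+1%:R / n.+2%:R * p.
have qp : tends q p by have := tendsM (@tends_ratio R) (tends_cst p); rewrite mul1r.
have := tends_bivariate g (tends_cst s) qp; rewrite gs => gq.
have x0 : 0 < e ^+ (size g).-1 / 2 by rewrite divr_gt0 ?exprn_gt0.
have e2 : 0 < e / 2 by rewrite divr_gt0.
have half (a : C) : 0 < a -> a / 2 < a by move=> a0; rewrite gtr_pMr // invf_lt1 // ltr1n.
have [N1 /(_ _ (leq_maxl N1 _)) h1] := gq _ x0; have [N2 /(_ _ (leq_maxr _ N2)) h2] := qp _ e2.
move: (h1 N2) (h2 N1) => {h1 h2}; set a := q _; rewrite subr0 => ga qa.
have qn : `|a| < 1.
  by rewrite normrM p1 mulr1 ger0_norm ?divr_ge0 // ltr_pdivrMr // mul1r ltr_nat.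
have small : `|\prod_(b <- fibre_roots g a) (s - b)| < e ^+ size (fibre_roots g a).
  have -> : \prod_(b <- fibre_roots g a) (s - b) = g.[s%:P].[a].
    rewrite -fibreE (monic_fibre_prod gm a) horner_prod.
    by apply: eq_bigr => b _; rewrite hornerXsubC.
  by rewrite size_monic_fibre_roots //; apply: le_lt_trans ga (half _ _); rewrite exprn_gt0.
have [b hb sb] := small_factor e0 (sn a) small.
exists (b, a); split=> //=; last by rewrite distrC (le_lt_trans qa) ?half.
by apply: gG => //; apply/eqP; rewrite -mem_fibre_roots.
Qed.

Lemma distinguished_normal_form W : distinguished_variety W ->
  (forall V, irreducible_component W V -> V `&` G !=set0) ->
  exists g : {poly {poly C}}, [/\ W = zero_set g, g \is monic, (1 < size g)%N,
    forall s p : C, `|p| < 1 -> g.[s%:P].[p] = 0 -> G (s, p) &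
    forall c : {poly {poly C}}, c \is monic -> zero_set c = zero_set g ->
      (size g <= size c)%N].
Proof.
move=> [f [WE [[s0 p0] [f00 G0]] bE]] cW.
have fb := distinguished_boundary bE.
have f0 : f != 0.
  have := fb 1 0; rewrite normr1 normr0 ltr01 => /(_ erefl isT).
  by apply: contraNneq => ->; rewrite !horner0.
have [g [u [fE gm gG uG]]] := inner_factor fb.
have u0 : u != 0 by apply: contraNneq f0 => h; rewrite fE h mul0r.
(* A zero of the cofactor would lie on an irreducible factor of u, hence on a component of W; this
   component meets G, where u has no zero. *)
have uZ : zero_set u = set0.
  apply/seteqP; split=> // x ux; have [u1 [i1 d1 ux1]] := zero_set_factor u0 ux.
  have d2 : divides u1 f by case: d1 => v vE; exists (v * g); rewrite fE vE; ring.
  have := irred_component f0 i1 d2; rewrite -WE => /cW[[s p] [hs hG]].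
  have := zero_set_divides d1 hs; rewrite /zero_set /= => h.
  by have := uG _ _ hG; rewrite h eqxx.
have WG : W = zero_set g by rewrite WE fE zero_setM uZ set0U.
have ex : exists n, `[< exists g', [/\ g' \is monic, zero_set g' = W & size g' = n] >].
  by exists (size g); apply/asboolP; exists g.
case: (ex_minnP ex) => n /asboolP[g' [gm' ZE sg']] nmin.
exists g'; split=> //.
- have p01 : `|p0| < 1.
    have [z1 [z2 [h1 h2]]] := symm_roots s0 p0; have [l1 l2] := (GP h1 h2).1 G0.
    by rewrite h2 normrM mulr_ilt1.
  have : zero_set g' (s0, p0) by rewrite ZE WE.
  rewrite /zero_set /= -fibreE ltnNge => h; apply/negP => sle.
  have g1 : size g' = 1%N by apply/eqP; rewrite eqn_leq sle size_poly_gt0 monic_neq0.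
  have g'1 : g' = 1.
    by have := gm'; rewrite (size1_polyC sle) monicE lead_coefC => /eqP ->.
  by move: h; rewrite g'1 rmorph1 hornerC => /eqP; rewrite oner_eq0.
- move=> s p p1 gs; apply: gG => //.
  by have : zero_set g' (s, p) by []; rewrite ZE WG.
- move=> c cm cZ; rewrite sg'; apply: nmin; apply/asboolP; exists c.
  by split; rewrite // cZ.
Qed.

End NormalForm.

(** * The wandering subspace of an isometry, without completion *)

Section WanderingSubspace.
Variables (R : realType) (d : nat).
Local Notation C := R[i].
(* B is a semidefinite form on an incomplete space: P is an isometry with image
   ker T and S = S^* P. If V were a Hilbert space, S would act on the wandering
   subspace V - P V as A + P F, where A is its compression and K F = A^* K for the
   Gram matrix K of the quotient. *)
Variables (V : lmodType C) (B : V -> V -> C) (P S : {linear V -> V}).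
Variables (T : {linear V -> 'cV[C]_d}) (A : 'M[C]_d).
Hypothesis BDl : forall u v w, B (u + v) w = B u w + B v w.
Hypothesis BZl : forall k u v, B (k *: u) v = k * B u v.
Hypothesis BC : forall u v, B v u = (B u v)^*.
Hypothesis B_ge0 : forall u, 0 <= B u u.
Hypothesis PS : forall u, P (S u) = S (P u).
Hypothesis BP : forall u v, B (P u) (P v) = B u v.
Hypothesis BS : forall u v, B (S u) v = B (P u) (S v).
Hypothesis B_S_le : forall u, B (S u) (S u) <= 4 * B u u.
Hypothesis TP : forall u, T (P u) = 0.
Hypothesis TS : forall u, T (S u) = A *m T u.
Hypothesis Tker : forall u, T u = 0 -> exists w, B (u - P w) (u - P w) = 0.
Hypothesis Tsurj : forall i, exists u, T u = delta_mx i 0.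
Variable cT : C.
Hypothesis cT_gt0 : 0 < cT.
Hypothesis T_bounded : forall u i, `|T u i 0| ^+ 2 <= cT * B u u.

Lemma BDr u v w : B u (v + w) = B u v + B u w.
Proof. by rewrite BC BDl rmorphD /= -!BC. Qed.

Lemma BZr k u v : B u (k *: v) = k^* * B u v.
Proof. by rewrite BC BZl rmorphM /= -BC. Qed.

Lemma BNl u v : B (- u) v = - B u v.
Proof. by rewrite -scaleN1r BZl mulN1r. Qed.

Lemma BBl u v w : B (u - v) w = B u w - B v w.
Proof. by rewrite BDl BNl. Qed.

Lemma B0l v : B 0 v = 0.
Proof. by rewrite -(scale0r 0) BZl mul0r. Qed.

Lemma B_suml (I : finType) (F : I -> V) v : B (\sum_i F i) v = \sum_i B (F i) v.
Proof.
elim: (index_enum I) => [|i s IH]; first by rewrite !big_nil B0l.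
by rewrite !big_cons BDl IH.
Qed.

Lemma B_expand u v t : B (u + t *: v) (u + t *: v) =
  B u u + t^* * B u v + t * (B u v)^* + t * t^* * B v v.
Proof. by rewrite BDl !BDr !BZl !BZr -(BC u v); ring. Qed.

Definition seminorm u := sqrtC (B u u).

Lemma seminorm_ge0 u : 0 <= seminorm u.
Proof. by rewrite sqrtC_ge0. Qed.

Lemma seminormE u : seminorm u ^+ 2 = B u u.
Proof. exact: sqrtCK. Qed.

Lemma cauchy_schwarz_sqr u v : `|B u v| ^+ 2 <= B u u * B v v.
Proof.
have [v0|v0] := eqVneq (B v v) 0; last first.
  have vp : 0 < B v v by rewrite lt_neqAle eq_sym v0 B_ge0.
  have := B_ge0 (u + (- (B u v / B v v)) *: v); rewrite B_expand.
  have cv : (B v v)^* = B v v by rewrite -BC.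
  have -> : (- (B u v / B v v))^* = - ((B u v)^* / B v v).
    by rewrite rmorphN rmorphM fmorphV /= cv.
  have -> : B u u + - ((B u v)^* / B v v) * B u v + - (B u v / B v v) * (B u v)^* +
    - (B u v / B v v) * - ((B u v)^* / B v v) * B v v = B u u - `|B u v| ^+ 2 / B v v.
    by rewrite normCK; field.
  by rewrite subr_ge0 ler_pdivrMr.
rewrite v0 mulr0; apply: contrapT => /negP.
rewrite -real_ltNge ?real0 ?realX ?normr_real // => b0.
(* Along a null v the quadratic term drops out; this multiple of v brings the form down to - (B u u
   + 2). *)
have := B_ge0 (u + (- ((B u u + 1) / `|B u v| ^+ 2 * B u v)) *: v); rewrite B_expand v0 mulr0 addr0.
have cr : ((B u u + 1) / `|B u v| ^+ 2)^* = (B u u + 1) / `|B u v| ^+ 2.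
  by apply: conj_Creal; rewrite rpredM ?rpredV ?rpredX ?normr_real // rpredD ?real1 ?ger0_real.
rewrite rmorphN rmorphM /= cr.
have -> : B u u + - ((B u u + 1) / `|B u v| ^+ 2 * (B u v)^*) * B u v +
    - ((B u u + 1) / `|B u v| ^+ 2 * B u v) * (B u v)^* = - (B u u + 2).
  transitivity (B u u - 2 * ((B u u + 1) / `|B u v| ^+ 2) * (B u v * (B u v)^*)).
    by ring.
  by rewrite -normCK; field; rewrite -sqrf_eq0 lt0r_neq0.
by rewrite oppr_ge0 => h; have := lt_le_trans (ltr_wpDl (B_ge0 u) (ltr0n C 2)) h; rewrite ltxx.
Qed.

Lemma cauchy_schwarz u v : `|B u v| <= seminorm u * seminorm v.
Proof.
rewrite -(ler_pXn2r (n := 2)) ?nnegrE ?mulr_ge0 ?seminorm_ge0 //.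
by rewrite exprMn !seminormE cauchy_schwarz_sqr.
Qed.

Lemma null_l u v w : B (u - v) (u - v) = 0 -> B u w = B v w.
Proof.
move=> h; apply/eqP; rewrite -subr_eq0 -BBl -normr_eq0 -sqrf_eq0 eq_le exprn_ge0 // andbT.
by rewrite (le_trans (cauchy_schwarz_sqr _ _)) // h mul0r.
Qed.

Lemma seminorm_P u : seminorm (P u) = seminorm u.
Proof. by rewrite /seminorm BP. Qed.

Lemma seminorm_S u : seminorm (S u) <= 2 * seminorm u.
Proof.
rewrite -(ler_pXn2r (n := 2)) ?nnegrE ?mulr_ge0 ?seminorm_ge0 //.
by rewrite exprMn !seminormE -natrX B_S_le.
Qed.

(* Near-minimizers of B u u subject to T u = x replace the orthogonal projection of u
   onto the wandering subspace. *)
Lemma near_minimizer x : (exists u, T u = x) -> exists D : C, forall e : C, 0 < e -> e <= 1 ->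
  exists u, [/\ T u = x, B u u <= D & forall z, `|B u (P z)| <= e * seminorm z].
Proof.
move=> [u0 u0x]; pose E : set R := [set complex.Re (B u u) | u in [set u | T u = x]].
have E0 : has_inf E.
  split; first by exists (complex.Re (B u0 u0)), u0.
  by exists 0 => _ [u _ <-]; have := B_ge0 u; rewrite lecE => /andP[].
have Bre u : B u u = ((complex.Re (B u u))%:C)%C by rewrite RRe_real // ger0_real.
pose m : C := ((inf E)%:C)%C.
have low u : T u = x -> m <= B u u.
  by move=> ux; rewrite Bre lecR; apply: ge_inf; [case: E0|exists u].
exists (m + 1) => e e0 e1.
have e2 : 0 < e ^+ 2 by rewrite exprn_gt0.
have [y y0 yE] := real_complexP (ltW e2).
have y1 : 0 < y by rewrite yE ltcR in e2.
have [_ [u ux <-] hu] := inf_adherent y1 E0.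
have {}hu : B u u <= m + e ^+ 2.
  by rewrite Bre yE /m -rmorphD lecR ltW.
exists u; split=> // [|z].
  by apply: (le_trans hu); rewrite lerD2l exprn_ile1 // ltW.
rewrite -(ler_pXn2r (n := 2)) ?nnegrE ?mulr_ge0 ?seminorm_ge0 ?(ltW e0) //.
rewrite exprMn seminormE; set b := B u (P z); set beta := B z z.
have bz : B (P z) (P z) = beta by rewrite BP.
have [z0|z0] := eqVneq beta 0.
  by have := cauchy_schwarz_sqr u (P z); rewrite bz z0 !mulr0.
have zp : 0 < beta by rewrite lt_neqAle eq_sym z0 B_ge0.
(* T kills the image of P, so u may be corrected by a multiple of P z. The best correction lowers
   the form by |b|^2 / beta, yet the result stays above the infimum m. *)
have := low (u + (- (b / beta)) *: P z); rewrite linearD linearZ /= TP scaler0 addr0.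
move=> /(_ ux); rewrite B_expand bz -/b.
have cv : beta^* = beta by rewrite -BC.
have -> : (- (b / beta))^* = - (b^* / beta) by rewrite rmorphN rmorphM fmorphV /= cv.
have -> : B u u + - (b^* / beta) * b + - (b / beta) * b^* + - (b / beta) * - (b^* / beta) * beta =
  B u u - `|b| ^+ 2 / beta by rewrite normCK; field.
rewrite lerBrDr => h; have := le_trans h hu; rewrite lerD2l.
by rewrite ler_pdivrMr.
Qed.

(** The vectors u n i approximate the basis of the wandering subspace that T sends to the standard
    basis, and K is the limit of their Gram matrices along a subsequence. *)
Lemma minimizing_sequence : exists (u : nat -> 'I_d -> V) (K : 'M[C]_d) (D : C),
  [/\ 0 < D, forall n i, T (u n i) = delta_mx i 0,
      forall n i, seminorm (u n i) <= D,
      forall n i z, `|B (u n i) (P z)| <= seminorm z / n.+1%:R &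
      forall i j, tends (fun n => B (u n j) (u n i)) (K i j)].
Proof.
have [D hD] := choice (fun i => near_minimizer (Tsurj i)).
have hex n : exists w : 'I_d -> V, forall i, [/\ T (w i) = delta_mx i 0,
    B (w i) (w i) <= D i & forall z, `|B (w i) (P z)| <= n.+1%:R^-1 * seminorm z].
  have n0 : 0 < (n.+1%:R^-1 : C) by rewrite invr_gt0.
  have n1 : (n.+1%:R^-1 : C) <= 1 by rewrite invf_le1 // ler1n.
  by have [w hw] := choice (fun i => hD i _ n0 n1); exists w.
have [u hu] := choice hex.
pose M : C := \sum_i `|D i| + 1.
have M1 : 1 <= M by rewrite lerDr sumr_ge0.
have uM n i : B (u n i) (u n i) <= M.
  have [_ h _] := hu n i; apply: (le_trans h); apply: (@le_trans _ _ `|D i|).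
    by apply: real_ler_norm; exact: ger0_real (le_trans (B_ge0 _) h).
  by rewrite /M (bigD1 i) //= -addrA lerDl addr_ge0 // sumr_ge0.
have sM n i : seminorm (u n i) <= M.
  rewrite -(ler_pXn2r (n := 2)) ?nnegrE ?seminorm_ge0 ?(le_trans ler01 M1) //.
  by rewrite seminormE (le_trans (uM n i)) // expr2 ler_peMl // (le_trans ler01).
have M0 : 0 < M by apply: lt_le_trans M1.
have bd n (ij : 'I_d * 'I_d) : `|B (u n ij.2) (u n ij.1)| <= M * M.
  by rewrite (le_trans (cauchy_schwarz _ _)) // ler_pM ?seminorm_ge0.
have [f [a [hf ha]]] := bounded_subsequence bd.
exists (fun n => u (f n)), (\matrix_(i, j) a (i, j)), M; split=> //.
- by move=> n i; case: (hu (f n) i).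
- move=> n i z; have [_ _ /(_ z) h] := hu (f n) i; apply: (le_trans h).
  by rewrite mulrC ler_wpM2l ?seminorm_ge0 // lef_pV2 ?posrE // ler_nat ltnS hf.
- by move=> i j; rewrite mxE; apply: ha (i, j).
Qed.

Section MinimizingSequence.
Variables (u : nat -> 'I_d -> V) (K : 'M[C]_d) (D : C).
Hypothesis D_gt0 : 0 < D.
Hypothesis Tu : forall n i, T (u n i) = delta_mx i 0.
Hypothesis u_le : forall n i, seminorm (u n i) <= D.
Hypothesis u_near : forall n i z, `|B (u n i) (P z)| <= seminorm z / n.+1%:R.
Hypothesis u_gram : forall i j, tends (fun n => B (u n j) (u n i)) (K i j).

(** The approximate lift of x along T to the wandering subspace. *)
Definition comb n (x : 'cV[C]_d) := \sum_j x j 0 *: u n j.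

Lemma T_comb n x : T (comb n x) = x.
Proof.
rewrite /comb linear_sum; apply/colP => i; rewrite summxE (bigD1 i) //=.
rewrite linearZ /= Tu !mxE !eqxx mulr1 big1 ?addr0 // => j ji.
by rewrite linearZ /= Tu !mxE eq_sym (negPf ji) mulr0.
Qed.

Lemma B_comb n x w : B (comb n x) w = \sum_j x j 0 * B (u n j) w.
Proof. by rewrite B_suml; apply: eq_bigr => j _; rewrite BZl. Qed.

Definition l1 (x : 'cV[C]_d) : C := \sum_i `|x i 0|.

Lemma l1_ge0 x : 0 <= l1 x.
Proof. exact: sumr_ge0. Qed.

Lemma comb_near n x z : `|B (comb n x) (P z)| <= l1 x * (seminorm z / n.+1%:R).
Proof.
rewrite B_comb (le_trans (ler_norm_sum _ _ _)) // /l1 mulr_suml ler_sum // => i _.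
by rewrite normrM ler_wpM2l.
Qed.

Lemma comb_le n x w : `|B (comb n x) w| <= l1 x * D * seminorm w.
Proof.
rewrite B_comb (le_trans (ler_norm_sum _ _ _)) // -mulrA /l1 mulr_suml ler_sum // => i _.
rewrite normrM ler_wpM2l // (le_trans (cauchy_schwarz _ _)) //.
by rewrite ler_wpM2r ?seminorm_ge0.
Qed.

Lemma seminorm_le_of_sqr v (c : C) : 0 <= c ->
  `|B v v| <= c * seminorm v -> seminorm v <= c.
Proof.
move=> c0; rewrite (ger0_norm (B_ge0 v)) -seminormE expr2.
have [->//|v0] := eqVneq (seminorm v) 0.
by rewrite ler_pM2r // lt_neqAle eq_sym v0 seminorm_ge0.
Qed.

(** A Wold decomposition into a wandering part and a vector of the image of P. It holds modulo null
    vectors, hence the products with an arbitrary v in place of an equation. *)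
Lemma decomposition n w : exists z,
  forall v, B w v = B (comb n (T w)) v + B (P z) v.
Proof.
have [|z hz] := Tker (u := w - comb n (T w)).
  by rewrite linearB /= T_comb subrr.
by exists z => v; rewrite -BDl; apply: null_l; rewrite opprD addrA.
Qed.

Lemma gram_hermitian : K ^t* = K.
Proof.
apply/matrixP => i j; rewrite !mxE; apply: (tends_uniq (tends_conj (u_gram j i))).
move=> e e0; have [N hN] := u_gram i j e0; exists N => n /hN.
by rewrite -BC.
Qed.

Lemma gram_form x : tends (fun n => B (comb n x) (comb n x)) (inner (K *m x) x).
Proof.
have -> : inner (K *m x) x = \sum_i (\sum_j K i j * x j 0) * (x i 0)^*.
  by rewrite innerE; apply: eq_bigr => i _; rewrite mxE.
have h : tends (fun n => \sum_i (\sum_j B (u n j) (u n i) * x j 0) * (x i 0)^*)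
    (\sum_i (\sum_j K i j * x j 0) * (x i 0)^*).
  apply: tends_sum => i; apply: (tendsM _ (tends_cst _)); apply: tends_sum => j.
  exact: tendsM (u_gram i j) (tends_cst _).
have E n : \sum_i (\sum_j B (u n j) (u n i) * x j 0) * (x i 0)^* = B (comb n x) (comb n x).
  transitivity (\sum_i \sum_j B (u n j) (u n i) * x j 0 * (x i 0)^*).
    by apply: eq_bigr => i _; rewrite mulr_suml.
  rewrite exchange_big B_comb /=; apply: eq_bigr => j _.
  rewrite BC B_comb rmorph_sum mulr_sumr; apply: eq_bigr => i _.
  by rewrite rmorphM /= -BC; ring.
by move=> e e0; have [N hN] := h e e0; exists N => n /hN; rewrite E.
Qed.

(** Boundedness of T keeps |x_i|^2 / cT below the form of every lift of x, hence below its limit. *)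
Lemma gram_pos x : x != 0 -> 0 < inner (K *m x) x.
Proof.
move=> x0; have kr : inner (K *m x) x \is Num.real.
  by rewrite CrealE -inner_conj inner_adj gram_hermitian.
have [i xi] : exists i, x i 0 != 0.
  apply: contrapT => /forallNP h; move/eqP: x0; apply; apply/colP => i.
  by rewrite mxE; apply/eqP; apply: contrapT => /negP; exact: h.
have : `|x i 0| ^+ 2 / cT <= inner (K *m x) x.
  apply: (tends_le _ kr _ (tends_cst _) (gram_form x)).
    by rewrite ger0_real // divr_ge0 ?exprn_ge0 // ltW.
  move=> n; rewrite ler_pdivrMr // mulrC.
  by have := T_bounded (comb n x) i; rewrite T_comb.
by apply: lt_le_trans; rewrite divr_gt0 // exprn_gt0 // normr_gt0.
Qed.

Lemma gram_unit : K \in unitmx.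
Proof.
rewrite unitmxE unitfE; apply/eqP => /mx_kernel_vec[x x0 Kx].
by have := gram_pos x0; rewrite Kx inner0l ltxx.
Qed.

Lemma T_Su n j : T (S (u n j)) = col j A.
Proof. by rewrite TS Tu colE. Qed.

Definition Asum : C := \sum_j l1 (col j A).

Lemma l1_col_le j : l1 (col j A) <= Asum.
Proof.
by rewrite /Asum (bigD1 j) //= lerDl sumr_ge0 // => i _; exact: l1_ge0.
Qed.

Lemma Asum_ge0 : 0 <= Asum.
Proof. by apply: sumr_ge0 => i _; exact: l1_ge0. Qed.

(** The constants of [shift_step]: S u has seminorm at most 2 D and its wandering part contributes
    at most Asum D; boundedness of T then bounds each of the d coordinates of T y, and these enter
    the estimate of z. *)
Definition y_bound : C := (2 + Asum) * D.
Definition Y_bound : C := sqrtC cT * y_bound.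
Definition z_bound : C := 2 + Asum + Y_bound *+ d.

Lemma y_bound_ge0 : 0 <= y_bound.
Proof. by rewrite mulr_ge0 ?addr_ge0 ?Asum_ge0 // ltW. Qed.

Lemma Y_bound_ge0 : 0 <= Y_bound.
Proof. by rewrite mulr_ge0 ?sqrtC_ge0 ?y_bound_ge0 // ltW. Qed.

Lemma z_bound_ge0 : 0 <= z_bound.
Proof. by rewrite !addr_ge0 ?Asum_ge0 ?mulrn_wge0 ?Y_bound_ge0. Qed.

(* S u_j = sum_i A_ij u_i + P y with y nearly orthogonal to the image of P, since
   <y, P v> is close to <S u_j, P P v> = <u_j, P S v>. *)
Lemma shift_step n j : exists y z,
  [/\ forall v, B (S (u n j)) v = B (comb n (col j A)) v + B (P y) v,
      forall v, B y v = B (comb n (T y)) v + B (P z) v,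
      seminorm y <= y_bound, forall i, `|T y i 0| <= Y_bound &
      seminorm z <= z_bound / n.+1%:R].
Proof.
have [y hy] := decomposition n (S (u n j)); rewrite T_Su in hy.
have [z hz] := decomposition n y.
have y1 : seminorm y <= y_bound.
  rewrite -seminorm_P; apply: seminorm_le_of_sqr; first exact: y_bound_ge0.
  have -> : B (P y) (P y) = B (S (u n j)) (P y) - B (comb n (col j A)) (P y).
    by rewrite hy addrC addKr.
  have -> : y_bound * seminorm (P y) = 2 * D * seminorm (P y) + Asum * D * seminorm (P y).
    by rewrite /y_bound; ring.
  apply: le_trans (ler_normB _ _) _; apply: lerD.
    rewrite (le_trans (cauchy_schwarz _ _)) // ler_wpM2r ?seminorm_ge0 //.
    by rewrite (le_trans (seminorm_S _)) // ler_wpM2l.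
  rewrite (le_trans (comb_le _ _ _)) // ler_wpM2r ?seminorm_ge0 //.
  by rewrite ler_wpM2r ?l1_col_le // ltW.
have Ty i : `|T y i 0| <= Y_bound.
  rewrite -(ler_pXn2r (n := 2)) ?nnegrE ?Y_bound_ge0 // exprMn sqrtCK.
  rewrite (le_trans (T_bounded _ _)) // ler_wpM2l ?(ltW cT_gt0) // -seminormE.
  by rewrite lerXn2r ?nnegrE ?seminorm_ge0 ?y_bound_ge0.
have n0 : 0 <= (n.+1%:R^-1 : C) by rewrite invr_ge0.
have near v : `|B y (P v)| <= (2 + Asum) * (seminorm v / n.+1%:R).
  have -> : B y (P v) = B (u n j) (P (S v)) - B (comb n (col j A)) (P (P v)).
    have -> : B (u n j) (P (S v)) = B (S (u n j)) (P (P v)) by rewrite BS -!PS BP.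
    by rewrite hy addrC addKr BP.
  apply: le_trans (ler_normB _ _) _; rewrite mulrDl; apply: lerD.
    rewrite (le_trans (u_near _ _ _)) // mulrA ler_wpM2r //; exact: seminorm_S.
  rewrite (le_trans (comb_near _ _ _)) // seminorm_P ler_wpM2r ?l1_col_le //.
  by rewrite mulr_ge0 ?seminorm_ge0.
exists y, z; split=> //; rewrite -seminorm_P.
apply: seminorm_le_of_sqr; first by rewrite mulr_ge0 // z_bound_ge0.
have -> : B (P z) (P z) = B y (P z) - B (comb n (T y)) (P z) by rewrite hz addrC addKr.
apply: le_trans (ler_normB _ _) _.
have -> : z_bound / n.+1%:R * seminorm (P z) =
    (2 + Asum) * (seminorm z / n.+1%:R) + Y_bound *+ d * (seminorm z / n.+1%:R).
  by rewrite seminorm_P /z_bound; ring.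
apply: lerD; first exact: near.
rewrite (le_trans (comb_near _ _ _)) // ler_wpM2r ?mulr_ge0 ?seminorm_ge0 //.
rewrite /l1 (_ : Y_bound *+ d = \sum_(i < d) Y_bound) ?ler_sum //.
by rewrite sumr_const card_ord.
Qed.

(** The adjoint of A for the inner product with Gram matrix K. *)
Definition compression := invmx K *m (A ^t* *m K).

Lemma compressionE : K *m compression = A ^t* *m K.
Proof. by rewrite mulKVmx // gram_unit. Qed.

(** The row kap is a limit of the numbers k (u n i). Applying k to S u_j = sum_i A_ij u_i + P y_j
    and to y_j = sum_i Y_ij u_i + P z_j, with z_j tending to 0, gives s0 kap = kap A + p0 kap Y. *)
Lemma eigenfunctional (k : {scalar V}) (Gam p0 s0 : C) : 0 <= Gam ->
  (forall v, `|k v| <= Gam * seminorm v) ->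
  (forall v, k (P v) = p0 * k v) -> (forall v, k (S v) = s0 * k v) ->
  `|p0| < 1 -> (exists v, k v != 0) ->
  exists2 kap : 'rV[C]_d, kap != 0 & kap *m (A + p0 *: compression) = s0 *: kap.
Proof.
move=> G0 kG kP kS p01 [v0 kv0].
have knull v w : (forall t, B v t = B w t) -> k v = k w.
  move=> h; apply/eqP; rewrite -subr_eq0 -linearB /= -normr_le0.
  rewrite (le_trans (kG _)) // /seminorm BBl h subrr sqrtC0 mulr0 //.
have kcomb n x : k (comb n x) = \sum_i x i 0 * k (u n i).
  by rewrite linear_sum; apply: eq_bigr => i _; rewrite linearZ.
have hex n : exists yz : 'I_d -> V * V, forall j, [/\
    forall v, B (S (u n j)) v = B (comb n (col j A)) v + B (P (yz j).1) v,
    forall v, B (yz j).1 v = B (comb n (T (yz j).1)) v + B (P (yz j).2) v,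
    seminorm (yz j).1 <= y_bound, forall i, `|T (yz j).1 i 0| <= Y_bound &
    seminorm (yz j).2 <= z_bound / n.+1%:R].
  have [yz h] := choice (fun j => let: ex_intro y (ex_intro z h) := shift_step n j in
    ex_intro (fun yz : V * V => [/\
    forall v, B (S (u n j)) v = B (comb n (col j A)) v + B (P yz.1) v,
    forall v, B yz.1 v = B (comb n (T yz.1)) v + B (P yz.2) v,
    seminorm yz.1 <= y_bound, forall i, `|T yz.1 i 0| <= Y_bound &
    seminorm yz.2 <= z_bound / n.+1%:R]) (y, z) h).
  by exists yz.
have [yz hyz] := choice hex.
pose y n j := (yz n j).1; pose z n j := (yz n j).2.
(* Both kinds of numbers form one family, so that a single subsequence makes them all converge. *)
pose fam n (i : 'I_d + 'I_d * 'I_d) : C :=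
  match i with inl i => k (u n i) | inr (i, j) => T (y n j) i 0 end.
have GD : 0 <= Gam * D by rewrite mulr_ge0 // ltW.
have fb n i : `|fam n i| <= Gam * D + Y_bound.
  case: i => [i|[i j]] /=.
    rewrite (le_trans (kG _)) // (@le_trans _ _ (Gam * D)) ?ler_wpM2l //.
    by rewrite lerDl Y_bound_ge0.
  have [_ _ _ h _] := hyz n j; apply: (le_trans (h i)).
  by rewrite lerDr.
have [f [a [hf ha]]] := bounded_subsequence fb.
have fn n : (n.+1%:R^-1 : C) >= (f n).+1%:R^-1.
  by rewrite lef_pV2 ?posrE // ler_nat ltnS.
pose kap : 'rV[C]_d := \row_i a (inl i).
pose Y : 'M[C]_d := \matrix_(i, j) a (inr (i, j)).
have kapE i : tends (fun n => k (u (f n) i)) (kap 0 i) by rewrite mxE; exact: (ha (inl i)).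
have YE i j : tends (fun n => T (y (f n) j) i 0) (Y i j) by rewrite mxE; exact: (ha (inr (i, j))).
clearbody kap Y.
have gramf i j := tends_sub hf (u_gram i j).
(* The limit of <y_j, u_i> is found in two ways: y_j is nearly sum_l Y_lj u_l, and <y_j, u_i> is
   close to <S u_j, P u_i> = <u_j, S u_i>, hence to sum_l conj(A_li) <u_j, u_l>. *)
have YK : Y = compression.
  apply: (can_inj (mulKmx gram_unit)); rewrite compressionE.
  apply/matrixP => i j; rewrite !mxE.
  have lim1 : tends (fun n => \sum_l B (u (f n) l) (u (f n) i) * T (y (f n) j) l 0)
      (\sum_l K i l * Y l j).
    by apply: tends_sum => l; apply: tendsM; [exact: gramf|exact: YE].
  have lim2 : tends (fun n => \sum_l (A l i)^* * B (u (f n) j) (u (f n) l))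
      (\sum_l A ^t* i l * K l j).
    apply: tends_sum => l; rewrite !mxE; apply: tendsM; first exact: tends_cst.
    exact: gramf.
  pose err := z_bound + (Asum * D + y_bound).
  have err0 : 0 <= err.
    exact: addr_ge0 z_bound_ge0 (addr_ge0 (mulr_ge0 Asum_ge0 (ltW D_gt0)) y_bound_ge0).
  apply: (tends_uniq lim1); apply: (tends_squeeze err0 _ lim2) => n0.
  apply: (@le_trans _ _ (err / (f n0).+1%:R)); last by rewrite ler_wpM2l.
  move: (f n0) => n {n0}.
  have [h1 h2 h3 h4 h5] := hyz n j; have [g1 _ g3 _ _] := hyz n i.
  rewrite -/(y n j) -/(z n j) in h1 h2 h3 h4 h5; rewrite -/(y n i) in g1 g3.
  have e1 : \sum_l B (u n l) (u n i) * T (y n j) l 0 = B (y n j) (u n i) - B (P (z n j)) (u n i).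
    by rewrite h2 addrK B_comb; apply: eq_bigr => l _; rewrite mulrC.
  have e2 : \sum_l (A l i)^* * B (u n j) (u n l) = B (u n j) (S (u n i)) - B (u n j) (P (y n i)).
    rewrite [B _ (S _)]BC g1 rmorphD /= -[(B (P _) _)^*]BC addrK B_comb rmorph_sum.
    by apply: eq_bigr => l _; rewrite rmorphM /= -BC mxE.
  have e3 : B (y n j) (u n i) = B (u n j) (S (u n i)) - B (comb n (col j A)) (P (u n i)).
    have -> : B (u n j) (S (u n i)) = B (S (u n j)) (P (u n i)) by rewrite BS -PS BP.
    by rewrite h1 addrC addKr BP.
  rewrite e1 e2 e3.
  have -> : B (u n j) (S (u n i)) - B (comb n (col j A)) (P (u n i)) - B (P (z n j)) (u n i) -
     (B (u n j) (S (u n i)) - B (u n j) (P (y n i))) =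
     - B (P (z n j)) (u n i) + (- B (comb n (col j A)) (P (u n i)) + B (u n j) (P (y n i))).
    by ring.
  have n1 : (n.+1%:R^-1 : C) <= 1 by rewrite invf_le1 // ler1n.
  rewrite /err mulrDl; apply: le_trans (ler_normD _ _) _; apply: lerD.
    rewrite normrN BC norm_conjC (le_trans (u_near _ _ _)) // ler_wpM2r ?invr_ge0 //.
    by rewrite (le_trans h5) // ler_piMr ?z_bound_ge0.
  rewrite mulrDl; apply: le_trans (ler_normD _ _) _; apply: lerD.
    rewrite normrN (le_trans (comb_near _ _ _)) // -mulrA.
    apply: ler_pM; rewrite ?l1_ge0 ?mulr_ge0 ?seminorm_ge0 ?invr_ge0 ?l1_col_le //.
    by rewrite ler_wpM2r ?invr_ge0.
  by rewrite (le_trans (u_near _ _ _)) // ler_wpM2r ?invr_ge0.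
exists kap.
  apply/eqP => kap0.
  (* If kap = 0, the decomposition of w makes k w close to p0 k t, with t no longer than w in the
     limit. So every bound for k improves by the factor |p0| < 1, and k would vanish. *)
  have shrink Gm : 0 <= Gm -> (forall v, `|k v| <= Gm * seminorm v) ->
      forall w, `|k w| <= `|p0| * Gm * seminorm w.
    move=> Gm0 kGm w; set X := l1 (T w).
    have X0 : 0 <= X := l1_ge0 _.
    have lim : tends (fun n => \sum_i T w i 0 * k (u (f n) i)) (\sum_i T w i 0 * kap 0 i).
      by apply: tends_sum => i; apply: tendsM; [exact: tends_cst|exact: kapE].
    have lim0 : \sum_i T w i 0 * kap 0 i = 0.
      by rewrite big1 // => i _; rewrite kap0 mxE mulr0.
    rewrite lim0 in lim.
    have K1 : 0 <= 1 + `|p0| * Gm * (2 * X) by rewrite !addr_ge0 ?mulr_ge0.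
    apply: (complex_le_eps K1); rewrite ?normr_real // ?ger0_real ?mulr_ge0 ?seminorm_ge0 //.
    move=> e e0.
    have [N1 hN1] := lim e e0; have [N2 hN2] := @tends_inv_nat R 1 ler01 e e0.
    have := hN1 _ (leq_maxl N1 N2); have := hN2 _ (leq_maxr N1 N2).
    rewrite !subr0 ger0_norm ?divr_ge0 // mul1r => ine.
    move: (fn (maxn N1 N2)) => /le_trans/(_ ine); move: (f _) => n {ine} ine kine.
    have [t ht] := decomposition n w.
    have kw : k w = \sum_i T w i 0 * k (u n i) + p0 * k t.
      rewrite -kcomb -kP -linearD /=; apply: knull => v.
      by rewrite ht BDl.
    have tw : seminorm t <= seminorm w + 2 * X * e.
      rewrite -seminorm_P; apply: seminorm_le_of_sqr.
        by rewrite addr_ge0 ?seminorm_ge0 ?mulr_ge0 // ltW.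
      have -> : B (P t) (P t) = B w (P t) - B (comb n (T w)) (P t) by rewrite ht addrC addKr.
      rewrite mulrDl; apply: le_trans (ler_normB _ _) _; apply: lerD.
        exact: cauchy_schwarz.
      rewrite (le_trans (comb_near _ _ _)) // -/X seminorm_P.
      rewrite [_ / _]mulrC mulrA ler_wpM2r ?seminorm_ge0 //.
      by rewrite -mulrA mulrCA ler_wpM2l // (le_trans ine) // ler_peMl ?ler1n // ltW.
    rewrite kw (le_trans (ler_normD _ _)) // normrM.
    have -> : `|p0| * Gm * seminorm w + (1 + `|p0| * Gm * (2 * X)) * e =
       e + `|p0| * (Gm * (seminorm w + 2 * X * e)) by ring.
    apply: lerD => //; rewrite ler_wpM2l // (le_trans (kGm _)) //.
    by rewrite ler_wpM2l.
  have iter m : forall v, `|k v| <= `|p0| ^+ m * Gam * seminorm v.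
    elim: m => [|m IH] v; first by rewrite expr0 mul1r.
    by rewrite exprS -[_ * _ * Gam]mulrA; apply: shrink => //; rewrite mulr_ge0 // exprn_ge0.
  have kv1 : 0 < `|k v0| by rewrite normr_gt0.
  have Gs : 0 < Gam * seminorm v0 by apply: lt_le_trans kv1 _.
  have e0 : 0 < `|k v0| / 2 / (Gam * seminorm v0) by rewrite !divr_gt0.
  have [m /(_ m (leqnn m)) hm] := expr_small (normr_ge0 p0) p01 e0.
  have := iter m v0; rewrite -mulrA => /le_trans/(_ (ler_wpM2r (ltW Gs) hm)).
  rewrite divfK ?lt0r_neq0 // ler_pdivlMr // mulr_natr mulr2n gerDl.
  by move=> /(lt_le_trans kv1); rewrite ltxx.
rewrite -YK; apply/rowP => j; rewrite mulmxDr -scalemxAr !mxE.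
have lim1 : tends (fun n => s0 * k (u (f n) j)) (s0 * kap 0 j).
  by apply: tendsM; [exact: tends_cst|exact: kapE].
have lim2 : tends (fun n => \sum_i k (u (f n) i) * A i j +
    p0 * \sum_i k (u (f n) i) * T (y (f n) j) i 0)
    (\sum_i kap 0 i * A i j + p0 * \sum_i kap 0 i * Y i j).
  apply: tendsD; first by apply: tends_sum => i; apply: tendsM; [exact: kapE|exact: tends_cst].
  apply: tendsM; first exact: tends_cst.
  by apply: tends_sum => i; apply: tendsM; [exact: kapE|exact: YE].
apply: (tends_uniq lim2); have c0 : 0 <= Gam * z_bound by rewrite mulr_ge0 ?z_bound_ge0.
apply: (tends_squeeze c0 _ lim1) => n0.
apply: (@le_trans _ _ (Gam * z_bound / (f n0).+1%:R)); last by rewrite ler_wpM2l.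
move: (f n0) => n {n0}; have [h1 h2 h3 h4 h5] := hyz n j.
rewrite -/(y n j) -/(z n j) in h1 h2 h3 h4 h5.
have e1 : s0 * k (u n j) = \sum_i k (u n i) * A i j + p0 * k (y n j).
  rewrite -kS -kP; have -> : \sum_i k (u n i) * A i j = k (comb n (col j A)).
    by rewrite kcomb; apply: eq_bigr => i _; rewrite mxE mulrC.
  by rewrite -linearD; apply: knull => v; rewrite h1 BDl.
have e2 : k (y n j) = \sum_i k (u n i) * T (y n j) i 0 + p0 * k (z n j).
  rewrite -kP; have -> : \sum_i k (u n i) * T (y n j) i 0 = k (comb n (T (y n j))).
    by rewrite kcomb; apply: eq_bigr => i _; rewrite mulrC.
  by rewrite -linearD; apply: knull => v; rewrite h2 BDl.
rewrite e1 e2.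
set S1 := \sum_i _; set S2 := \sum_i _.
have -> : S1 + p0 * S2 - (S1 + p0 * (S2 + p0 * k (z n j))) = - (p0 * p0 * k (z n j)) by ring.
rewrite normrN !normrM -mulrA (le_trans _ (_ : 1 * `|k (z n j)| <= _)) //.
  by rewrite mulrA ler_wpM2r // mulr_ile1 // ltW.
by rewrite mul1r (le_trans (kG _)) // -mulrA ler_wpM2l.
Qed.

End MinimizingSequence.

Theorem wandering_pencil : exists K F : 'M[C]_d,
  [/\ K ^t* = K, forall x, x != 0 -> 0 < inner (K *m x) x,
      K *m F = A ^t* *m K &
      forall (k : {scalar V}) (Gam p0 s0 : C), 0 <= Gam ->
        (forall v, `|k v| ^+ 2 <= Gam * B v v) ->
        (forall v, k (P v) = p0 * k v) -> (forall v, k (S v) = s0 * k v) ->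
        `|p0| < 1 -> (exists v, k v != 0) ->
        exists2 kap : 'rV[C]_d, kap != 0 & kap *m (A + p0 *: F) = s0 *: kap].
Proof.
have [u [K [D [D0 h1 h2 h3 h4]]]] := minimizing_sequence.
exists K, (compression K); split.
- exact: gram_hermitian h4.
- exact: (gram_pos h1 h4).
- exact: (compressionE h1 h4).
move=> k Gam p0 s0 G0 kG kP kS p01 kv.
apply: (eigenfunctional D0 h1 h2 h3 h4 (k := k) (Gam := sqrtC Gam)) => //.
  by rewrite sqrtC_ge0.
move=> v; rewrite -(ler_pXn2r (n := 2)) ?nnegrE ?mulr_ge0 ?sqrtC_ge0 ?seminorm_ge0 //.
by rewrite exprMn sqrtCK seminormE.
Qed.

End WanderingSubspace.

(** * Hermitian matrices and the numerical radius *)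

Section HermitianSpectral.
Variables (R : realType) (d : nat).
Local Notation C := R[i].
Implicit Types (H K F : 'M[C]_d) (h x : 'cV[C]_d).

Lemma hermitian_diagonalization H : H ^t* = H -> exists (Q : 'M[C]_d) (l : 'I_d -> C),
  [/\ Q ^t* *m Q = 1%:M, Q *m Q ^t* = 1%:M & forall h, inner (H *m h) h =
    \sum_i l i * `|(Q *m h) i 0| ^+ 2 ] /\
  (forall i, H *m (Q ^t* *m delta_mx i 0 : 'cV[C]_d) = l i *: (Q ^t* *m delta_mx i 0)).
Proof.
move=> Hh; have Hn : H \is normalmx by apply/normalmxP; rewrite Hh.
have /orthomx_spectralP HE := Hn.
set Q := spectralmx H in HE; set sp := spectral_diag H in HE.
have Qu : Q \is unitarymx := spectral_unitarymx H.
have QQ : Q *m Q ^t* = 1%:M by apply/unitarymxP.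
have QQ' : Q ^t* *m Q = 1%:M by rewrite -(invmx_unitary Qu) mulVmx // unitarymx_unit.
rewrite (invmx_unitary Qu) in HE.
exists Q, (fun i => sp 0 i); split; first split=> //.
  move=> h; rewrite HE -!mulmxA inner_adj trmxCK innerE; apply: eq_bigr => i _.
  rewrite normCK mulrA; congr (_ * _).
  by rewrite mul_diag_mx mxE.
move=> i; rewrite HE -!mulmxA [Q *m (_ *m _)]mulmxA QQ mul1mx scalemxAr; congr (_ *m _).
apply/colP => j; rewrite mul_diag_mx !mxE.
by case: eqP => [->|]; rewrite ?mulr0.
Qed.

Lemma unitary_inner (Q : 'M[C]_d) h : Q ^t* *m Q = 1%:M ->
  \sum_i `|(Q *m h) i 0| ^+ 2 = inner h h.
Proof.
move=> QQ; have -> : inner h h = inner (Q *m h) (Q *m h) by rewrite inner_adj mulmxA QQ mul1mx.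
by rewrite innerE; apply: eq_bigr => i _; rewrite normCK.
Qed.

Lemma hermitian_form_le H (c : C) h : H ^t* = H ->
  (forall l : C, \det (H - l%:M) = 0 -> `|l| <= c) -> `|inner (H *m h) h| <= c * inner h h.
Proof.
move=> /hermitian_diagonalization[Q [l [[QQ QQ' HE] He]]] hc.
rewrite HE -(unitary_inner h QQ) mulr_sumr (le_trans (ler_norm_sum _ _ _)) //.
apply: ler_sum => i _; rewrite normrM [X in _ * X]ger0_norm ?exprn_ge0 //.
rewrite ler_wpM2r ?exprn_ge0 //; apply: hc; apply: (mx_kernel_det (h := (Q ^t* *m delta_mx i 0 : 'cV[C]_d))).
  apply/eqP => /(congr1 (mulmx Q)); rewrite mulmxA QQ' mul1mx mulmx0 => /colP/(_ i).
  by rewrite !mxE !eqxx => /eqP; rewrite oner_eq0.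
by rewrite mulmxBl He mul_scalar_mx subrr.
Qed.

Lemma numerical_contraction_pencil F :
  (forall s p : C, `|p| = 1 -> W_of F (s, p) -> `|s| <= 2) -> numerical_contraction F.
Proof.
move=> hF; apply/numerical_contractionP => h; set b := inner (F *m h) h.
have [b0|b0] := eqVneq b 0; first by rewrite b0 normr0 inner_ge0.
have nb : 0 < `|b| by rewrite normr_gt0.
(* This phase turns <F h, h> into its modulus. The Hermitian H = conj(q) (F^* + q^2 F) has <H h, h>
   = 2 |b|, and its eigenvalues are conj(q) times those of the pencil at p = q^2. *)
pose q := b^* / `|b|.
have q1 : `|q| = 1 by rewrite normrM normfV norm_conjC normr_id divff // lt0r_neq0.
have qq : q * q^* = 1 by rewrite -normCK q1 expr1n.
have qb : q * b = `|b|.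
  by rewrite mulrAC [b^* * b]mulrC -normCK expr2 mulfK // lt0r_neq0.
pose H := q^* *: F ^t* + q *: F.
have Hh : H ^t* = H.
  rewrite /H linearD !linearZ /= map_mxD !map_mxZ /= conjCK addrC; congr (_ + _).
  by rewrite -[F^T ^ _]/(F ^t*) -[X in _ *: X]/((F ^t*) ^t*) trmxCK.
have HE : H = q^* *: (F ^t* + q ^+ 2 *: F).
  by rewrite scalerDr scalerA expr2 mulrA [q^* * q]mulrC qq mul1r.
have q0 : q^* != 0 by rewrite conjC_eq0 -normr_eq0 q1 oner_eq0.
have : `|inner (H *m h) h| <= 2 * inner h h.
  apply: hermitian_form_le => // l Hl.
  have -> : `|l| = `|q * l| by rewrite normrM q1 mul1r.
  apply: (hF _ (q ^+ 2)); first by rewrite normrX q1 expr1n.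
  rewrite /W_of /=; apply/eqP.
  have : \det (H - l%:M) = q^* ^+ d * \det (F ^t* + q ^+ 2 *: F - (q * l)%:M).
    rewrite -detZ scalerBr -HE scale_scalar_mx mulrA [q^* * q]mulrC qq mul1r //.
  by rewrite Hl => /esym/eqP; rewrite mulf_eq0 expf_eq0 (negPf q0) andbF.
have -> : inner (H *m h) h = `|b| *+ 2.
  rewrite mulmxDl -!scalemxAl innerDl !innerZl -/b qb inner_adj trmxCK inner_conj -/b.
  by rewrite -rmorphM qb /= conj_Creal ?normr_real // mulr2n.
by rewrite ger0_norm ?mulrn_wge0 // -[`|b| *+ 2]mulr_natl ler_pM2l.
Qed.

Lemma positive_definite_factor K : K ^t* = K ->
  (forall x, x != 0 -> 0 < inner (K *m x) x) ->
  exists2 Y : 'M[C]_d, Y \in unitmx & K = Y ^t* *m Y.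
Proof.
move=> Kh Kp; have [Q [l [[QQ QQ' KE] Ke]]] := hermitian_diagonalization Kh.
pose e i : 'cV[C]_d := Q ^t* *m delta_mx i 0.
have e0 i : e i != 0.
  apply/eqP => /(congr1 (mulmx Q)); rewrite mulmxA QQ' mul1mx mulmx0 => /colP/(_ i).
  by rewrite !mxE !eqxx => /eqP; rewrite oner_eq0.
have l0 i : 0 < l i.
  have := Kp _ (e0 i); rewrite Ke innerZl => h.
  by rewrite -(pmulr_lgt0 _ (_ : 0 < inner (e i) (e i))) ?inner_gt0.
pose Dm := diag_mx (\row_i sqrtC (l i)).
have DD : Dm ^t* *m Dm = diag_mx (\row_i l i).
  rewrite /Dm tr_diag_mx map_diag_mx mulmx_diag; congr diag_mx; apply/rowP => i.
  rewrite !mxE -[X in X * _]/((sqrtC (l i))^* ) conj_Creal ?ger0_real ?sqrtC_ge0 ?(ltW (l0 i)) //.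
  by rewrite -expr2 sqrtCK.
have Du : Dm \in unitmx.
  rewrite unitmxE unitfE det_diag; apply/prodf_neq0 => i _; rewrite mxE.
  by rewrite sqrtC_eq0 lt0r_neq0.
exists (Dm *m Q).
  by rewrite unitmx_mul Du /= unitmxE; case: (mulmx1_unit QQ') => + _; rewrite unitmxE.
rewrite trmx_mul map_mxM /= -mulmxA [Dm ^t* *m _]mulmxA DD.
have KQ : K *m Q ^t* = Q ^t* *m diag_mx (\row_i l i).
  apply/matrixP => a i.
  have colM (M : 'M[C]_d) : (M *m delta_mx i (0 : 'I_1)) a 0 = M a i by rewrite -colE mxE.
  by rewrite -colM -mulmxA Ke mxE colM mul_mx_diag [RHS]mxE mulrC; congr (_ * _); rewrite mxE.
by rewrite mulmxA -KQ -mulmxA QQ mulmx1.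
Qed.

End HermitianSpectral.

(** * The normalized integral of trigonometric polynomials over the circle *)

Section CircleMean.
Variable R : realType.
Local Notation C := R[i].
Implicit Types (phi psi : C -> C).

Definition trigonometric phi := exists (n : nat) (q : {poly C}),
  forall a : C, `|a| = 1 -> phi a = a^-1 ^+ n * q.[a].

Lemma eq_trigonometric phi psi : (forall a : C, `|a| = 1 -> psi a = phi a) ->
  trigonometric phi -> trigonometric psi.
Proof. by move=> h [n [q hq]]; exists n, q => a a1; rewrite h // hq. Qed.

Lemma trigonometric_poly (q : {poly C}) : trigonometric (fun a => q.[a]).
Proof. by exists 0%N, q => a _; rewrite mul1r. Qed.

Lemma trigonometric_cst (c : C) : trigonometric (fun=> c).
Proof. by exists 0%N, c%:P => a _; rewrite hornerC mul1r. Qed.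

Lemma trigonometric_expV n : trigonometric (fun a => a^-1 ^+ n).
Proof. by exists n, 1 => a _; rewrite hornerC mulr1. Qed.

Lemma trigonometricM phi psi : trigonometric phi -> trigonometric psi ->
  trigonometric (fun a => phi a * psi a).
Proof.
move=> [n [q hq]] [m [s hs]]; exists (n + m)%N, (q * s) => a a1.
by rewrite hq // hs // hornerM exprD mulrACA.
Qed.

Lemma trigonometricD phi psi : trigonometric phi -> trigonometric psi ->
  trigonometric (fun a => phi a + psi a).
Proof.
move=> [n [q hq]] [m [s hs]]; exists (n + m)%N, ('X^m * q + 'X^n * s) => a a1.
have a0 : a != 0 by rewrite -normr_eq0 a1 oner_eq0.
rewrite hq // hs // hornerD !hornerM !hornerXn exprD mulrDr !exprVn.
by field; rewrite !expf_neq0.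
Qed.

Lemma trigonometric_sum (I : Type) (r : seq I) (phi : I -> C -> C) :
  (forall i, trigonometric (phi i)) -> trigonometric (fun a => \sum_(i <- r) phi i a).
Proof.
move=> h; elim: r => [|i r IH].
  by apply: eq_trigonometric (trigonometric_cst 0) => a _; rewrite big_nil.
by apply: eq_trigonometric (trigonometricD (h i) IH) => a _; rewrite big_cons.
Qed.

Lemma trigonometric_conj_poly (q : {poly C}) : trigonometric (fun a => (q.[a])^*).
Proof.
elim/poly_ind: q => [|q c IH].
  by apply: eq_trigonometric (trigonometric_cst 0) => a _; rewrite horner0 conjC0.
have h := trigonometricD (trigonometricM IH (trigonometric_expV 1)) (trigonometric_cst c^*).
by apply: eq_trigonometric h => a a1; rewrite hornerMXaddC rmorphD rmorphM /= (conj_circle a1) expr1.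
Qed.

(** For a trigonometric polynomial the average over M-th roots of unity no longer depends on M once
    M is large; the eventual value is the integral. *)
Definition is_mean phi c := exists N, forall M (w : C), (N <= M)%N ->
  M.-primitive_root w -> avg M w phi = c.

(** The default 0 is taken where the averages do not become constant. *)
Definition mean phi : C := xget 0 (is_mean phi).

Lemma is_mean_uniq phi c c' : is_mean phi c -> is_mean phi c' -> c = c'.
Proof.
move=> [N h] [N' h']; have [w wM] := prim_root_ex R (ltn0Sn (maxn N N')).
by rewrite -(h _ w (leqW (leq_maxl _ _)) wM) -(h' _ w (leqW (leq_maxr _ _)) wM).
Qed.

Lemma is_mean_coef phi n (q : {poly C}) :
  (forall a : C, `|a| = 1 -> phi a = a^-1 ^+ n * q.[a]) -> is_mean phi q`_n.
Proof.
move=> h; exists (maxn n.+1 (size q)) => M w; rewrite geq_max => /andP[nM qM] wM.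
rewrite -(avg_coef _ wM) ?(prim_order_gt0 wM) //.
by apply: (eq_avg (prim_order_gt0 wM) wM) => a a1 _; rewrite h.
Qed.

Lemma mean_is_mean phi : trigonometric phi -> is_mean phi (mean phi).
Proof.
by move=> [n [q /is_mean_coef h]]; apply: (xgetPex 0); exists q`_n.
Qed.

Lemma meanE phi c : is_mean phi c -> mean phi = c.
Proof. by move=> h; apply: (is_mean_uniq _ h); apply: (xgetPex 0); exists c. Qed.

Lemma mean_coef phi n (q : {poly C}) :
  (forall a : C, `|a| = 1 -> phi a = a^-1 ^+ n * q.[a]) -> mean phi = q`_n.
Proof. by move/is_mean_coef/meanE. Qed.

(** One M that serves two functions reduces inequalities between means to inequalities between
    finite sums. *)
Lemma mean_avg2 phi psi : trigonometric phi -> trigonometric psi ->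
  exists M (w : C), [/\ (0 < M)%N, M.-primitive_root w,
    avg M w phi = mean phi & avg M w psi = mean psi].
Proof.
move=> /mean_is_mean[N h] /mean_is_mean[N' h'].
have [w wM] := prim_root_ex R (ltn0Sn (maxn N N')).
exists (maxn N N').+1, w; split=> //.
  exact: h (leqW (leq_maxl _ _)) wM.
exact: h' (leqW (leq_maxr _ _)) wM.
Qed.

Lemma eq_mean phi psi : trigonometric phi ->
  (forall a : C, `|a| = 1 -> psi a = phi a) -> mean psi = mean phi.
Proof.
move=> /mean_is_mean[N h] e; apply: meanE; exists N => M w NM wM.
rewrite -(h M w NM wM); apply: (eq_avg (prim_order_gt0 wM) wM) => a a1 _; exact: e.
Qed.

Lemma meanD phi psi : trigonometric phi -> trigonometric psi ->
  mean (fun a => phi a + psi a) = mean phi + mean psi.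
Proof.
move=> /mean_is_mean[N h] /mean_is_mean[N' h']; apply: meanE.
exists (maxn N N') => M w; rewrite geq_max => /andP[NM NM'] wM.
by rewrite avgD h ?h'.
Qed.

Lemma meanZ k phi : trigonometric phi -> mean (fun a => k * phi a) = k * mean phi.
Proof.
move=> /mean_is_mean[N h]; apply: meanE; exists N => M w NM wM.
by rewrite avgZ h.
Qed.

Lemma mean_conj phi : trigonometric phi -> mean (fun a => (phi a)^*) = (mean phi)^*.
Proof.
move=> /mean_is_mean[N h]; apply: meanE; exists N => M w NM wM.
by rewrite avg_conj h.
Qed.

Lemma ler_mean phi psi : trigonometric phi -> trigonometric psi ->
  (forall a : C, `|a| = 1 -> phi a <= psi a) -> mean phi <= mean psi.
Proof.
move=> tp ts h; have [M [w [M0 wM <- <-]]] := mean_avg2 tp ts.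
exact: (ler_avg M0 wM h).
Qed.

Lemma mean_ge0 phi : trigonometric phi ->
  (forall a : C, `|a| = 1 -> 0 <= phi a) -> 0 <= mean phi.
Proof.
move=> tp h; have [M [w [M0 wM _ <-]]] := mean_avg2 (trigonometric_cst 0) tp.
exact: (avg_ge0 M0 wM h).
Qed.

Lemma sqr_sum_le (I : Type) (r : seq I) (x : I -> C) :
  `|\sum_(i <- r) x i| ^+ 2 <= (size r)%:R * \sum_(i <- r) `|x i| ^+ 2.
Proof.
apply: (@le_trans _ _ ((\sum_(i <- r) `|x i|) ^+ 2)).
  by rewrite lerXn2r ?nnegrE ?sumr_ge0 ?ler_norm_sum.
elim: r => [|i r IH]; first by rewrite !big_nil expr0n mul0r.
rewrite !big_cons /=; set y := `|x i|; set s := \sum_(j <- r) _; set t := \sum_(j <- r) _.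
rewrite -/s -/t in IH.
have y0 : 0 <= y := normr_ge0 _; have s0 : 0 <= s by exact: sumr_ge0.
have t0 : 0 <= t by apply: sumr_ge0 => j _; rewrite exprn_ge0.
have [rs0|rs0] := posnP (size r).
  rewrite rs0 mul0r in IH *; have : s ^+ 2 == 0 by rewrite eq_le IH exprn_ge0.
  by rewrite expf_eq0 /= => /eqP ->; rewrite addr0 mul1r lerDl.
set n : C := (size r)%:R in IH *; have n0 : 0 < n by rewrite ltr0n.
rewrite -natr1 -/n -subr_ge0 -(pmulr_rge0 _ n0).
(* Completing the square; the induction hypothesis makes the second summand nonnegative. *)
have -> : n * ((n + 1) * (y ^+ 2 + t) - (y + s) ^+ 2) =
  (n * y - s) ^+ 2 + (n + 1) * (n * t - s ^+ 2) by ring.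
have r1 : n * y - s \is Num.real by rewrite realB ?ger0_real ?mulr_ge0 // ltW.
rewrite addr_ge0 ?real_exprn_even_ge0 // mulr_ge0 ?subr_ge0 // addr_ge0 // ltW.
Qed.

Lemma avg_sqr_le M (w : C) phi : (0 < M)%N ->
  `|avg M w phi| ^+ 2 <= avg M w (fun a => `|phi a| ^+ 2).
Proof.
move=> M0; have Mp : (0 : C) < M%:R by rewrite ltr0n.
rewrite /avg normrM exprMn normfV normr_nat exprVn ler_pdivrMl ?exprn_gt0 //.
rewrite [M%:R ^+ 2]expr2 -[leRHS]mulrA mulVKf ?lt0r_neq0 //.
apply: le_trans (sqr_sum_le _ _) _.
by rewrite /index_enum -enumT size_enum_ord.
Qed.

Lemma mean_sqr_le phi psi : trigonometric phi -> trigonometric psi ->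
  (forall a : C, `|a| = 1 -> `|phi a| ^+ 2 <= psi a) ->
  `|mean phi| ^+ 2 <= mean psi.
Proof.
move=> tp ts h; have [M [w [M0 wM <- <-]]] := mean_avg2 tp ts.
by apply: le_trans (avg_sqr_le w phi M0) _; exact: (ler_avg M0 wM h).
Qed.

End CircleMean.

(** * Polynomials in two variables as a complex vector space *)

Section Bipoly.
Variable R : realType.
Local Notation C := R[i].

(** A separate name for the type, whose scalars are to be complex numbers: under its own name it is
    already a module over {poly C}. *)
Definition bipoly : Type := {poly {poly C}}.

HB.instance Definition _ := GRing.Zmodule.copy bipoly {poly {poly C}}.

Definition bipoly_scale (k : C) (u : bipoly) : bipoly := k%:P *: (u : {poly {poly C}}).

Fact bipoly_scaleA k l u : bipoly_scale k (bipoly_scale l u) = bipoly_scale (k * l) u.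
Proof. by rewrite /bipoly_scale scalerA -polyCM. Qed.

Fact bipoly_scale1 : left_id 1 bipoly_scale.
Proof. by move=> u; rewrite /bipoly_scale scale1r. Qed.

Fact bipoly_scaleDr : right_distributive bipoly_scale +%R.
Proof. by move=> k u v; rewrite /bipoly_scale -scalerDr. Qed.

Fact bipoly_scaleDl u : {morph bipoly_scale^~ u : k l / k + l}.
Proof. by move=> k l; rewrite /bipoly_scale polyCD scalerDl. Qed.

HB.instance Definition _ := GRing.Zmodule_isLmodule.Build C bipoly
  bipoly_scaleA bipoly_scale1 bipoly_scaleDr bipoly_scaleDl.

Definition bipoly_mul (a : {poly {poly C}}) (u : bipoly) : bipoly :=
  a * (u : {poly {poly C}}).

Fact bipoly_mul_linear a : linear (bipoly_mul a).
Proof.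
move=> k u v; rewrite /bipoly_mul /GRing.scale /= /bipoly_scale.
by rewrite mulrDr -scalerAr.
Qed.

HB.instance Definition _ a := GRing.isLinear.Build C bipoly bipoly *:%R
  (bipoly_mul a) (bipoly_mul_linear a).

Definition bipoly_eval (s p : C) (u : bipoly) : C := (u : {poly {poly C}}).[s%:P].[p].

Fact bipoly_eval_linear s p : scalar (bipoly_eval s p).
Proof.
move=> k u v; rewrite /bipoly_eval /GRing.scale /= /bipoly_scale.
by rewrite hornerD hornerZ hornerD hornerM hornerC.
Qed.

HB.instance Definition _ s p := GRing.isLinear.Build C bipoly C *%R
  (bipoly_eval s p) (bipoly_eval_linear s p).

(** The class of u in C[s,p]/(g, p), in the basis of the powers of s. Monicity is an argument
    because the linear structure attached to this map depends on it. *)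
Definition residue (g : {poly {poly C}}) of g \is monic := fun u : bipoly =>
  \col_(i < (size g).-1) ((Pdiv.Ring.rmodp (u : {poly {poly C}}) g)`_i).[0] : 'cV[C]_(size g).-1.

Fact residue_linear g (gm : g \is monic) : linear (residue gm).
Proof.
move=> k u v; apply/colP => i; rewrite !mxE /GRing.scale /= /bipoly_scale.
by rewrite Pdiv.RingMonic.rmodpD // Pdiv.RingMonic.rmodpZ // coefD coefZ hornerD hornerM hornerC.
Qed.

HB.instance Definition _ g (gm : g \is monic) := GRing.isLinear.Build C bipoly
  'cV[C]_(size g).-1 *:%R (residue gm) (residue_linear gm).

End Bipoly.

(** * The inner product over the circle and boundedness of point evaluations *)

Section FibreForm.
Variable R : realType.
Local Notation C := R[i].
Variable g : {poly {poly C}}.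
Hypothesis gm : g \is monic.
Hypothesis g_circle : forall s p : C, `|p| = 1 -> g.[s%:P].[p] = 0 -> s = p * s^*.
Hypothesis g_le2 : forall s p : C, `|p| = 1 -> g.[s%:P].[p] = 0 -> `|s| <= 2.
Variable N : nat -> {poly C}.
Hypothesis NE : forall k p, power_sum (fibre_roots g p) k = (N k).[p].
Local Notation d := (size g).-1.
Implicit Types (u v w : bipoly R) (p s a : C).

(** The trace of s^j u from C[s,p]/(g) down to C[p], written through power sums so that it is
    visibly a polynomial in p. *)
Definition trace (u : {poly {poly C}}) j : {poly C} := \sum_(i < size u) u`_i * N (j + i)%N.

Lemma traceE (u : {poly {poly C}}) j p :
  \sum_(r <- fibre_roots g p) r ^+ j * u.[r%:P].[p] = (trace u j).[p].
Proof.
rewrite /trace horner_sum.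
under eq_bigr => r _ do rewrite [u.[_]]horner_coef horner_sum mulr_sumr.
rewrite exchange_big; apply: eq_bigr => i _; rewrite hornerM -NE mulr_sumr.
by apply: eq_bigr => r _; rewrite hornerM -polyC_exp hornerC exprD mulrCA.
Qed.

Definition fibre_form u v p : C :=
  \sum_(r <- fibre_roots g p) bipoly_eval r p u * (bipoly_eval r p v)^*.

Lemma eq_fibre_form u v u' v' p :
  (forall r, g.[r%:P].[p] = 0 ->
    bipoly_eval r p u * (bipoly_eval r p v)^* = bipoly_eval r p u' * (bipoly_eval r p v')^*) ->
  fibre_form u v p = fibre_form u' v' p.
Proof.
move=> h; apply: eq_big_seq => r; rewrite (mem_fibre_roots gm) => /eqP; exact: h.
Qed.

(** On the circle conj(r) = r / p for each root r, which makes the conjugate value of v a polynomial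
    in r; summing over the roots leaves only traces of s^j u. *)
Lemma fibre_form_trigonometric u v : trigonometric (fibre_form u v).
Proof.
pose b : {poly {poly C}} := v.
pose phi a := \sum_(j < size b) ((b`_j).[a])^* * a^-1 ^+ j * (trace u j).[a].
apply: (@eq_trigonometric _ phi).
  move=> a a1; rewrite /phi; under [RHS]eq_bigr => j _ do rewrite -traceE mulr_sumr.
  rewrite exchange_big; apply: eq_big_seq => r; rewrite (mem_fibre_roots gm) => /eqP gr.
  rewrite /bipoly_eval -/b [b.[_]]horner_coef horner_sum rmorph_sum mulr_sumr.
  apply: eq_bigr => j _; rewrite hornerM -polyC_exp hornerC rmorphM rmorphXn /=.
  by rewrite (conj_fibre_root g_circle a1 gr) exprMn; ring.
apply: trigonometric_sum => j; apply: trigonometricM; last exact: trigonometric_poly.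
by apply: trigonometricM; [exact: trigonometric_conj_poly|exact: trigonometric_expV].
Qed.

Definition form u v : C := mean (fibre_form u v).

Lemma formDl u v w : form (u + v) w = form u w + form v w.
Proof.
rewrite -meanD; try exact: fibre_form_trigonometric.
apply: eq_mean => [|a a1].
  by apply: trigonometricD; exact: fibre_form_trigonometric.
by rewrite /fibre_form -big_split; apply: eq_bigr => r _; rewrite linearD mulrDl.
Qed.

Lemma formZl k u v : form (k *: u) v = k * form u v.
Proof.
rewrite -meanZ; last exact: fibre_form_trigonometric.
apply: eq_mean => [|a a1].
  by apply: trigonometricM (trigonometric_cst _) _; exact: fibre_form_trigonometric.
by rewrite /fibre_form mulr_sumr; apply: eq_bigr => r _; rewrite linearZ mulrA.
Qed.

Lemma form_conj u v : form v u = (form u v)^*.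
Proof.
rewrite -mean_conj; last exact: fibre_form_trigonometric.
congr mean; apply: funext => a; rewrite /fibre_form rmorph_sum; apply: eq_bigr => r _.
by rewrite rmorphM /= conjCK mulrC.
Qed.

Lemma fibre_form_ge0 u a : 0 <= fibre_form u u a.
Proof. by apply: sumr_ge0 => r _; rewrite -normCK exprn_ge0. Qed.

Lemma form_ge0 u : 0 <= form u u.
Proof.
by apply: mean_ge0 => [|a _]; [exact: fibre_form_trigonometric|exact: fibre_form_ge0].
Qed.

Lemma eq_form u v u' v' : (forall r a, `|a| = 1 -> g.[r%:P].[a] = 0 ->
    bipoly_eval r a u * (bipoly_eval r a v)^* = bipoly_eval r a u' * (bipoly_eval r a v')^*) ->
  form u v = form u' v'.
Proof.
move=> h; apply: eq_mean => [|a a1]; first exact: fibre_form_trigonometric.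
by apply: eq_fibre_form => r; exact: h.
Qed.

Lemma bipoly_eval_mul (b : {poly {poly C}}) s p u :
  bipoly_eval s p (bipoly_mul b u) = b.[s%:P].[p] * bipoly_eval s p u.
Proof. by rewrite /bipoly_eval /bipoly_mul !hornerM. Qed.

Local Notation P := (bipoly_mul ('X%:P)).
Local Notation S := (bipoly_mul 'X).

Lemma form_P u v : form (P u) (P v) = form u v.
Proof.
apply: eq_form => r a a1 _; rewrite !bipoly_eval_mul hornerC hornerX rmorphM /=.
by rewrite mulrACA -normCK a1 expr1n mul1r.
Qed.

Lemma form_S u v : form (S u) v = form (P u) (S v).
Proof.
apply: eq_form => r a a1 gr; rewrite !bipoly_eval_mul hornerC !hornerX hornerC rmorphM /=.
by rewrite {1}(g_circle a1 gr); ring.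
Qed.

Lemma form_S_le u : form (S u) (S u) <= 4 * form u u.
Proof.
rewrite -meanZ; last exact: fibre_form_trigonometric.
apply: ler_mean => [||a a1]; first exact: fibre_form_trigonometric.
  by apply: trigonometricM (trigonometric_cst _) _; exact: fibre_form_trigonometric.
rewrite /fibre_form mulr_sumr; rewrite big_seq [leRHS]big_seq; apply: ler_sum => r.
rewrite (mem_fibre_roots gm) => /eqP gr.
rewrite bipoly_eval_mul hornerX hornerC rmorphM mulrACA -!normCK.
rewrite ler_wpM2r ?exprn_ge0 //.
have -> : (4 : C) = 2 ^+ 2 by rewrite -natrX.
by rewrite lerXn2r ?nnegrE // (g_le2 a1 gr).
Qed.

Lemma trace_form_le u j a : `|a| = 1 ->
  `|(trace u j).[a]| ^+ 2 <= (d%:R * 4 ^+ j) * fibre_form u u a.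
Proof.
move=> a1; rewrite -traceE (le_trans (sqr_sum_le _ _)) //.
rewrite (size_monic_fibre_roots gm) -mulrA ler_wpM2l // /fibre_form mulr_sumr.
rewrite big_seq [leRHS]big_seq; apply: ler_sum => r; rewrite (mem_fibre_roots gm) => /eqP gr.
rewrite normrM exprMn normrX -[bipoly_eval _ _ _ * _]normCK ler_wpM2r ?exprn_ge0 //.
rewrite -exprM mulnC exprM lerXn2r ?nnegrE ?exprn_ge0 //.
have -> : (4 : C) = 2 ^+ 2 by rewrite -natrX.
by rewrite lerXn2r ?nnegrE // (g_le2 a1 gr).
Qed.

Definition form_norm u : C := sqrtC (form u u).

Lemma form_norm_ge0 u : 0 <= form_norm u.
Proof. by rewrite sqrtC_ge0 form_ge0. Qed.

Lemma trace_coef_le u j m :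
  `|(trace u j)`_m| <= sqrtC (d%:R * 4 ^+ j) * form_norm u.
Proof.
have c0 : 0 <= d%:R * 4 ^+ j :> C by rewrite mulr_ge0 ?exprn_ge0.
rewrite -(ler_pXn2r (n := 2)) ?nnegrE ?mulr_ge0 ?sqrtC_ge0 ?form_ge0 //.
rewrite exprMn !sqrtCK -meanZ; last exact: fibre_form_trigonometric.
rewrite -(@mean_coef _ (fun a => a^-1 ^+ m * (trace u j).[a]) m (trace u j)) //.
apply: mean_sqr_le => [||a a1].
- by apply: trigonometricM (trigonometric_expV _ _) (trigonometric_poly _).
- by apply: trigonometricM (trigonometric_cst _) _; exact: fibre_form_trigonometric.
by rewrite normrM normrX normfV a1 invr1 expr1n mul1r trace_form_le.
Qed.

Definition bounded (l : bipoly R -> C) :=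
  exists2 c, 0 <= c & forall u, `|l u| <= c * form_norm u.

Lemma eq_bounded l l' : l =1 l' -> bounded l -> bounded l'.
Proof. by move=> e [c c0 h]; exists c => // u; rewrite -e. Qed.

Lemma boundedD l l' : bounded l -> bounded l' -> bounded (fun u => l u + l' u).
Proof.
move=> [c c0 h] [c' c'0 h']; exists (c + c') => [|u]; first by rewrite addr_ge0.
by rewrite (le_trans (ler_normD _ _)) // mulrDl lerD.
Qed.

Lemma boundedZ k l : bounded l -> bounded (fun u => k * l u).
Proof.
move=> [c c0 h]; exists (`|k| * c) => [|u]; first by rewrite mulr_ge0.
by rewrite normrM -mulrA ler_wpM2l.
Qed.

Lemma bounded_sum (I : Type) (r : seq I) (l : I -> bipoly R -> C) :
  (forall i, bounded (l i)) -> bounded (fun u => \sum_(i <- r) l i u).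
Proof.
move=> h; elim: r => [|i r IH].
  by exists 0 => // u; rewrite big_nil normr0 mul0r.
by apply: eq_bounded (boundedD (h i) IH) => u; rewrite big_cons.
Qed.

Lemma trace_coef_bounded j m : bounded (fun u => (trace u j)`_m).
Proof.
exists (sqrtC (d%:R * 4 ^+ j)) => [|u]; last exact: trace_coef_le.
by rewrite sqrtC_ge0 mulr_ge0 ?exprn_ge0.
Qed.

(** All coefficients of the trace obey one bound, so its value at p is dominated by a geometric
    series in |p|. *)
Lemma trace_eval_bounded j p : `|p| < 1 -> bounded (fun u => (trace u j).[p]).
Proof.
move=> p1; have c0 : 0 <= sqrtC (d%:R * 4 ^+ j) :> C.
  by rewrite sqrtC_ge0 mulr_ge0 ?exprn_ge0.
exists (sqrtC (d%:R * 4 ^+ j) * (1 - `|p|)^-1) => [|u].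
  by rewrite mulr_ge0 // invr_ge0 subr_ge0 ltW.
rewrite horner_coef (le_trans (ler_norm_sum _ _ _)) // mulrAC.
rewrite (le_trans _ (ler_wpM2l _ (geometric_bound (size (trace u j)) (normr_ge0 p) p1))) //.
  rewrite mulr_sumr ler_sum // => i _; rewrite normrM normrX ler_wpM2r ?exprn_ge0 //.
  exact: trace_coef_le.
by rewrite mulr_ge0 ?form_norm_ge0.
Qed.

Local Notation rem u := (Pdiv.Ring.rmodp (u : {poly {poly C}}) g).

Lemma size_rem (u : {poly {poly C}}) : (size (rem u) <= d)%N.
Proof.
have g0 : g != 0 by rewrite monic_neq0.
by rewrite -ltnS prednK ?size_poly_gt0 // Pdiv.Ring.ltn_rmodp.
Qed.

Lemma eval_rem (u : {poly {poly C}}) s p : g.[s%:P].[p] = 0 ->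
  (rem u).[s%:P].[p] = u.[s%:P].[p].
Proof.
move=> gs; rewrite {2}(Pdiv.RingMonic.rdivp_eq gm u) !hornerD hornerM hornerM gs mulr0.
by rewrite add0r.
Qed.

Lemma trace_rem (u : {poly {poly C}}) j :
  trace u j = \sum_(i < d) (rem u)`_i * N (j + i)%N.
Proof.
apply/eqP; rewrite -subr_eq0; apply/eqP/disk_points_neq0 => p _.
apply/eqP; rewrite hornerD hornerN subr_eq0 -traceE; apply/eqP.
transitivity (\sum_(r <- fibre_roots g p) r ^+ j * (rem u).[r%:P].[p]).
  by apply: eq_big_seq => r; rewrite (mem_fibre_roots gm) => /eqP gr; rewrite eval_rem.
rewrite horner_sum.
under eq_bigr => r _ do rewrite (horner_coef_wide _ (size_rem u)) horner_sum mulr_sumr.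
rewrite exchange_big; apply: eq_bigr => i _; rewrite hornerM -NE mulr_sumr.
by apply: eq_bigr => r _; rewrite hornerM -polyC_exp hornerC exprD mulrCA.
Qed.

Let H : 'M[{poly C}]_d := \matrix_(i < d, j < d) N (i + j)%N.

(** Cramer's rule: the Hankel matrix H sends the coefficients of the remainder to the traces of s^j
    u. *)
Lemma det_rem_coef (u : {poly {poly C}}) (i : 'I_d) :
  \det H * (rem u)`_i = \sum_(j < d) \adj H i j * trace u j.
Proof.
pose x : 'cV[{poly C}]_d := \col_l (rem u)`_l.
have : \adj H *m (H *m x) = \det H *: x by rewrite mulmxA mul_adj_mx mul_scalar_mx.
move=> /colP/(_ i); rewrite !mxE => <-; apply: eq_bigr => j _; congr (_ * _).
rewrite mxE trace_rem; apply: eq_bigr => l _; by rewrite !mxE mulrC.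
Qed.

Hypothesis H0 : \det H != 0.

Lemma residue_bounded i : bounded (fun u => residue gm u i 0).
Proof.
(* The discriminant may vanish at p = 0, so its value there cannot be divided out. With m its order
   of vanishing, the coefficient of index m of det H times a coefficient of the remainder is (det
   H)_m times the value of the latter at 0. *)
have [m Hm mmin] : exists2 m, (\det H)`_m != 0 & forall k, (k < m)%N -> (\det H)`_k = 0.
  have ex : exists m, (\det H)`_m != 0.
    by exists (size (\det H)).-1; rewrite -/(lead_coef _) lead_coef_eq0.
  case: (ex_minnP ex) => m hm hmin; exists m => // k km; apply/eqP; apply: contraTT km.
  by rewrite -leqNgt; exact: hmin.
pose l u := ((\det H)`_m)^-1 * \sum_(j < d) \sum_(k < m.+1)
    (\adj H i j)`_k * (trace u j)`_(m - k).
apply: (@eq_bounded l); last first.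
  apply: boundedZ; apply: bounded_sum => j; apply: bounded_sum => k.
  by apply: boundedZ; exact: trace_coef_bounded.
move=> u; apply: (mulfI Hm); rewrite mulVKf // mxE horner_coef0.
have := coefM (\det H) (rem u)`_i m; rewrite big_ord_recr big1 /= => [|k _]; last by rewrite mmin ?mul0r //=.
rewrite add0r subnn => <-; rewrite det_rem_coef [RHS]coef_sum; apply: eq_bigr => k _.
by rewrite coefM.
Qed.

Lemma eval_bounded s p : `|p| < 1 -> (\det H).[p] != 0 -> g.[s%:P].[p] = 0 ->
  bounded (bipoly_eval s p).
Proof.
move=> p1 Hp gs.
pose l u := (\det H).[p]^-1 * \sum_(i < d) s ^+ i *
    \sum_(j < d) (\adj H i j).[p] * (trace u j).[p].
apply: (@eq_bounded l); last first.
  apply: boundedZ; apply: bounded_sum => i; apply: boundedZ; apply: bounded_sum => j.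
  by apply: boundedZ; exact: trace_eval_bounded.
move=> u; apply: (mulfI Hp); rewrite mulVKf // /bipoly_eval -(eval_rem u gs).
rewrite (horner_coef_wide _ (size_rem u)) [X in _ = _ * X]horner_sum mulr_sumr.
apply: eq_bigr => i _; rewrite hornerM -polyC_exp hornerC mulrA -hornerM det_rem_coef mulrC.
by congr (_ * _); rewrite [RHS]horner_sum; apply: eq_bigr => j _; rewrite hornerM.
Qed.

(** The companion matrix of g(., 0), that is, multiplication by s modulo (g, p). *)
Definition residue_mul : 'M[C]_d := \matrix_(i < d, j < d) ((rem ('X * 'X^j))`_i).[0].

Lemma residue_P u : residue gm (P u) = 0.
Proof.
apply/colP => i; rewrite !mxE /bipoly_mul mul_polyC Pdiv.RingMonic.rmodpZ //.
by rewrite coefZ hornerM hornerX mul0r.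
Qed.

Lemma rem_sum (u : {poly {poly C}}) : rem u = \sum_(j < d) (rem u)`_j *: 'X^j.
Proof.
apply/polyP => i; rewrite coef_sum; have [ri|ri] := ltnP i d.
  rewrite (bigD1 (Ordinal ri)) //= coefZ coefXn eqxx mulr1 big1 ?addr0 // => j ji.
  rewrite coefZ coefXn; case: eqP => [e|]; last by rewrite mulr0.
  by case/eqP: ji; apply: val_inj.
rewrite nth_default ?(leq_trans (size_rem u)) // big1 // => j _.
by rewrite coefZ coefXn gtn_eqF ?mulr0 // (leq_trans (ltn_ord j)).
Qed.

Lemma residue_S u : residue gm (S u) = residue_mul *m residue gm u.
Proof.
apply/colP => i; rewrite !mxE /bipoly_mul -Pdiv.RingMonic.rmodp_mulmr // [rem u]rem_sum.
rewrite mulr_sumr Pdiv.RingMonic.rmodp_sum // coef_sum horner_sum; apply: eq_bigr => j _.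
by rewrite !mxE -scalerAr Pdiv.RingMonic.rmodpZ // coefZ hornerM mulrC.
Qed.

(** A remainder that vanishes at p = 0 has the form p w, and u - p w vanishes on Z(g), so it is a
    null vector. *)
Lemma residue_ker u : residue gm u = 0 -> exists w, form (u - P w) (u - P w) = 0.
Proof.
move=> u0; have : fibre 0 (rem u) = 0.
  apply/polyP => i; rewrite coef_fibre coef0; have [ri|ri] := ltnP i d.
    by have /colP/(_ (Ordinal ri)) := u0; rewrite !mxE.
  by rewrite nth_default ?horner0 ?(leq_trans (size_rem u)).
move=> /fibre_eq0_dvd[w wE]; exists w.
rewrite -[RHS](coef0 C 0) -(@mean_coef _ (fun=> 0) 0 0) => [|a _]; last by rewrite horner0 mulr0.
apply: eq_mean (trigonometric_cst 0) _ => a a1.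
apply: big1_seq => r /=; rewrite (mem_fibre_roots gm) => /eqP gr.
have -> : bipoly_eval r a (u - P w) = 0; last by rewrite mul0r.
rewrite linearB /= bipoly_eval_mul /bipoly_eval -(eval_rem u gr) wE hornerM hornerC.
by rewrite hornerM hornerC polyC0 subr0 subrr.
Qed.

Lemma residue_surj (i : 'I_d) : exists u, residue gm u = delta_mx i 0.
Proof.
exists ('X^i : {poly {poly C}}); apply/colP => j; rewrite !mxE.
rewrite Pdiv.Ring.rmodp_small; last first.
  by rewrite size_polyXn -ltn_predRL.
by rewrite coefXn andbT -(inj_eq val_inj) /=; case: eqP => _; rewrite ?hornerC ?horner0.
Qed.

(** If roots coincide, the product over the distinct ones has degree below d, and its coefficients
    form a kernel vector of the Hankel matrix at p. *)
Lemma uniq_fibre_roots p : (\det H).[p] != 0 -> uniq (fibre_roots g p).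
Proof.
apply: contraNT => nu; pose rs := undup (fibre_roots g p).
pose e := \prod_(r <- rs) ('X - r%:P).
have se : (size e <= d)%N.
  rewrite size_prod_XsubC -(size_monic_fibre_roots gm p).
  by rewrite ltn_size_undup.
rewrite -[_.[p]]/(horner_eval p _) -det_map_mx; apply/det0P.
exists (\row_i e`_i).
  have : e != 0 by rewrite monic_neq0 // monic_prod_XsubC.
  apply: contraNneq => e0; apply/eqP/polyP => i; rewrite coef0.
  have [id|id] := ltnP i d; last by rewrite nth_default // (leq_trans se).
  by have /rowP/(_ (Ordinal id)) := e0; rewrite !mxE.
apply/rowP => j; rewrite !mxE.
transitivity (\sum_(r <- fibre_roots g p) e.[r] * r ^+ j).
  under [RHS]eq_bigr => r _ do rewrite (horner_coef_wide _ se) mulr_suml.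
  rewrite exchange_big; apply: eq_bigr => i _; rewrite !mxE /= /horner_eval -NE mulr_sumr.
  by apply: eq_bigr => r _; rewrite exprD mulrA.
apply: big1_seq => r /= hr; have : root e r by rewrite root_prod_XsubC mem_undup.
by move=> /eqP ->; rewrite mul0r.
Qed.

(** Over a p in the disk with det H(p) nonzero, evaluations at the d distinct roots of g(., p) are
    eigenfunctionals. Each root is thus an eigenvalue of the pencil, and the two monic polynomials
    of degree d agree. *)
Lemma pencil_of_fibre_form : exists F : 'M[C]_d, pencil_poly F = g.
Proof.
have [cT cT0 Tb] : exists2 cT : C, 0 < cT & forall u i, `|residue gm u i 0| ^+ 2 <= cT * form u u.
  have hex (i : 'I_d) : exists c, 0 <= c /\ forall u, `|residue gm u i 0| <= c * form_norm u.
    by have [c c0 h] := residue_bounded i; exists c.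
  have [c hc] := choice hex; exists (1 + \sum_i c i ^+ 2) => [|u i].
    rewrite ltr_pwDl // sumr_ge0 // => i _; rewrite exprn_ge0 //; exact: (hc i).1.
  apply: (@le_trans _ _ (c i ^+ 2 * form u u)).
    rewrite -[form u u]sqrtCK -exprMn lerXn2r ?nnegrE ?(hc i).2 //.
    by rewrite mulr_ge0 ?form_norm_ge0 ?(hc i).1.
  rewrite ler_wpM2r ?form_ge0 // (bigD1 i) //= addrCA lerDl addr_ge0 // sumr_ge0 // => j _.
  by rewrite exprn_ge0 // (hc j).1.
have PS u : P (S u) = S (P u) by rewrite /bipoly_mul mulrCA.
have [K [F [Kh Kp KF hF]]] := wandering_pencil formDl formZl form_conj form_ge0 PS
  form_P form_S form_S_le residue_P residue_S residue_ker residue_surj cT0 Tb.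
have [Y Yu KE] := positive_definite_factor Kh Kp.
have Yu' : Y ^t* \in unitmx by rewrite map_unitmx unitmx_tr.
(* Y carries the Gram inner product to the standard one: K F = A^* K becomes M^* = Y A Y^-1, so M^*
   + p M is conjugate to A + p F. *)
pose M := Y *m F *m invmx Y.
have ME : M ^t* = Y *m residue_mul *m invmx Y.
  have : M = invmx (Y ^t*) *m residue_mul ^t* *m Y ^t*.
    apply: (can_inj (mulKmx Yu')); rewrite !mulmxA mulmxV // mul1mx.
    by rewrite -KE KF KE !mulmxA mulmxK.
  move=> ->; rewrite !trmx_mul !map_mxM /= !trmxCK mulmxA.
  by rewrite trmx_inv map_invmx /= trmxCK.
exists M; apply/eqP; rewrite -subr_eq0; apply/eqP.
(* The factor det H discards the p over which g(., p) may have multiple roots. *)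
suff : (\det H)%:P * (pencil_poly M - g) = 0.
  by move/eqP; rewrite mulf_eq0 polyC_eq0 (negPf H0) => /eqP.
apply: disk_fibre_eq0 => p p1; rewrite rmorphM rmorphB /= fibreC.
have [->|Hp] := eqVneq (\det H).[p] 0; first by rewrite mul0r.
suff -> : fibre p (pencil_poly M) = fibre p g by rewrite subrr mulr0.
rewrite fibre_pencil_poly (monic_fibre_prod gm p).
have Hm := char_poly_monic (M ^t* + p *: M).
rewrite [LHS](@all_roots_prod_XsubC _ _ (fibre_roots g p)) ?(monicP Hm) ?scale1r //.
- by rewrite size_char_poly (size_monic_fibre_roots gm).
- apply/allP => s; rewrite (mem_fibre_roots gm) => /eqP gs.
  have [Gam G0 hk] := eval_bounded p1 Hp gs.
  have [|v|v|v||kap kap0 kapE] := hF (bipoly_eval s p) (Gam ^+ 2) p s _ _ _ _ p1.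
  + by rewrite exprn_ge0.
  + rewrite -[form v v]sqrtCK -exprMn lerXn2r ?nnegrE ?hk //.
    by rewrite mulr_ge0 ?form_norm_ge0.
  + by rewrite /= bipoly_eval_mul hornerC hornerX.
  + by rewrite /= bipoly_eval_mul hornerX hornerC.
  + by exists (1 : {poly {poly C}}); rewrite /= /bipoly_eval !hornerC oner_eq0.
  rewrite -eigenvalue_root_char; apply/eigenvalueP; exists (kap *m invmx Y).
    rewrite ME /M scalemxAl -mulmxDl scalemxAr -mulmxDr !mulmxA mulmxKV //.
    by rewrite kapE scalemxAl.
  by apply: contra kap0 => /eqP/(congr1 (mulmx^~ Y)); rewrite mulmxKV // mul0mx => ->.
- by rewrite uniq_rootsE uniq_fibre_roots.
Qed.

End FibreForm.

(** * Realization of distinguished varieties and conclusion *)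

Lemma bG_conj (R : realType) (s p : R[i]) : bG (s, p) -> s = p * s^* /\ `|s| <= 2.
Proof.
have [z1 [z2 [hs hp]]] := symm_roots s p.
move=> /(bGP hs hp)[h1 h2]; split; last first.
  by rewrite hs (le_trans (ler_normD _ _)) // h1 h2.
have e1 : z1 * z1^* = 1 by rewrite -normCK h1 expr1n.
have e2 : z2 * z2^* = 1 by rewrite -normCK h2 expr1n.
rewrite hs hp rmorphD /= mulrDr -mulrA [z2 * z1^*]mulrC mulrA e1 mul1r.
by rewrite -mulrA e2 mulr1 addrC.
Qed.

Theorem distinguished_realization (R : realType) (W : set (R[i] * R[i])) :
  distinguished_variety W ->
  (forall V, irreducible_component W V -> V `&` G !=set0) ->
  exists (d : nat) (F : 'M[R[i]]_d),
    [/\ (0 < d)%N, numerical_contraction F, completely_nonunitary F & W = W_of F].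
Proof.
move=> dW cW; have [g [WE gm sg gG gmin]] := distinguished_normal_form dW cW.
have gb := circle_roots_bG gm sg gG.
have g_circle (s p : R[i]) : `|p| = 1 -> g.[s%:P].[p] = 0 -> s = p * s^*.
  by move=> p1 gs; have [] := bG_conj (gb _ _ p1 gs).
have g_le2 (s p : R[i]) : `|p| = 1 -> g.[s%:P].[p] = 0 -> `|s| <= 2.
  by move=> p1 gs; have [] := bG_conj (gb _ _ p1 gs).
have [N NE] := choice (power_sum_poly gm).
have H0 := hankel_det_neq0 gm g_circle gmin NE.
have [F FE] := pencil_of_fibre_form gm g_circle g_le2 NE H0.
have d0 : (0 < (size g).-1)%N by rewrite ltn_predRL.
have WF : W = W_of F by rewrite W_of_zero_set FE.
exists (size g).-1, F; split=> //.
- apply: numerical_contraction_pencil => s p p1; rewrite W_of_zero_set FE.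
  exact: g_le2.
- by apply: distinguished_cnu; rewrite -?WF.
Qed.

Theorem theorem2p5 (R : realType) :
  (forall (d : nat) (F : 'M[R[i]]_d), (0 < d)%N -> numerical_contraction F ->
     [/\ W_of F = [set sp : R[i] * R[i] |
                    joint_spectrum (F ^t* + sp.2 *: F) sp.2%:M sp],
         algebraic_variety (W_of F),
         W_of F `&` Gamma !=set0 &
         [<-> distinguished_variety (W_of F);
              completely_nonunitary F;
              spectrum F `&` circle = set0;
              W_of F `<=` @symm R @` (disk `*` disk `|` circle `*` circle
                                      `|` exterior_disk `*` exterior_disk);
              forall V, irreducible_component (W_of F) V -> V `&` G !=set0]])
  /\
  (forall W : set (R[i] * R[i]), distinguished_variety W ->
     (forall V, irreducible_component W V -> V `&` G !=set0) ->
     exists (d : nat) (F : 'M[R[i]]_d),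
       [/\ (0 < d)%N, numerical_contraction F, completely_nonunitary F &
           W = W_of F]).
Proof.
split; last exact: distinguished_realization.
move=> d F d0 nF; split.
- exact: W_of_joint_spectrum.
- by exists (pencil_poly F); exact: W_of_zero_set.
- exact: W_of_meets_Gamma.
tfae.
- exact: distinguished_cnu.
- exact: cnu_spectrum.
- exact: spectrum_W_of.
- exact: W_of_components.
- by move=> /(components_spectrum nF)/(spectrum_W_of nF); exact: W_of_distinguished.
Qed.
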